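(* For every prime power $q$ there exist a constant $c>0$ (depending only on $q$) and an infinite subset $\mathcal{N}\subseteq\mathbb{N}$ such that for every $n\in\mathcal{N}$ there is a triple $(Q^{(1)},Q^{(2)},Q^{(3)})$ of $[[n,k,d]]_q$ quantum CSS codes with $k\geq cn$ and $d\geq cn$ that supports a transversal $CCZ_q$ gate. Furthermore, if $q\geq 5$, then for every $n\in\mathcal{N}$ the triple can be taken with $Q^{(1)}=Q^{(2)}=Q^{(3)}$, so that this code also supports a transversal $U_q$ gate.
   Context: A quantum CSS code $\mathrm{CSS}(Q_X,Q_Z)$ of length $n$ over $\mathbb{F}_q$ is a pair of subspaces $Q_X,Q_Z\subseteq\mathbb{F}_q^n$ with $Q_X^\perp\subseteq Q_Z$ (duals w.r.t. $x\cdot y=\sum_ix_iy_i$), of dimension $k=\dim Q_Z-\dim Q_X^\perp$ and distance $d=\min\{|y|:y\in(Q_X\setminus Q_Z^\perp)\cup(Q_Z\setminus Q_X^\perp)\}$ (Hamming weight). A $Z$ encoding function is an $\mathbb{F}_q$-linear isomorphism $\mathrm{Enc}_Z:\mathbb{F}_q^k\to Q_Z/Q_X^\perp$. A triple $(Q^{(h)};\mathrm{Enc}^{(h)}_Z)_{h\in[3]}$ of $[[n,k]]_q$ codes supports a transversal $CCZ_q$ gate if there is $b\in\mathbb{F}_q^n$ such that for all $z^{(h)}\in\mathbb{F}_q^k$ and all $z^{(h)\prime}\in\mathrm{Enc}^{(h)}_Z(z^{(h)})$, $\sum_{j\in[k]}z^{(1)}_jz^{(2)}_jz^{(3)}_j=\sum_{j\in[n]}b_jz^{(1)\prime}_jz^{(2)\prime}_jz^{(3)\prime}_j$.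 A code supports a transversal $U_q$ gate if there is $b\in\mathbb{F}_q^n$ with $\sum_{j\in[k]}z_j^3=\sum_{j\in[n]}b_jz_j'^3$ for all $z\in\mathbb{F}_q^k$, $z'\in\mathrm{Enc}_Z(z)$. *)

(* Defs.v *)
From HB Require Import structures.
From mathcomp Require Import all_boot all_order all_algebra all_field.
Set Implicit Arguments. Unset Strict Implicit. Unset Printing Implicit Defensive.
Import GRing.Theory.
Local Open Scope ring_scope.

(* A finite field F plays the role of F_q, with q = #|F|.
   Subspaces of F^n are represented as row spaces of square matrices
   'M[F]_n (mxalgebra); vectors of F^n are row vectors 'rV[F]_n. *)

Definition dualmx (F : fieldType) (n : nat) (A : 'M[F]_n) : 'M[F]_n :=
  kermx A^T.

Definition wt (F : fieldType) (n : nat) (y : 'rV[F]_n) : nat :=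
  #|[set j : 'I_n | y 0 j != 0]|.

Record css (F : fieldType) (n : nat) := CSS { QX : 'M[F]_n; QZ : 'M[F]_n }.

Definition css_valid (F : fieldType) (n : nat) (Q : css F n) : Prop :=
  (dualmx (QX Q) <= QZ Q)%MS.

Definition css_dim (F : fieldType) (n : nat) (Q : css F n) : nat :=
  (\rank (QZ Q) - \rank (dualmx (QX Q)))%N.

Definition css_logical (F : finFieldType) (n : nat) (Q : css F n)
  (y : 'rV[F]_n) : bool :=
  ((y <= QX Q)%MS && ~~ (y <= dualmx (QZ Q))%MS)
  || ((y <= QZ Q)%MS && ~~ (y <= dualmx (QX Q))%MS).

(* distance: minimum weight over the logical set (value n if it is empty) *)
Definition css_dist (F : finFieldType) (n : nat) (Q : css F n) : nat :=
  \big[minn/n]_(y : 'rV[F]_n | css_logical Q y) wt y.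

(* A Z encoding function F^k -> Q_Z / Q_X^perp, represented by a linear lift
   E : F^k -> F^n (z |-> z *m E) with values in Q_Z that induces an
   isomorphism onto the quotient Q_Z / Q_X^perp.  The coset Enc_Z(z) is
   { z *m E + w | w in Q_X^perp }. *)
Definition is_encZ (F : fieldType) (n k : nat) (Q : css F n)
  (E : 'M[F]_(k, n)) : Prop :=
  [/\ (E <= QZ Q)%MS,
      (forall z : 'rV[F]_k, (z *m E <= dualmx (QX Q))%MS -> z = 0)
    & (QZ Q <= E + dualmx (QX Q))%MS ].

Definition in_enc (F : fieldType) (n k : nat) (Q : css F n)
  (E : 'M[F]_(k, n)) (z : 'rV[F]_k) (z' : 'rV[F]_n) : Prop :=
  (z' - z *m E <= dualmx (QX Q))%MS.

Definition supports_CCZ (F : fieldType) (n k : nat)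
  (Q1 Q2 Q3 : css F n) (E1 E2 E3 : 'M[F]_(k, n)) : Prop :=
  exists b : 'rV[F]_n,
    forall (z1 z2 z3 : 'rV[F]_k) (z1' z2' z3' : 'rV[F]_n),
      in_enc Q1 E1 z1 z1' -> in_enc Q2 E2 z2 z2' -> in_enc Q3 E3 z3 z3' ->
      \sum_(j < k) z1 0 j * z2 0 j * z3 0 j
      = \sum_(j < n) b 0 j * z1' 0 j * z2' 0 j * z3' 0 j.

Definition supports_U (F : fieldType) (n k : nat)
  (Q : css F n) (E : 'M[F]_(k, n)) : Prop :=
  exists b : 'rV[F]_n,
    forall (z : 'rV[F]_k) (z' : 'rV[F]_n),
      in_enc Q E z z' ->
      \sum_(j < k) z 0 j ^+ 3 = \sum_(j < n) b 0 j * z' 0 j ^+ 3.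

Definition good_code (F : finFieldType) (n k : nat) (c : rat)
  (Q : css F n) (E : 'M[F]_(k, n)) : Prop :=
  [/\ css_valid Q, css_dim Q = k, is_encZ Q E,
      c * n%:R <= (css_dist Q)%:R & c * n%:R <= k%:R].

Definition infinite_natset (N : nat -> Prop) : Prop :=
  forall m : nat, exists n : nat, (m <= n)%N /\ N n.

(* Main.v *)
(** Let [q = #|F|] and let [K] be the quadratic extension of [F].  Starting from
    [y_0 = x], the equations [y_(i+1)^(q+1) = (y_i + 1)^(q+1) - 1] define a tame
    tower over [K(x)] that is ramified only above roots of [x^(q^2) - x] and in which
    the place at infinity splits completely.  In a Galois closure [L] of degree [d]
    over [K(x)], words are the families, over the [d] places at infinity, of jets of
    bounded length of functions integral over [K[x]] with poles of bounded order.  A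
    nonzero function has a nonzero polynomial as norm, so few of its jets vanish;
    since the tower is tame, the trace dual of a reduced integral basis has bounded
    degree, so that reduced bases have bounded degree and few jets can be prescribed
    arbitrarily.  These two facts replace Riemann-Roch.  Products of four words
    still do not fill the space of all jets, so a nonzero linear functional kills
    them; composed with the multiplication by a suitable word, it kills all products
    of three words and takes the value [1] at [1] in a positive proportion of blocks.

    The resulting sum of local trilinear forms over [K] becomes a diagonal
    cubic form over [F] after each jet is re-encoded by sufficiently many
    [F]-linear functionals: coordinates in general, one common family when cubes of
    linear forms span all symmetric trilinear forms.  Putting the message as constants
    on some blocks and deleting these blocks gives the CSS codes: the distance in [Z]
    comes from the distance of the words, the one in [X] from interpolation. *)

From HB Require Import structures.
Require Import Defs.
From mathcomp Require Import all_boot all_order all_algebra all_field.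
From mathcomp Require Import all_fingroup all_solvable.
From mathcomp Require Import boolp.
From mathcomp Require classical_sets.
From mathcomp Require Import zify ring.
Set Implicit Arguments. Unset Strict Implicit. Unset Printing Implicit Defensive.
Import GRing.Theory.
Local Open Scope ring_scope.

(** * Valuation rings *)

(** Passing to the Galois closure makes the group permute the places at infinity simply
    transitively, so one valuation ring [V] and the conjugates [act g f] carry all local data;
    divisors and genus never appear. What a genus bound would give comes from the degree [q^2] of
    [x^(q^2) - x]: it bounds the codifferent, hence the degrees in a reduced basis.

    Two things force the constants to be [K], with [q^2] elements: the group moves each [y_i] by a
    [(q+1)]-th root of unity, and the residues of [y_i / x] at infinity satisfy [k^(q^2-1) = 1].

    The jet length [16 q^2] is found as follows. Interpolation costs degree [2 q^2]: [q^2] for a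
    function vanishing on the chosen blocks and [q^2] for an approximation. A product of four words
    has degree [8 q^2], half the jet length, so a nonzero one vanishes on at most half of the
    blocks. The fourth factor is there only to normalise the functional on the message blocks. *)

Section ValuationRings.
Variable L : fieldType.
Implicit Types (B V : L -> Prop) (x y z : L).

Definition sub_ring B :=
  [/\ B 1, forall x y, B x -> B y -> B (x - y) & forall x y, B x -> B y -> B (x * y)].

Section SubRing.
Variable B : L -> Prop.
Hypothesis HB : sub_ring B.

Lemma sub_ring1 : B 1. Proof. by case: HB. Qed.
Lemma sub_ringB x y : B x -> B y -> B (x - y). Proof. by case: HB => _ + _; apply. Qed.
Lemma sub_ringM x y : B x -> B y -> B (x * y). Proof. by case: HB => _ _; apply. Qed.
Lemma sub_ring0 : B 0. Proof. by rewrite -(subrr 1); apply: sub_ringB; apply: sub_ring1. Qed.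
Lemma sub_ringN x : B x -> B (- x).
Proof. by rewrite -sub0r; apply: sub_ringB; apply: sub_ring0. Qed.
Lemma sub_ringD x y : B x -> B y -> B (x + y).
Proof. by move=> Bx By; rewrite -(opprK y); apply: sub_ringB => //; apply: sub_ringN. Qed.
Lemma sub_ringX x n : B x -> B (x ^+ n).
Proof.
by move=> Bx; elim: n => [|n IH]; rewrite ?expr0 ?exprS;
  [apply: sub_ring1 | apply: sub_ringM].
Qed.
Lemma sub_ring_sum I (r : seq I) (P : pred I) (F : I -> L) :
  (forall i, P i -> B (F i)) -> B (\sum_(i <- r | P i) F i).
Proof. by move=> BF; apply: big_ind => //; [apply: sub_ring0 | apply: sub_ringD]. Qed.
Lemma sub_ring_prod I (r : seq I) (P : pred I) (F : I -> L) :
  (forall i, P i -> B (F i)) -> B (\prod_(i <- r | P i) F i).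
Proof. by move=> BF; apply: big_ind => //; [apply: sub_ring1 | apply: sub_ringM]. Qed.
Lemma sub_ring_nat n : B n%:R.
Proof. by elim: n => [|n IH]; rewrite ?mulrS; [apply: sub_ring0|apply: sub_ringD => //; apply: sub_ring1]. Qed.
Lemma sub_ring_horner (p : {poly L}) x : (forall i, B p`_i) -> B x -> B p.[x].
Proof.
move=> Bp Bx; rewrite horner_coef; apply: sub_ring_sum => i _.
by apply: sub_ringM => //; apply: sub_ringX.
Qed.
Lemma sub_ring_coefM (p q : {poly L}) :
  (forall i, B p`_i) -> (forall i, B q`_i) -> forall i, B (p * q)`_i.
Proof.
by move=> Bp Bq i; rewrite coefM; apply: sub_ring_sum => j _; apply: sub_ringM.
Qed.
Lemma sub_ring_det n (A : 'M[L]_n) : (forall i j, B (A i j)) -> B (\det A).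
Proof.
move=> BA; apply: sub_ring_sum => s _; apply: sub_ringM; last by apply: sub_ring_prod.
by apply: sub_ringX; apply: sub_ringN; apply: sub_ring1.
Qed.
Lemma sub_ring_adj n (A : 'M[L]_n) i j : (forall i j, B (A i j)) -> B ((\adj A) i j).
Proof.
move=> BA; rewrite mxE; apply: sub_ringM.
  by apply: sub_ringX; apply: sub_ringN; apply: sub_ring1.
by apply: sub_ring_det => k l; rewrite !mxE.
Qed.
End SubRing.

Definition valring V := sub_ring V /\ forall x, V x \/ V x^-1.

(* The maximal ideal; [0] needs a separate clause because [0^-1 = 0]. *)
Definition maxid V x := x = 0 \/ ~ V x^-1.

Section ValRing.
Variable V : L -> Prop.
Hypothesis HV : valring V.
Let HB := HV.1.
Notation m := (maxid V).

Lemma valringP x : V x \/ m x^-1.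
Proof.
have [Vx|nVx] := EM (V x); [by left | right; right].
by rewrite invrK.
Qed.

Lemma maxid_sub x : m x -> V x.
Proof.
move=> [->|nV]; first exact: (sub_ring0 HB).
by case: (HV.2 x).
Qed.

Lemma maxid0 : m 0. Proof. by left. Qed.

Lemma unitV x : V x -> ~ m x -> V x^-1 /\ x != 0.
Proof.
move=> Vx nm; split; first by case: (EM (V x^-1)) => // ?; case: nm; right.
by apply/eqP => x0; apply: nm; left.
Qed.

Lemma maxidN1 : ~ m 1.
Proof.
move=> [/eqP|]; first by rewrite oner_eq0.
by rewrite invr1; case; apply: (sub_ring1 HB).
Qed.

Lemma maxidMl x y : V x -> m y -> m (x * y).
Proof.
move=> Vx my; have [->|x0] := eqVneq x 0; first by left; rewrite mul0r.
case: my => [->|nVy]; first by left; rewrite mulr0.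
right => Vxy; apply: nVy.
have -> : y^-1 = x * (x * y)^-1.
  by rewrite invfM mulVKf.
exact: (sub_ringM HB).
Qed.

Lemma maxidMr x y : m x -> V y -> m (x * y).
Proof. by move=> mx Vy; rewrite mulrC; apply: maxidMl. Qed.

Lemma maxidN x : m x -> m (- x).
Proof.
move=> mx; rewrite -mulN1r; apply: maxidMl => //.
by apply: (sub_ringN HB (sub_ring1 HB)).
Qed.

Lemma maxidD x y : m x -> m y -> m (x + y).
Proof.
wlog : x y / V (x / y) => [IH mx my|Vxy mx my].
  case: (HV.2 (x / y)); first by move=> h; apply: IH.
  rewrite invf_div => h; rewrite addrC; exact: IH.
have [y0|y0] := eqVneq y 0; first by rewrite y0 addr0.
have -> : x + y = (x / y + 1) * y by rewrite mulrDl mul1r divfK.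
apply: maxidMl => //; apply: (sub_ringD HB) => //; exact: (sub_ring1 HB).
Qed.

Lemma maxidB x y : m x -> m y -> m (x - y).
Proof. by move=> mx my; apply: maxidD => //; apply: maxidN. Qed.

Lemma maxid_sum I (r : seq I) (P : pred I) (F : I -> L) :
  (forall i, P i -> m (F i)) -> m (\sum_(i <- r | P i) F i).
Proof. by move=> BF; apply: big_ind => //; [apply: maxid0 | apply: maxidD]. Qed.

Lemma maxid_prime x y : V x -> V y -> m (x * y) -> m x \/ m y.
Proof.
move=> Vx Vy mxy; have [mx|nmx] := EM (m x); [by left | right].
have [Vxi x0] := unitV Vx nmx.
by rewrite -(mulKf x0 y); apply: maxidMl.
Qed.

Lemma maxidX x n : V x -> m (x ^+ n) -> m x.
Proof.
move=> Vx; elim: n => [|n IH]; first by rewrite expr0 => /maxidN1.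
by rewrite exprS => /maxid_prime[] //; apply: (sub_ringX HB).
Qed.

Lemma maxidXp x n : (0 < n)%N -> m x -> m (x ^+ n).
Proof.
case: n => // n _ mx; rewrite exprS; apply: maxidMr => //.
by apply: (sub_ringX HB); apply: maxid_sub.
Qed.

Lemma maxid_prod_prime (I : eqType) (r : seq I) (F : I -> L) :
  (forall i, i \in r -> V (F i)) -> m (\prod_(i <- r) F i) -> exists2 i, i \in r & m (F i).
Proof.
elim: r => [|i r IH] VF; first by rewrite big_nil => /maxidN1.
rewrite big_cons => /maxid_prime[].
- by apply: VF; rewrite mem_head.
- by rewrite big_seq; apply: (sub_ring_prod HB) => j jr; apply: VF; rewrite inE jr orbT.
- by move=> mi; exists i; rewrite ?mem_head.
case/IH => [j jr|j jr mj]; first by apply: VF; rewrite inE jr orbT.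
by exists j; rewrite // inE jr orbT.
Qed.

(** Otherwise [y^-1] lies in the maximal ideal, and dividing the relation by [y ^+ n] puts 1 there
    too. *)
Lemma val_integral (c : nat -> L) y n :
  (forall i, (i < n)%N -> V (c i)) -> y ^+ n = \sum_(i < n) c i * y ^+ i -> V y.
Proof.
move=> Vc e; have [//|my] := valringP y.
have [y0|y0] := eqVneq y 0; first by rewrite y0; apply: (sub_ring0 HB).
case: n => [|n] in Vc e *.
  by move: e; rewrite expr0 big_ord0 => /eqP; rewrite oner_eq0.
have : m 1.
  have -> : 1 = \sum_(i < n.+1) c i * y^-1 ^+ (n.+1 - i).
    rewrite -[LHS](mulVf (expf_neq0 n.+1 y0)) {2}e mulr_sumr; apply: eq_bigr => i _.
    rewrite mulrCA; congr (_ * _); rewrite exprVn -{1}(subnK (ltnW (ltn_ord i))).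
    by rewrite exprD invfM mulfVK // expf_neq0.
  apply: maxid_sum => i _; apply: maxidMl; first exact: Vc.
  by apply: maxidXp; rewrite // subn_gt0.
by move=> /maxidN1.
Qed.

Lemma val_root y n : (0 < n)%N -> V (y ^+ n) -> V y.
Proof.
case: n => // n _ Vy; apply: (@val_integral (fun i => if i == 0 then y ^+ n.+1 else 0) y n.+1).
  by case=> [|i] _ //=; apply: (sub_ring0 HB).
rewrite big_ord_recl /= expr0 mulr1 big1 ?addr0 // => i _; exact: mul0r.
Qed.

(** Divisibility in [V] is a total preorder on nonzero elements. Dividing by the term found here
    normalises a family to have entries in [V] and one entry 1. *)
Lemma dominant n (c : 'I_n -> L) :
  (exists i, c i != 0) -> exists2 i, c i != 0 & forall j, V (c j / c i).
Proof.
elim: n c => [|n IH] c [i0 ci0]; first by case: i0 ci0.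
have [[i ci]|all0] := EM (exists i : 'I_n, c (lift ord0 i) != 0).
  have [j cj Vj] := IH (fun i => c (lift ord0 i)) (ex_intro _ i ci).
  have [z0|z0] := eqVneq (c ord0) 0.
    exists (lift ord0 j) => // l; case: (unliftP ord0 l) => [l' ->|->] //.
    by rewrite z0 mul0r; apply: (sub_ring0 HB).
  have [h|h] := HV.2 (c ord0 / c (lift ord0 j)).
    by exists (lift ord0 j) => // l; case: (unliftP ord0 l) => [l' ->|->].
  exists ord0 => // l; case: (unliftP ord0 l) => [l' ->|->].
    have -> : c (lift ord0 l') / c ord0 = (c (lift ord0 l') / c (lift ord0 j)) * (c ord0 / c (lift ord0 j))^-1.
      by rewrite invf_div mulrA divfK.
    exact: (sub_ringM HB).
  by rewrite divff //; apply: (sub_ring1 HB).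
have all0' i : c (lift ord0 i) = 0.
  by apply/eqP; case: eqP => // /eqP h; case: all0; exists i.
have z0 : c ord0 != 0 by case: (unliftP ord0 i0) ci0 => [l' ->|->] //; rewrite all0' eqxx.
exists ord0 => // l; case: (unliftP ord0 l) => [l' ->|->].
  by rewrite all0' mul0r; apply: (sub_ring0 HB).
by rewrite divff //; apply: (sub_ring1 HB).
Qed.

Lemma maxid_prod_congr I (r : seq I) (F F' : I -> L) :
  (forall i, V (F i)) -> (forall i, V (F' i)) -> (forall i, m (F i - F' i)) ->
  m (\prod_(i <- r) F i - \prod_(i <- r) F' i).
Proof.
move=> VF VF' mF; elim: r => [|i r IH]; first by rewrite !big_nil subrr; apply: maxid0.
rewrite !big_cons.
have -> : F i * \prod_(j <- r) F j - F' i * \prod_(j <- r) F' j =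
  (F i - F' i) * \prod_(j <- r) F j + F' i * (\prod_(j <- r) F j - \prod_(j <- r) F' j) by ring.
apply: maxidD; last exact: maxidMl.
by apply: maxidMr => //; apply: (sub_ring_prod HB).
Qed.

Lemma nmaxidD x y : ~ m x -> m y -> ~ m (x + y).
Proof. by move=> nx my mxy; apply: nx; rewrite -(addrK y x); apply: maxidB. Qed.

End ValRing.

(** * Existence of valuation rings above a subring *)

Section Chevalley.
Variables (B0 : L -> Prop) (p : L).
Hypotheses (HB0 : sub_ring B0) (B0p : B0 p) (nB0p : ~ B0 p^-1).

Let good (B : L -> Prop) := [/\ sub_ring B, (forall x, B0 x -> B x) & ~ B p^-1].

Lemma exists_maximal_good :
  exists B, good B /\ forall B', good B' -> (forall x, B x -> B' x) -> forall x, B' x -> B x.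
Proof.
pose set0 : L -> Prop := @classical_sets.set0 L.
pose P (B : L -> Prop) := B = set0 \/ good B.
have [F FP Ftot|B [PB maxB]] := @classical_sets.Zorn_bigcup L P.
  have [F0|[B1 [FB1 B1n0]]] : (forall B, F B -> B = set0) \/ exists B, F B /\ B <> set0.
  - have [h|h] := EM (exists B, F B /\ B <> set0); [by right | left => B FB].
    by apply: contrapT => Bn0; apply: h; exists B.
  - by left; apply/classical_sets.bigcup0P => B /F0.
  have [//|[HB1 B01 nB1p]] := FP _ FB1.
  have goodF X x : F X -> X x -> good X.
    move=> FX Xx; have [X0|//] := FP _ FX; by rewrite X0 in Xx.
  have join x y X Y : F X -> X x -> F Y -> Y y -> exists Z, [/\ F Z, Z x, Z y & good Z].
    move=> FX Xx FY Yy; have [XY|YX] := Ftot _ _ FX FY.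
      by exists Y; split=> //; [apply: XY | apply: goodF FY Yy].
    by exists X; split=> //; [apply: YX | apply: goodF FX Xx].
  right; split; last by move=> [X FX Xp]; have [_ _] := goodF _ _ FX Xp; apply.
    split.
    - by exists B1 => //; apply: (sub_ring1 HB1).
    - move=> x y [X FX Xx] [Y FY Yy]; have [Z [FZ Zx Zy [HZ _ _]]] := join _ _ _ _ FX Xx FY Yy.
      by exists Z => //; apply: (sub_ringB HZ).
    - move=> x y [X FX Xx] [Y FY Yy]; have [Z [FZ Zx Zy [HZ _ _]]] := join _ _ _ _ FX Xx FY Yy.
      by exists Z => //; apply: (sub_ringM HZ).
  by move=> x B0x; exists B1 => //; apply: B01.
have gB0 : good B0 by split.
have gB : good B.
  case: PB => // B0'; exfalso; apply: (maxB B0); last by right.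
  rewrite B0'; split; first by move=> ? [].
  by move=> h; case: (h 1); apply: (sub_ring1 HB0).
exists B; split=> // B' gB' BB' x B'x; apply: contrapT => nBx.
apply: (maxB B'); last by right.
by split=> // h; apply: nBx; apply: h.
Qed.

Let adj (B : L -> Prop) y x := exists2 q : {poly L}, (forall i, B q`_i) & x = q.[y].

Lemma adj_sub_ring B y : sub_ring B -> sub_ring (adj B y).
Proof.
move=> HB; split.
- exists 1; last by rewrite hornerC.
  by move=> i; rewrite coef1; apply: (sub_ring_nat HB).
- move=> _ _ [q Bq ->] [q' Bq' ->]; exists (q - q'); last by rewrite !hornerE.
  by move=> i; rewrite coefB; apply: (sub_ringB HB).
- move=> _ _ [q Bq ->] [q' Bq' ->]; exists (q * q'); last by rewrite hornerM.
  exact: (sub_ring_coefM HB).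
Qed.

(* A subring maximal among those not containing [p^-1] is a valuation ring. *)
Theorem chevalley : exists V, [/\ valring V, forall x, B0 x -> V x & maxid V p].
Proof.
have [B [[HB B0B nBp] maxB]] := exists_maximal_good.
exists B; split=> //; last by right.
have Bp := B0B _ B0p.
have adjP y : ~ B y -> exists2 q : {poly L}, (forall i, B q`_i) & p^-1 = q.[y].
  move=> nBy; apply: contrapT => nadj; apply: nBy.
  have BA x : B x -> adj B y x.
    move=> Bx; exists x%:P; rewrite ?hornerC // => i; rewrite coefC.
    by case: ifP => _ //; apply: (sub_ring0 HB).
  apply: (maxB (adj B y)) => //.
    by split=> //; [apply: adj_sub_ring | move=> x /B0B /BA].
  exists 'X; last by rewrite hornerX.
  by move=> i; rewrite coefX; apply: (sub_ring_nat HB).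
have p0 : p != 0 by apply/eqP => p0; apply: nBp; rewrite p0 invr0; apply: (sub_ring0 HB).
pose J z := exists2 b, B b & z = p * b.
have nJ1 : ~ J 1.
  move=> [b Bb e]; apply: nBp; suff -> : p^-1 = b by [].
  by apply: (mulfI p0); rewrite -e divff.
have JD x y : J x -> J y -> J (x + y).
  by move=> [a Ba ->] [b Bb ->]; exists (a + b); [apply: (sub_ringD HB) | rewrite mulrDr].
have JM x y : J x -> B y -> J (x * y).
  by move=> [a Ba ->] Bb; exists (a * y); [apply: (sub_ringM HB) | rewrite mulrA].
have J0 : J 0 by exists 0; rewrite ?mulr0 //; apply: (sub_ring0 HB).
(* The ideal [J = p B] lies in the Jacobson radical. If [(1 - z)^-1] were outside [B], maximality
   would make [p^-1] a polynomial in it; clearing denominators puts [(1 - z) ^+ n] in [J], although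
   it is 1 modulo [J]. *)
have Junit z : J z -> 1 - z != 0 /\ B (1 - z)^-1.
  move=> Jz; have z1 : 1 - z != 0.
    by apply/eqP => /subr0_eq e; apply: nJ1; rewrite e.
  split=> //; apply: contrapT => /adjP [q Bq e]; apply: nJ1.
  pose n := size q.
  have Jpow i : J ((1 - z) ^+ i - 1).
    elim: i => [|i IH]; first by rewrite expr0 subrr.
    have -> : (1 - z) ^+ i.+1 - 1 = ((1 - z) ^+ i - 1) * (1 - z) + z * -1.
      rewrite exprS; ring.
    have B1 : B (-1) by apply: (sub_ringN HB (sub_ring1 HB)).
    apply: JD; apply: JM => //.
    apply: (sub_ringB HB (sub_ring1 HB)).
    by case: Jz => b Bb ->; apply: (sub_ringM HB).
  have -> : 1 = (1 - z) ^+ n + ((1 - z) ^+ n - 1) * -1 by ring.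
  apply: JD; last by apply: JM => //; apply: (sub_ringN HB (sub_ring1 HB)).
  exists (\sum_(i < n) q`_i * (1 - z) ^+ (n - i)).
    apply: (sub_ring_sum HB) => i _; apply: (sub_ringM HB) => //; apply: (sub_ringX HB).
    apply: (sub_ringB HB) (sub_ring1 HB) _.
    by case: Jz => b Bb ->; apply: (sub_ringM HB).
  apply: (mulfI (invr_neq0 p0)); rewrite mulKf // e horner_coef mulr_suml.
  apply: eq_bigr => i _; rewrite -mulrA; congr (_ * _).
  have -> : (1 - z) ^+ n = (1 - z) ^+ (n - i) * (1 - z) ^+ i.
    by rewrite -exprD subnK // ltnW.
  by rewrite exprVn mulrC mulfK // expf_neq0.
(* If [y] and [y^-1] are both outside [B], each satisfies such a relation. The shorter relation
   lowers the degree of the longer one until 1 lies in [J]. *)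
pose Pn y n := exists2 c : nat -> L, (forall i, J (c i)) & \sum_(i < n.+1) c i * y ^+ i = 1.
have noP N : forall y n n', (n + n' <= N)%N -> y != 0 -> Pn y n -> Pn y^-1 n' -> False.
  elim: N => [|N IH] y n n' le y0 P P'.
    have n0 : n = 0%N by lia.
    case: P => c Jc; rewrite n0 big_ord_recl big_ord0 expr0 mulr1 addr0 => e.
    by apply: nJ1; rewrite -e.
  wlog le_n : y n n' le y0 P P' / (n' <= n)%N.
    move=> W; have [h|h] := leqP n' n; first exact: (W y n n').
    apply: (W y^-1 n' n); rewrite ?invrK ?invr_eq0 //; [by rewrite addnC | exact: ltnW].
  case: P => b Jb eb; case: P' => c Jc ec.
  have [u0 Bu] := Junit _ (Jc 0%N); set u := 1 - c 0%N in u0 Bu.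
  case: n' => [|n'] in le le_n ec *.
    by apply: nJ1; rewrite -ec big_ord_recl big_ord0 expr0 mulr1 addr0.
  case: n => [//|n] in le le_n eb *.
  have ec' := ec; move: ec; rewrite big_ord_recl expr0 mulr1 => /(canRL (addKr _)).
  rewrite addrC -/u => ec.
  (* [y ^+ n.+1] has degree at most [n] modulo the second relation *)
  have ey : y ^+ n.+1 = \sum_(i < n'.+1) (c i.+1 / u) * y ^+ (n - i).
    apply: (mulfI u0); rewrite -{1}ec mulr_suml mulr_sumr; apply: eq_bigr => i _.
    have -> : y ^+ n.+1 = y ^+ i.+1 * y ^+ (n - i).
      by rewrite -exprD; congr (_ ^+ _); have := ltn_ord i; lia.
    rewrite lift0 exprVn -[LHS]mulrA mulKf ?expf_neq0 //.
    by rewrite [RHS]mulrCA -[RHS]mulrA mulKf.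
  have hN : (n + n'.+1 <= N)%N by lia.
  apply: (IH y n n'.+1 hN y0 _ (ex_intro2 _ _ c Jc ec')).
  exists (fun j => b j + b n.+1 * \sum_(i < n'.+1 | (n - i)%N == j) (c i.+1 / u)).
    move=> i; apply: JD => //; apply: JM => //; apply: (sub_ring_sum HB) => j _.
    by apply: (sub_ringM HB) => //; case: (Jc j.+1) => a Ba ->; apply: (sub_ringM HB).
  rewrite -eb [RHS]big_ord_recr /= ey.
  under eq_bigr do rewrite mulrDl.
  rewrite big_split /=; congr (_ + _).
  under eq_bigr do rewrite -mulrA.
  rewrite -mulr_sumr; congr (_ * _).
  under [LHS]eq_bigr => j _ do rewrite mulr_suml.
  rewrite (exchange_big_dep xpredT) //=; apply: eq_bigr => i _.
  rewrite (bigD1 (inord (n - i))) ?inordK ?ltnS ?leq_subr //= big1 ?addr0 //.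
  move=> j /andP[/eqP e]; case/eqP; apply: val_inj; rewrite /= inordK ?e ?ltn_ord //.
split=> // y; have [By|nBy] := EM (B y); [by left | right].
apply: contrapT => nByi.
have y0 : y != 0 by apply/eqP => y0; apply: nBy; rewrite y0; apply: (sub_ring0 HB).
have mkP z : ~ B z -> exists n, Pn z n.
  move=> /adjP [q Bq e]; exists (size q); exists (fun i => p * q`_i).
    by move=> i; exists q`_i.
  rewrite big_ord_recr /= nth_default // mulr0 mul0r addr0.
  under eq_bigr do rewrite -mulrA.
  by rewrite -mulr_sumr -horner_coef -e divff.
have [n P] := mkP _ nBy; have [n' P'] := mkP _ nByi.
exact: (noP (n + n')%N y n n' (leqnn _) y0 P P').
Qed.

End Chevalley.
End ValuationRings.

(** * Subspaces over a finite field *)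

Definition lin_closed (F : fieldType) (T : Type) (P : (T -> F) -> Prop) :=
  P (fun=> 0) /\ forall a x y, P x -> P y -> P (fun i => a * x i + y i).

Section FiniteSubspaces.
Variable F : finFieldType.

(** As [F] is finite, the lines spanned by all vectors of [P] can simply be summed, without choosing
    a basis. *)
Lemma subspace_mx n (P : 'rV[F]_n -> Prop) :
  P 0 -> (forall a x y, P x -> P y -> P (a *: x + y)) ->
  exists A : 'M[F]_n, forall v, (v <= A)%MS <-> P v.
Proof.
move=> P0 PD; exists (\sum_(v : 'rV[F]_n | `[< P v >]) <<v>>)%MS => v.
split=> [/sub_sumsmxP[c ->]|Pv].
  apply: big_ind => [//|x y Px Py|u /asboolP Pu].
    by rewrite -[x]scale1r; apply: PD.
  have /sub_rVP[a ->] : (c u *m <<u>> <= u)%MS by rewrite (submx_trans (submxMl _ _)) // genmxE.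
  by rewrite -[_ *: _]addr0; apply: PD.
by apply: (sumsmx_sup v); [apply/asboolP | rewrite genmxE].
Qed.

Lemma annihilator (I : finType) (P : (I -> F) -> Prop) : lin_closed P ->
  (exists v, ~ P v) ->
  exists l : I -> F, (exists i, l i != 0) /\ forall v, P v -> \sum_i l i * v i = 0.
Proof.
move=> [P0 PD] [v0 nPv0].
pose fn (v : 'rV[F]_#|I|) i := v 0 (enum_rank i).
have [||A HA] := @subspace_mx #|I| (fun v => P (fn v)).
- by have -> : fn 0 = fun=> 0 by apply/funext => i; rewrite /fn mxE.
- move=> a x y Px Py.
  have -> : fn (a *: x + y) = fun i => a * fn x i + fn y i by apply/funext => i; rewrite /fn !mxE.
  exact: PD.
have fnK w : fn (\row_k w (enum_val k)) = w.
  by apply/funext => i; rewrite /fn mxE enum_rankK.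
have : cokermx A != 0.
  apply/eqP => A0; apply: nPv0; rewrite -[v0]fnK; apply/HA.
  by rewrite submxE A0 mulmx0.
move=> /eqP nA; have [i [j Aij]] : exists i j, cokermx A i j != 0.
  apply: contrapT => h; apply: nA; apply/matrixP => i j; rewrite [RHS]mxE.
  by apply: contrapT => /eqP hij; apply: h; exists i, j.
exists (fun l => cokermx A (enum_rank l) j); split.
  by exists (@enum_val I I i); rewrite enum_valK.
move=> v Pv; have : (\row_k v (enum_val k) <= A)%MS by apply/HA; rewrite fnK.
rewrite submxE => /eqP/rowP/(_ j); rewrite mxE [RHS]mxE => e.
rewrite -[RHS]e (reindex (@enum_val I I)) /=; last exact: (onW_bij _ (@enum_val_bij I)).
by apply: eq_bigr => k _; rewrite [X in _ = X * _]mxE enum_valK mulrC.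
Qed.

End FiniteSubspaces.

(* An abstract block code: [lam g] is the local part of a functional that kills the
   products of three words and is normalised on the blocks of [A]. *)
Definition poly_code (K : finFieldType) (G : finType) (r delta : nat) : Prop :=
  exists C : (G -> {poly K}) -> Prop,
  [/\ C (fun=> 0) /\ (forall a x y, C x -> C y -> C (fun g => a *: x g + y g)),
      forall x, C x -> forall g, (size (x g) <= r)%N,
      forall x, C x -> (exists g, x g != 0) -> (delta <= #|[set g | x g != 0%R]|)%N,
      forall (W : {set G}) p, (#|W| <= delta)%N -> (forall g, (size (p g : {poly K}) <= r)%N) ->
        exists2 x, C x & forall g, g \in W -> x g = p g
    & forall k, (k <= delta)%N -> exists (A : {set G}) (lam : G -> {poly K} -> K),
      [/\ #|A| = k, forall g a x y, lam g (a *: x + y) = a * lam g x + lam g y,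
         forall x y z, C x -> C y -> C z -> \sum_g lam g (x g * y g * z g) = 0
       & forall g, g \in A -> lam g 1 = 1]].

(** * The Fermat tower *)

Section FermatTower.
Variables (K : finFieldType) (L : fieldType) (iota : {rmorphism {poly K} -> L}).
Variable q : nat.
Notation kappa := (iota \o polyC).
Local Notation X := (iota 'X).

(** All choices of roots at all levels are collected, so that the set is stable under the group;
    [chain_gen] says that the group acts faithfully on it. *)
Inductive chain : L -> Prop :=
| chain_base : chain X
| chain_step z y : chain z -> y ^+ q.+1 = (z + 1) ^+ q.+1 - 1 -> chain y.

Variables (ell : nat) (G : finGroupType) (act : G -> {rmorphism L -> L}).
Hypotheses (iota_inj : injective iota)
  (act1 : forall y, act 1%g y = y)
  (actM : forall g h y, act (g * h)%g y = act h (act g y))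
  (act_iota : forall g p, act g (iota p) = iota p)
  (act_fixed : forall y, (forall g, act g y = y) ->
     exists a b, b != 0 /\ y = iota a / iota b)
  (q_gt1 : (1 < q)%N) (cardK : #|K| = (q ^ 2)%N)
  (frob : forall a b : L, (a + b) ^+ q = a ^+ q + b ^+ q)
  (p_prime : prime ell) (p_dvd_q : (ell %| q)%N) (p_char : ell%:R = 0 :> K)
  (chain_gen : forall g, (forall y, chain y -> act g y = y) -> g = 1%g).

Notation d := #|G|.
Definition fixed y := forall g, act g y = y.
Definition Tr y := \sum_(h : G) act h y.
(** The intersection of all conjugates of [V]: a ring stable under the group, with traces in [V]. *)
Definition conjs_in (V : L -> Prop) y := forall g, V (act g y).
(* The integral closure of [K[x]], as the intersection of the valuation rings above it. *)
Definition integral (y : L) := forall V, valring V -> (forall p, V (iota p)) -> V y.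

Lemma iota_eq0 p : (iota p == 0) = (p == 0).
Proof. by rewrite -(inj_eq iota_inj) rmorph0. Qed.

Lemma fixed_Tr y : fixed (Tr y).
Proof.
move=> g; rewrite rmorph_sum /= [RHS](reindex_inj (mulIg g)) /=.
by apply: eq_bigr => h _; rewrite actM.
Qed.

Lemma fixedM x y : fixed x -> fixed y -> fixed (x * y).
Proof. by move=> hx hy g; rewrite rmorphM hx hy. Qed.
Lemma fixedV x : fixed x -> fixed x^-1.
Proof. by move=> hx g; rewrite fmorphV hx. Qed.
Lemma fixed_iota p : fixed (iota p). Proof. by move=> g; apply: act_iota. Qed.
Lemma fixed_kappa c : fixed (kappa c). Proof. exact: fixed_iota. Qed.

Lemma TrZ c y : fixed c -> Tr (c * y) = c * Tr y.
Proof. by move=> hc; rewrite /Tr mulr_sumr; apply: eq_bigr => h _; rewrite rmorphM hc. Qed.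

Lemma TrB x y : Tr (x - y) = Tr x - Tr y.
Proof. by rewrite /Tr -sumrB; apply: eq_bigr => h _; rewrite rmorphB. Qed.

Lemma fixed_coprime y : fixed y -> exists a b, [/\ coprimep a b, b != 0 & y = iota a / iota b].
Proof.
case/act_fixed => a [b [b0 ->]].
have g0 : gcdp a b != 0 by rewrite gcdp_eq0 negb_and b0 orbT.
exists (a %/ gcdp a b), (b %/ gcdp a b); split.
- by apply: coprimep_div_gcd; rewrite b0 orbT.
- by rewrite divpN0 // leq_gcdpr.
- have -> : iota a = iota (a %/ gcdp a b) * iota (gcdp a b) by rewrite -rmorphM divpK ?dvdp_gcdl.
  have -> : iota b = iota (b %/ gcdp a b) * iota (gcdp a b) by rewrite -rmorphM divpK ?dvdp_gcdr.
  by rewrite -mulf_div divff ?mulr1 // iota_eq0.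
Qed.

(** The characteristic polynomial over the fixed field, of degree [d] whatever the degree of [y]. *)
Definition norm_poly y : {poly L} := \prod_(h : G) ('X - (act h y)%:P).

Lemma size_norm_poly y : size (norm_poly y) = d.+1.
Proof. by rewrite /norm_poly size_prod_XsubC /index_enum -enumT -cardE. Qed.

Lemma norm_poly_monic y : (norm_poly y)`_d = 1.
Proof.
have /monicP := monic_prod_XsubC (index_enum G) xpredT (fun h => act h y).
by rewrite -/(norm_poly y) /lead_coef size_norm_poly.
Qed.

Lemma norm_poly_root g y : (norm_poly y).[act g y] = 0.
Proof.
by apply/eqP/rootP; rewrite /norm_poly (bigD1 g) //= hornerM hornerXsubC subrr mul0r.
Qed.

Lemma fixed_norm_poly y i : fixed (norm_poly y)`_i.
Proof.
move=> g; rewrite -coef_map; congr (polyseq _)`_i.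
rewrite /norm_poly rmorph_prod /= [RHS](reindex_inj (mulIg g)) /=; apply: eq_bigr => h _.
by rewrite rmorphB /= map_polyX map_polyC actM.
Qed.

Lemma norm_poly_rel g y : act g y ^+ d = \sum_(i < d) - (norm_poly y)`_i * act g y ^+ i.
Proof.
have := norm_poly_root g y.
rewrite horner_coef size_norm_poly big_ord_recr /= norm_poly_monic mul1r => /eqP.
rewrite addrC addr_eq0 => /eqP ->; rewrite -sumrN.
by apply: eq_bigr => i _; rewrite mulNr.
Qed.

(** * One valuation ring and its conjugates *)

Section Val.
Variable V : L -> Prop.
Hypotheses (HV : valring V).
Let HB := HV.1.
Notation m := (maxid V).
Notation R := (conjs_in V).

Lemma conjs_sub_ring : sub_ring R.
Proof.
split=> [g|x y Rx Ry g|x y Rx Ry g].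
- by rewrite rmorph1; apply: (sub_ring1 HB).
- by rewrite rmorphB; apply: (sub_ringB HB).
- by rewrite rmorphM; apply: (sub_ringM HB).
Qed.

Lemma conjs_sub y : R y -> V y. Proof. by move=> /(_ 1%g); rewrite act1. Qed.

Lemma conjs_act g y : R y -> R (act g y).
Proof. by move=> Ry h; rewrite -actM. Qed.

Lemma conjs_fixed c : fixed c -> V c -> R c.
Proof. by move=> hc Vc g; rewrite hc. Qed.

Lemma V_Tr y : R y -> V (Tr y).
Proof. by move=> Ry; apply: (sub_ring_sum HB) => h _; apply: Ry. Qed.

Lemma m_Tr y : (forall g, m (act g y)) -> m (Tr y).
Proof. by move=> my; apply: maxid_sum => // h _; apply: my. Qed.

Lemma V_norm_poly y i : R y -> V (norm_poly y)`_i.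
Proof.
move=> Ry; rewrite /norm_poly.
elim: (index_enum G) i => [|h s IH] i; first by rewrite big_nil coef1; apply: (sub_ring_nat HB).
rewrite big_cons; apply: (sub_ring_coefM HB) => // j.
rewrite coefB coefX coefC; apply: (sub_ringB HB); first exact: (sub_ring_nat HB).
by case: ifP => _; [apply: Ry | apply: (sub_ring0 HB)].
Qed.

(* Multiplying [E(h) = sum_i a_i h(b_i)] by the factor [h(c_g) - g(c_g)]
   kills its value at [h = g] without leaving the span of such expressions. *)
Lemma trace_separation (N : L -> Prop) (c : G -> L) (gs : seq G) :
  (forall x y, N x -> N y -> N (x - y)) ->
  (forall g, R (c g)) ->
  (forall g x, N x -> N (act g (c g) * x)) ->
  forall f, (forall b, R b -> N (Tr (f * b))) ->
  N (\sum_h act h f * \prod_(g <- gs) (act h (c g) - act g (c g))).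
Proof.
move=> NB Rc NM; elim: gs => [|g gs IH] f Nf.
  under eq_bigr do rewrite big_nil mulr1.
  by rewrite -[f]mulr1; apply: Nf; apply: (sub_ring1 conjs_sub_ring).
have -> : \sum_h act h f * \prod_(g0 <- g :: gs) (act h (c g0) - act g0 (c g0)) =
  \sum_h act h (f * c g) * \prod_(g0 <- gs) (act h (c g0) - act g0 (c g0)) -
  act g (c g) * \sum_h act h f * \prod_(g0 <- gs) (act h (c g0) - act g0 (c g0)).
  rewrite mulr_sumr -sumrB; apply: eq_bigr => h _.
  by rewrite big_cons rmorphM; ring.
apply: NB; last by apply: NM; apply: IH.
apply: IH => b Rb; rewrite -mulrA; apply: Nf.
exact: (sub_ringM conjs_sub_ring).
Qed.

(** [V] is a localisation of [R]. Scale the characteristic polynomial of [c] so that its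
    coefficients [p i] lie in [V] and one of them is 1; the multiplier is one of its Horner tails
    [r j] at [c]. *)
Lemma horner_tail_lemma c : V c -> exists r, [/\ R r, ~ m r & R (r * c)].
Proof.
move=> Vc; pose P i := (norm_poly c)`_i.
have [|i0 Pi0 dom] := @dominant _ _ HV d.+1 (fun i => P i).
  by exists ord_max; rewrite /P norm_poly_monic oner_eq0.
pose p i := P i / P i0.
have fp i : fixed (p i) by apply: fixedM; [|apply: fixedV]; apply: fixed_norm_poly.
have Vp i : V (p i).
  have [ld|ld] := ltnP i d.+1; first exact: (dom (Ordinal ld)).
  rewrite /p /P nth_default ?size_norm_poly // mul0r; exact: (sub_ring0 HB).
have p0 : p i0 = 1 by rewrite /p divff.
have pc g : \sum_(i < d.+1) p i * act g c ^+ i = 0.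
  have := norm_poly_root g c; rewrite horner_coef size_norm_poly => e.
  under eq_bigr do rewrite /p mulrAC.
  by rewrite -mulr_suml e mul0r.
pose r j := \sum_(i < d.+1 | (j <= i)%N) p i * c ^+ (i - j).
have actr g j : act g (r j) = \sum_(i < d.+1 | (j <= i)%N) p i * act g c ^+ (i - j).
  by rewrite rmorph_sum; apply: eq_bigr => i _; rewrite rmorphM rmorphXn fp.
have Rr j : R (r j).
  move=> g; rewrite actr; have [Vg|mg] := valringP V (act g c).
    by apply: (sub_ring_sum HB) => i _; apply: (sub_ringM HB) => //; apply: (sub_ringX HB).
  have [g0|g0] := eqVneq (act g c) 0.
    rewrite g0; apply: (sub_ring_sum HB) => i _; apply: (sub_ringM HB) => //.
    by apply: (sub_ringX HB); apply: (sub_ring0 HB).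
  (* When the conjugate of [c] has a pole, the equation trades the tail for the complementary terms,
     which are polynomial in its inverse. *)
  have -> : \sum_(i < d.+1 | (j <= i)%N) p i * act g c ^+ (i - j) =
     - \sum_(i < d.+1 | ~~ (j <= i)%N) p i * (act g c)^-1 ^+ (j - i).
    apply: (mulIf (expf_neq0 j g0)); rewrite mulNr !mulr_suml.
    apply/eqP; rewrite -addr_eq0; apply/eqP; rewrite -[RHS](pc g).
    rewrite [RHS](bigID (fun i : 'I_d.+1 => (j <= i)%N)) /=; congr (_ + _).
      by apply: eq_bigr => i ji; rewrite -mulrA -exprD subnK.
    apply: eq_bigr => i; rewrite -ltnNge => ij; rewrite -mulrA; congr (_ * _).
    rewrite exprVn -{2}(subnK (ltnW ij)) exprD mulKf //.
    exact: expf_neq0.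
  apply: (sub_ringN HB); apply: (sub_ring_sum HB) => i _; apply: (sub_ringM HB) => //.
  by apply: (sub_ringX HB); apply: maxid_sub.
have rS j : (j <= d)%N -> r j = p j + r j.+1 * c.
  move=> jd; rewrite {1}/r (bigD1 (inord j)) ?inordK //= subnn expr0 mulr1; congr (_ + _).
  rewrite /r mulr_suml; apply: eq_big => [i|i].
    by rewrite ltn_neqAle andbC eq_sym -val_eqE /= inordK.
  move=> /andP[ji]; rewrite -val_eqE /= inordK // => ij; rewrite -mulrA -exprSr.
  by congr (_ * _ ^+ _); move: ji ij; lia.
(* If all tails were in the maximal ideal, so would be [p i0 = r i0 - r i0.+1 * c], which is 1. *)
have [j nmj] : exists j, ~ m (r j).
  apply: contrapT => h; have hm j : m (r j) by apply: contrapT => hj; apply: h; exists j.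
  apply: (maxidN1 HV); rewrite -p0.
  have i0d : (i0 <= d)%N by rewrite -ltnS.
  have -> : p i0 = r i0 - r i0.+1 * c by rewrite rS // addrK.
  by apply: maxidB => //; apply: maxidMr.
case: j nmj => [|j] nmj.
  case: nmj; left; rewrite /r -[RHS](pc 1%g); apply: eq_bigr => i _.
  by rewrite subn0 act1.
have jd : (j <= d)%N.
  rewrite leqNgt; apply/negP => dj; case: nmj; left; rewrite /r big1 // => i ji.
  by have := ltn_ord i; lia.
exists (r j.+1); split=> //.
have -> : r j.+1 * c = r j - p j by rewrite (rS j) // [RHS]addrC addKr.
by apply: (sub_ringB conjs_sub_ring) => //; apply: conjs_fixed.
Qed.

Hypothesis VA : forall p, V (iota p).

Lemma conjs_integral y : integral y -> R y.
Proof.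
move=> Oy g; apply: (Oy (fun y => V (act g y))); last by move=> p; rewrite act_iota.
split; last by move=> x; rewrite fmorphV; apply: HV.2.
split=> [|x z Rx Rz|x z Rx Rz].
- by rewrite rmorph1; apply: (sub_ring1 HB).
- by rewrite rmorphB; apply: (sub_ringB HB).
- by rewrite rmorphM; apply: (sub_ringM HB).
Qed.

Lemma fixed_denominator c : fixed c -> V c -> exists b, ~ m (iota b) /\ exists a, iota b * c = iota a.
Proof.
move=> fc Vc; have [a [b [cab b0 e]]] := fixed_coprime fc.
exists b; split; last by exists a; rewrite e mulrC divfK // iota_eq0.
move=> mb; have ma : m (iota a).
  have -> : iota a = c * iota b by rewrite e divfK // iota_eq0.
  exact: maxidMl.
case/Bezout_eq1_coprimepP: cab => -[u v] /= uv.
apply: (maxidN1 HV); rewrite -(rmorph1 iota) -uv rmorphD !rmorphM.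
by apply: maxidD => //; apply: maxidMl.
Qed.

(** The coefficients of [norm_poly y] are fractions with denominators that are units at [V]. The
    product of these denominators makes [y] integral and stays a unit because the maximal ideal is
    prime. *)
Lemma conjs_denominator y : R y -> exists b, ~ m (iota b) /\ integral (iota b * y).
Proof.
move=> Ry.
have /choice[b Hb] : forall i : 'I_d, exists b, ~ m (iota b) /\ exists a, iota b * (norm_poly y)`_i = iota a.
  by move=> i; apply: fixed_denominator; [apply: fixed_norm_poly | apply: V_norm_poly].
exists (\prod_i b i); split.
  rewrite rmorph_prod => /(maxid_prod_prime HV)[] // i _.
  exact: (Hb i).1.
move=> V' HV' V'A; set B := iota _.
pose c i := - (B ^+ (d - i)) * (norm_poly y)`_i.
apply: (@val_integral _ _ HV' c _ d) => [i id|].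
  rewrite /c mulNr; apply: (sub_ringN HV'.1).
  have -> : (d - i = (d - i).-1.+1)%N by rewrite prednK ?subn_gt0.
  rewrite exprSr -mulrA; apply: (sub_ringM HV'.1); first by apply: (sub_ringX HV'.1); apply: V'A.
  rewrite /B (bigD1 (Ordinal id)) //= rmorphM mulrAC.
  have [_ [a ->]] := Hb (Ordinal id).
  by rewrite -rmorphM.
have := norm_poly_rel 1 y; rewrite act1 exprMn => ->; rewrite mulr_sumr.
apply: eq_bigr => i _; rewrite /c exprMn.
rewrite -{1}(subnK (ltnW (ltn_ord i))) exprD; ring.
Qed.

End Val.

(** * Ramification in the tower *)

Lemma prod_sub_kappa y : \prod_(c : K) (y - kappa c) = y ^+ (q ^ 2) - y.
Proof.
have /(congr1 (fun P => (map_poly kappa P).[y])) := finField_genPoly K.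
rewrite cardK rmorphB /= map_polyXn map_polyX !hornerE => ->.
rewrite rmorph_prod horner_prod; apply: eq_bigr => c _.
by rewrite rmorphB /= map_polyX map_polyC hornerXsubC.
Qed.

Lemma kappa_root y : y ^+ (q ^ 2) = y -> exists c, y = kappa c.
Proof.
move=> e; have /eqP := prod_sub_kappa y; rewrite e subrr => /prodf_eq0[c _ /=].
by rewrite subr_eq0 => /eqP; exists c.
Qed.

Lemma kappa_residue V y : valring V -> (forall c, V (kappa c)) -> V y ->
  maxid V (y ^+ (q ^ 2) - y) -> exists c, maxid V (y - kappa c).
Proof.
move=> HV VK Vy; rewrite -prod_sub_kappa => /(maxid_prod_prime HV)[c _|c _ mc].
  exact: (sub_ringB HV.1).
by exists c.
Qed.

Lemma frobQ (a b : L) : (a + b) ^+ (q ^ 2) = a ^+ (q ^ 2) + b ^+ (q ^ 2).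
Proof. by rewrite -mulnn !exprM !frob. Qed.

Lemma expq2 : (q ^ 2 = q.+1 * q.-1 + 1)%N.
Proof. by case: q q_gt1 => // n _; rewrite -mulnn /=; lia. Qed.

(** The quotient [act g y / y] is a [(q+1)]-th root of unity; these lie in [K] because [q+1] divides
    [q^2 - 1]. *)
Lemma kummer g z y : act g z = z -> y ^+ q.+1 = (z + 1) ^+ q.+1 - 1 -> y != 0 ->
  exists c, act g y = kappa c * y /\ c ^+ q.+1 = 1.
Proof.
move=> gz e y0; pose zeta := act g y / y.
have zeta1 : zeta ^+ q.+1 = 1.
  rewrite /zeta exprMn exprVn -rmorphXn e /= rmorphB rmorphXn rmorphD rmorph1 /= gz.
  by rewrite -e divff // expf_neq0.
have [|c ec] := @kappa_root zeta; first by rewrite expq2 exprD exprM zeta1 expr1n mul1r expr1.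
exists c; split; first by rewrite -ec divfK.
apply: (fmorph_inj kappa); rewrite rmorphXn rmorph1 -[LHS]/(kappa c ^+ q.+1).
by rewrite -ec.
Qed.

Lemma chain_act g y : chain y -> chain (act g y).
Proof.
elim=> [|z {}y _ chz e]; first by rewrite act_iota; apply: chain_base.
apply: (chain_step chz).
by rewrite -rmorphXn e /= rmorphB rmorphXn rmorphD rmorph1.
Qed.

Lemma chain_integral y : chain y -> integral y.
Proof.
move=> chy V HV VA; elim: chy => [|z {}y _ Vz e]; first exact: VA.
apply: (@val_root _ _ HV _ q.+1) => //; rewrite e.
apply: (sub_ringB HV.1); last exact: (sub_ring1 HV.1).
by apply: (sub_ringX HV.1); apply: (sub_ringD HV.1) => //; apply: (sub_ring1 HV.1).
Qed.

(** The product of all [x - c] with [c] in [K]; its zeros contain the finite ramification locus of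
    the tower. *)
Definition ramif : {poly K} := 'X^(q ^ 2) - 'X.

Lemma size_ramif : size ramif = (q ^ 2).+1.
Proof.
rewrite /ramif size_polyDl ?size_polyXn // size_polyN size_polyX ltnS.
by rewrite (leq_trans q_gt1) // -{1}(expn1 q) leq_exp2l.
Qed.

Lemma ramif_neq0 : ramif != 0.
Proof. by rewrite -size_poly_eq0 size_ramif. Qed.

(** With [u = z + 1], the Frobenius turns the tower equation into
    [u^q (u^(q^2) - u) = y^q (y^(q^2) - y)]. Thus a residue of [y] in [K] forces one of [z] in [K],
    and so on down to [x]. *)
Lemma chain_ramified V y : valring V -> (forall p, V (iota p)) ->
  chain y -> maxid V (y ^+ (q ^ 2) - y) -> maxid V (iota ramif).
Proof.
move=> HV VA; elim=> [|z {}y chz IH e my].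
  by rewrite rmorphB rmorphXn.
have Vz := chain_integral chz HV VA.
have Vy := chain_integral (chain_step chz e) HV VA.
apply: IH; pose u := z + 1.
have Vu : V u by apply: (sub_ringD HV.1) => //; apply: (sub_ring1 HV.1).
have mu : maxid V (u ^+ (q ^ 2) - u).
  have : maxid V (u ^+ q * (u ^+ (q ^ 2) - u)).
    have -> : u ^+ q * (u ^+ (q ^ 2) - u) = y ^+ q * (y ^+ (q ^ 2) - y).
      rewrite !mulrBr -!exprSr -!exprD.
      have -> : (q + q ^ 2 = q.+1 * q)%N by rewrite -mulnn mulSn.
      rewrite !exprM e -/u.
      have -> : u ^+ q.+1 = y ^+ q.+1 + 1 by rewrite e subrK.
      by rewrite frob expr1n addrK; ring.
    by apply: maxidMl => //; apply: (sub_ringX HV.1).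
  move=> /(maxid_prime HV)[] //.
  - exact: (sub_ringX HV.1).
  - by apply: (sub_ringB HV.1) => //; apply: (sub_ringX HV.1).
  move=> /(maxidX HV Vu) mu.
  by apply: maxidB => //; apply: maxidXp => //; rewrite expn_gt0 ltnW.
suff -> : z ^+ (q ^ 2) - z = u ^+ (q ^ 2) - u by [].
by rewrite /u frobQ expr1n; ring.
Qed.

Lemma act_expg g n y : act (g ^+ n)%g y = iter n (act g) y.
Proof.
elim: n y => [|n IH] y; first by rewrite expg0 act1.
by rewrite expgS actM IH -iterSr.
Qed.

(** By Cauchy there would be an element of order [ell]. It moves a chain element [y] with fixed
    predecessor by a constant [c] with [c^ell = 1], hence [c^q = 1]; with [c^(q+1) = 1] this gives
    [c = 1], level by level. *)
Lemma p'_group : ~~ (ell %| d)%N.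
Proof.
apply/negP; rewrite -cardsT => /(Cauchy p_prime)[g _ og].
suff g1 : g = 1%g by move: og p_prime; rewrite g1 order1 => <-.
apply: chain_gen => y; elim=> [|z {}y chz gz e]; first exact: act_iota.
have [->|y0] := eqVneq y 0; first exact: rmorph0.
have [c [gy c1]] := kummer gz e y0.
have gny n : act (g ^+ n)%g y = kappa (c ^+ n) * y.
  rewrite act_expg; elim: n => [|n IH]; first by rewrite expr0 rmorph1 mul1r.
  by rewrite iterS IH rmorphM /= act_iota gy exprSr rmorphM /= mulrA -rmorphM.
have cp : c ^+ ell = 1.
  apply: (fmorph_inj kappa); apply: (mulIf y0).
  by rewrite -gny -og expg_order act1 rmorph1 mul1r.
have cq : c ^+ q = 1 by rewrite -(divnK p_dvd_q) mulnC exprM cp expr1n.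
by rewrite gy; move: c1; rewrite exprS cq mulr1 => ->; rewrite rmorph1 mul1r.
Qed.

Lemma card_unit V (H : {group G}) : valring V -> (forall p, V (iota p)) -> ~ maxid V #|H|%:R.
Proof.
move=> HV VA mH.
have n0 : (#|H|%:R : K) != 0.
  have pc : ell \in [pchar K] by rewrite inE p_prime p_char eqxx.
  rewrite -(dvdn_pcharf pc); apply: contra p'_group => h.
  by rewrite -cardsT; apply: (dvdn_trans h); apply: cardSg; apply: subsetT.
apply: (maxidN1 HV).
have -> : 1 = kappa (#|H|%:R^-1) * #|H|%:R.
  by rewrite -(rmorph_nat kappa) -rmorphM mulVf // rmorph1.
by apply: maxidMl => //; apply: VA.
Qed.

(** * The bound on the codifferent *)

Section Codifferent.
Variable w : L.
Hypothesis Tr_w : forall o, integral o -> exists a, Tr (w * o) = iota a.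

Lemma codifferent_V V b : valring V -> (forall p, V (iota p)) -> conjs_in V b -> V (Tr (w * b)).
Proof.
move=> HV VA Rb; have [e [me Oe]] := conjs_denominator HV VA Rb.
have [a ea] := Tr_w Oe.
have [Vei e0] := unitV (VA e) me.
have -> : Tr (w * b) = (iota e)^-1 * iota a.
  have -> : iota a = Tr (iota e * (w * b)) by rewrite -ea mulrCA.
  by rewrite (TrZ _ (fixed_iota e)) mulKf.
exact: (sub_ringM HV.1).
Qed.

(* Tameness: the codifferent exceeds the integral closure by less than one
   power of [ramif], because the inertia groups have order prime to [ell]. *)
Theorem codifferent_ramif : integral (iota ramif * w).
Proof.
move=> V HV VA; have HB := HV.1; have VTr b := @codifferent_V V b HV VA.
have RB := conjs_sub_ring HV.
(* The inertia group of [V], expressed on [R] so as not to mention residue fields. *)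
pose inert g := forall c, conjs_in V c -> maxid V (c - act g c).
have inertM g c : inert g -> conjs_in V c -> maxid V c -> maxid V (act g c).
  by move=> Ig Rc mc; rewrite -[act g c](subKr c); apply: maxidB => //; apply: Ig.
have gI : group_set [set g | `[< inert g >]].
  apply/group_setP; split; first by rewrite in_set; apply/asboolP => c Rc; rewrite act1 subrr; left.
  move=> g h; rewrite !in_set => /asboolP Ig /asboolP Ih; apply/asboolP => c Rc.
  have -> : c - act (g * h)%g c = (c - act g c) + (act g c - act h (act g c)).
    by rewrite actM; ring.
  apply: maxidD => //; first exact: Ig.
  by apply: Ih; apply: conjs_act.
pose I := Group gI.
have IP g : reflect (inert g) (g \in I) by rewrite in_set; apply: asboolP.
have /choice[c Hc] : forall g, exists c, conjs_in V c /\ (g \notin I -> ~ maxid V (c - act g c)).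
  move=> g; case: (IP g) => [_|nI]; first by exists 1; split=> //; apply: (sub_ring1 RB).
  apply: contrapT => h; apply: nI => c Rc; apply: contrapT => mc; apply: h.
  by exists c.
(* [E] vanishes outside the inertia group and is congruent to the unit [E 1] on it, so it cuts a
   trace down to a sum over inertia. *)
pose E h := \prod_(g <- enum (~: I)) (act h (c g) - act g (c g)).
have sepE f : (forall b, conjs_in V b -> V (Tr (f * b))) -> V (\sum_(h in I) act h f * E h).
  move=> Hf.
  have -> : \sum_(h in I) act h f * E h = \sum_h act h f * E h.
    rewrite [RHS](bigID [in I]) /= [X in _ = _ + X]big1 ?addr0 // => h nI.
    rewrite /E (bigD1_seq h) ?enum_uniq ?mem_enum ?in_setC //= ?subrr ?mul0r ?mulr0 //.
  apply: (trace_separation HV) => //.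
  - by move=> x y; apply: (sub_ringB HB).
  - by move=> g; apply: (Hc g).1.
  - by move=> g x; apply: (sub_ringM HB); apply: (Hc g).1.
have VE h : V (E h).
  by apply: (sub_ring_prod HB) => g _; apply: (sub_ringB HB); apply: (Hc g).1.
have E1 : ~ maxid V (E 1%g).
  move=> /(maxid_prod_prime HV)[g _|g]; first by apply: (sub_ringB HB); apply: (Hc g).1.
  by rewrite mem_enum in_setC act1 => /(Hc g).2.
have Eh h : h \in I -> maxid V (E h - E 1%g).
  move=> /IP Ih; rewrite /E.
  apply: (maxid_prod_congr HV) => g; try by apply: (sub_ringB HB); apply: (Hc g).1.
  have -> : act h (c g) - act g (c g) - (act 1%g (c g) - act g (c g)) = - (c g - act h (c g)).
    by rewrite act1; ring.
  by apply: maxidN => //; apply: Ih; apply: (Hc g).1.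
have [mh|nmh] := EM (maxid V (iota ramif)); last first.
  (* Away from the zeros of [ramif], inertia is trivial: an inert element that multiplies [y] by a
     constant other than 1 forces [y] into the maximal ideal, and then [chain_ramified] applies. *)
  have I1 : I = 1%G.
    apply/eqP; rewrite -val_eqE; apply/eqP; apply/trivgP/subsetP => g /IP Ig.
    rewrite in_set1; apply/eqP/chain_gen => y; elim=> [|z {}y chz gz e]; first exact: act_iota.
    have [->|y0] := eqVneq y 0; first exact: rmorph0.
    have [k [gy _]] := kummer gz e y0.
    have chy := chain_step chz e.
    have Vy := chain_integral chy HV VA.
    have : maxid V ((1 - kappa k) * y).
      rewrite mulrBl mul1r -gy; apply: Ig.
      by apply: (conjs_integral HV) => //; apply: chain_integral.
    move=> /(maxid_prime HV)[] //.
    - by apply: (sub_ringB HB); [apply: (sub_ring1 HB) | apply: VA].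
    - have [k1|k1] := eqVneq k 1; first by rewrite gy k1 rmorph1 mul1r.
      move=> mk; case: (maxidN1 HV).
      have -> : 1 = kappa (1 - k)^-1 * (1 - kappa k).
        rewrite -(rmorph1 kappa) -rmorphB -rmorphM mulVf //.
        by rewrite subr_eq0 eq_sym.
      by apply: maxidMl => //; apply: VA.
    move=> my; case: nmh; apply: (chain_ramified HV VA chy).
    by apply: maxidB => //; apply: maxidXp => //; rewrite expn_gt0 ltnW.
  have := sepE w VTr; rewrite I1 big_set1 act1 => VwE.
  have [VEi E0] := unitV (VE 1%g) E1.
  apply: (sub_ringM HB) => //; rewrite -(mulfK E0 w); exact: (sub_ringM HB).
(* Suppose that [ramif * w] has a pole. Then [f = r / ramif] still has traces in [V], and its sum
   over inertia is [S / ramif] with [S] congruent to [#|I| * r * E 1]. This is a unit since [#|I|]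
   is prime to [ell], so [1 / ramif] would lie in [V]. *)
have [//|mi] := valringP V (iota ramif * w).
have [w0|w0] := eqVneq w 0; first by rewrite w0 mulr0; apply: (sub_ring0 HB).
have h0 : iota ramif != 0 by rewrite iota_eq0 ramif_neq0.
have [r [Rr nmr Rrc]] := horner_tail_lemma HV (maxid_sub HV mi).
pose f := w * (r * (iota ramif * w)^-1).
have fE h : act h f = act h r * (iota ramif)^-1.
  have -> : f = r * (iota ramif)^-1 by rewrite /f; field; rewrite h0 w0.
  by rewrite rmorphM fmorphV act_iota.
have : V (\sum_(h in I) act h f * E h).
  by apply: sepE => b Rb; rewrite /f -mulrA; apply: VTr; apply: (sub_ringM RB).
pose S := \sum_(h in I) act h r * E h.
have -> : \sum_(h in I) act h f * E h = (iota ramif)^-1 * S.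
  by rewrite mulr_sumr; apply: eq_bigr => h _; rewrite fE; ring.
have mS : maxid V (S - #|I|%:R * (r * E 1%g)).
  have -> : S - #|I|%:R * (r * E 1%g) = \sum_(h in I) (act h r * E h - r * E 1%g).
    by rewrite mulr_natl sumrB sumr_const.
  apply: maxid_sum => // h hI.
  have -> : act h r * E h - r * E 1%g = act h r * (E h - E 1%g) - (r - act h r) * E 1%g by ring.
  apply: maxidB => //; first by apply: maxidMl => //; apply: Eh.
  by apply: maxidMr => //; apply: (IP _ hI).
have VI : V #|I|%:R by apply: (sub_ring_nat HB).
have Vr := conjs_sub Rr.
have nmS : ~ maxid V S.
  rewrite -(subrK (#|I|%:R * (r * E 1%g)) S) addrC; apply: nmaxidD => //.
  move=> /(maxid_prime HV)[] //; first exact: (sub_ringM HB).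
  - exact: card_unit.
  - by move=> /(maxid_prime HV)[].
have VS : V S by apply: (sub_ring_sum HB) => h _; apply: (sub_ringM HB).
have [VSi S0] := unitV VS nmS.
move=> VhS; exfalso; case: mh => [/eqP|]; first by rewrite (negPf h0).
apply; rewrite -(mulfK S0 (iota ramif)^-1); exact: (sub_ringM HB).
Qed.

End Codifferent.

Lemma integral_sub_ring : sub_ring integral.
Proof.
split=> [V HV _|x y Ix Iy V HV VA|x y Ix Iy V HV VA].
- exact: (sub_ring1 HV.1).
- by apply: (sub_ringB HV.1); [apply: Ix | apply: Iy].
- by apply: (sub_ringM HV.1); [apply: Ix | apply: Iy].
Qed.

Lemma integral_act g y : integral y -> integral (act g y).
Proof. by move=> Iy V HV VA; apply: conjs_integral. Qed.

Lemma integral_iota p : integral (iota p).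
Proof. by move=> V _; apply. Qed.

(** If the reduced denominator were not constant, Chevalley would give a valuation ring above [K[x]]
    in whose maximal ideal it lies; the numerator would follow, against Bezout. *)
Lemma fixed_integral c : fixed c -> integral c -> exists a, c = iota a.
Proof.
move=> fc Ic; have [a [b [cab b0 ec]]] := fixed_coprime fc.
have ib0 : iota b != 0 by rewrite iota_eq0.
have [sb|sb] := leqP (size b) 1.
  have kb := size1_polyC sb; set k := b`_0 in kb.
  have k0 : k != 0 by rewrite -polyC_eq0 -kb.
  exists (a * k^-1%:P); rewrite ec; apply: (mulIf ib0).
  by rewrite divfK // -rmorphM kb -mulrA -polyCM mulVf // mulr1.
pose B y := exists p, y = iota p.
have HB : sub_ring B.
  split; first by exists 1; rewrite rmorph1.
  - by move=> _ _ [x ->] [y ->]; exists (x - y); rewrite rmorphB.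
  - by move=> _ _ [x ->] [y ->]; exists (x * y); rewrite rmorphM.
have nB : ~ B (iota b)^-1.
  move=> [e ee]; have : b * e = 1.
    by apply: iota_inj; rewrite rmorphM -ee mulfV // rmorph1.
  have e0 : e != 0.
    by apply/eqP => e0; move: ee; rewrite e0 rmorph0 => /eqP; rewrite invr_eq0 (negPf ib0).
  move=> /(congr1 (fun P : {poly K} => size P)); rewrite size_poly1 size_mul //.
  by have := size_poly_gt0 e; rewrite e0 => e1 e2; move: sb e1 e2; case: (size b) (size e) => [|[|?]] [|?] //=; lia.
have [V [HV BV mb]] := chevalley HB (ex_intro _ b erefl) nB.
have VA p : V (iota p) by apply: BV; exists p.
have ma : maxid V (iota a).
  by rewrite -[iota a](divfK ib0) -ec; apply: maxidMl => //; apply: Ic.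
case/Bezout_eq1_coprimepP: cab => -[u v] /= uv.
case: (maxidN1 HV); rewrite -(rmorph1 iota) -uv rmorphD !rmorphM.
by apply: maxidD => //; apply: maxidMl.
Qed.

Lemma integral_norm f : integral f -> f != 0 -> exists2 a, a != 0 & \prod_g act g f = iota a.
Proof.
move=> If f0.
have fN : fixed (\prod_g act g f).
  by move=> g; rewrite rmorph_prod [RHS](reindex_inj (mulIg g)) /=; apply: eq_bigr => h _; rewrite actM.
have IN : integral (\prod_g act g f).
  by apply: (sub_ring_prod integral_sub_ring) => g _; apply: integral_act.
have [a ea] := fixed_integral fN IN.
by exists a => //; rewrite -iota_eq0 -ea; apply/prodf_neq0 => g _; rewrite fmorph_eq0.
Qed.

(** The whole field is a valuation ring with maximal ideal 0, and [conjs_denominator] applies to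
    it. *)
Lemma multiple_integral y : exists2 b, b != 0 & integral (iota b * y).
Proof.
have HT : valring (fun _ : L => True) by split; [split | left].
have [//|//|b [nb Ib]] := @conjs_denominator _ HT _ y.
by exists b => //; apply/eqP => b0; apply: nb; rewrite b0 rmorph0; left.
Qed.

(** * The places at infinity *)

Local Notation t := (X^-1).

Lemma X_neq0 : X != 0. Proof. by rewrite iota_eq0 polyX_eq0. Qed.

Lemma expXV_sub (y : L) n i : y != 0 -> (i <= n)%N -> y ^+ n * y^-1 ^+ i = y ^+ (n - i).
Proof.
by move=> y0 le; rewrite -{1}(subnK le) exprD exprVn mulfK // expf_neq0.
Qed.

(** Chevalley for [K[t]]: an equation [x = a(t)], multiplied by a power of [x], contradicts
    degrees. *)
Lemma exists_infinite_place :
  exists V, [/\ valring V, forall c, V (kappa c) & maxid V t].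
Proof.
pose B y := exists p : {poly K}, y = (map_poly kappa p).[t].
have HB : sub_ring B.
  split; first by exists 1; rewrite rmorph1 hornerC.
  - by move=> _ _ [a ->] [b ->]; exists (a - b); rewrite rmorphB !hornerE.
  - by move=> _ _ [a ->] [b ->]; exists (a * b); rewrite rmorphM hornerM.
have Bt : B t by exists 'X; rewrite map_polyX hornerX.
have nBt : ~ B t^-1.
  rewrite invrK => -[a]; rewrite horner_coef size_map_poly => e.
  pose n := size a.
  have : 'X^(n.+1) = \sum_(i < n) a`_i *: 'X^(n - i) :> {poly K}.
    apply: iota_inj; have -> : iota 'X^(n.+1) = X ^+ n * X by rewrite rmorphXn exprSr.
    rewrite [Z in _ * Z]e mulr_sumr rmorph_sum /=.
    apply: eq_bigr => i _; rewrite coef_map -mul_polyC rmorphM rmorphXn /= mulrCA.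
    by rewrite expXV_sub ?X_neq0 // ltnW.
  move=> /(congr1 (fun P : {poly K} => P`_n.+1)); rewrite coefXn eqxx coef_sum big1 => [/eqP|i _].
    by rewrite oner_eq0.
  by rewrite coefZ coefXn; case: eqP => [h|]; rewrite ?mulr0 //; lia.
have [V [HV BV mV]] := chevalley HB Bt nBt.
exists V; split=> // c; apply: BV; exists c%:P.
by rewrite map_polyC hornerC.
Qed.

Section Infinity.
Variable V : L -> Prop.
Hypotheses (HV : valring V) (VK : forall c, V (kappa c)) (mt : maxid V t).
Let HB := HV.1.
Let RB := conjs_sub_ring HV.
Notation m := (maxid V).
Notation R := (conjs_in V).

(** A relation, so that no residue field has to be built. That every element of [V] has a residue in
    [K] is complete splitting, proved in [V_residue]. *)
Definition residue y k := m (y - kappa k).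

Lemma t_neq0 : t != 0. Proof. by rewrite invr_eq0 X_neq0. Qed.
Lemma Vt : V t. Proof. exact: (maxid_sub HV). Qed.
Lemma fixed_t : fixed t. Proof. by apply: fixedV; apply: fixed_iota. Qed.

Lemma m_kappa k : m (kappa k) -> k = 0.
Proof.
move=> mk; apply/eqP/negP => /negP k0; apply: (maxidN1 HV).
have -> : 1 = kappa k^-1 * kappa k by rewrite -rmorphM mulVf // rmorph1.
exact: maxidMl.
Qed.

Lemma residue_V y k : residue y k -> V y.
Proof.
by move=> /(maxid_sub HV) h; rewrite -[y](subrK (kappa k)); apply: (sub_ringD HB).
Qed.

Lemma residue_kappa k : residue (kappa k) k.
Proof. by rewrite /residue subrr; left. Qed.

Lemma residueM x y a b : residue x a -> residue y b -> residue (x * y) (a * b).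
Proof.
move=> rx ry; rewrite /residue rmorphM.
have -> : x * y - kappa a * kappa b = (x - kappa a) * y + kappa a * (y - kappa b) by ring.
by apply: maxidD => //; [apply: maxidMr => //; apply: residue_V ry | apply: maxidMl].
Qed.

Lemma residueD x y a b : residue x a -> residue y b -> residue (x + y) (a + b).
Proof. by move=> rx ry; rewrite /residue rmorphD opprD addrACA; apply: maxidD. Qed.

Lemma residueN x a : residue x a -> residue (- x) (- a).
Proof. by move=> rx; rewrite /residue rmorphN -opprD; apply: maxidN. Qed.

Lemma residueB x y a b : residue x a -> residue y b -> residue (x - y) (a - b).
Proof. by move=> rx ry; apply: residueD => //; apply: residueN. Qed.

Lemma residueX x a n : residue x a -> residue (x ^+ n) (a ^+ n).
Proof.
move=> rx; elim: n => [|n IH]; last by rewrite !exprS; apply: residueM.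
by rewrite /residue !expr0 rmorph1 subrr; left.
Qed.

Lemma residue_m y : residue y 0 <-> m y.
Proof. by rewrite /residue rmorph0 subr0. Qed.

Lemma residue_inj y a b : residue y a -> residue y b -> a = b.
Proof.
move=> ra rb; apply/eqP; rewrite -subr_eq0; apply/eqP/m_kappa; rewrite rmorphB.
have -> : kappa a - kappa b = (y - kappa b) - (y - kappa a) by ring.
exact: maxidB.
Qed.

Lemma residue_unit y a : residue y a -> a != 0 -> [/\ ~ m y, y != 0, V y^-1 & residue y^-1 a^-1].
Proof.
move=> ry a0.
have nmy : ~ m y by move=> /residue_m h; move: a0; rewrite (residue_inj ry h) eqxx.
have [Vi y0] := unitV (residue_V ry) nmy.
split=> //; rewrite /residue.
have ka0 : kappa a != 0 by rewrite fmorph_eq0.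
have -> : y^-1 - kappa a^-1 = - (y^-1 * kappa a^-1 * (y - kappa a)).
  by rewrite fmorphV /=; field; rewrite ka0 y0.
apply: maxidN => //; apply: maxidMl => //; exact: (sub_ringM HB).
Qed.

Lemma residue_div x y a b : residue (x * y) a -> residue y b -> b != 0 -> residue x (a / b).
Proof.
move=> rxy ry b0; have [_ y0 _ ryi] := residue_unit ry b0.
by rewrite -(mulfK y0 x); apply: residueM.
Qed.

Lemma iota_infinity (p : {poly K}) : p != 0 ->
  exists v, V v /\ t ^+ (size p).-1 * iota p = kappa (lead_coef p) + t * v.
Proof.
move=> p0; set n := (size p).-1; have sp : size p = n.+1 by rewrite prednK // size_poly_gt0.
exists (\sum_(i < n) kappa p`_i * t ^+ (n - i).-1); split.
  apply: (sub_ring_sum HB) => i _; apply: (sub_ringM HB) => //.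
  by apply: (sub_ringX HB); apply: Vt.
rewrite -{1}[p]coefK poly_def sp big_ord_recr /= rmorphD mulrDr addrC; congr (_ + _).
  rewrite -mul_polyC rmorphM rmorphXn /= mulrCA exprVn mulVf ?mulr1 //.
  by rewrite expf_neq0 // X_neq0.
rewrite rmorph_sum /= !mulr_sumr; apply: eq_bigr => i _.
rewrite -mul_polyC rmorphM rmorphXn /= mulrCA [RHS]mulrCA; congr (_ * _).
rewrite -exprS prednK ?subn_gt0 //.
by have := expXV_sub (invr_neq0 X_neq0) (ltnW (ltn_ord i)); rewrite invrK.
Qed.

Lemma iota_infinity_residue (p : {poly K}) : residue (t ^+ (size p).-1 * iota p) (lead_coef p).
Proof.
have [->|p0] := eqVneq p 0; first by rewrite rmorph0 mulr0 lead_coef0; apply/residue_m; left.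
have [v [Vv ->]] := iota_infinity p0.
by rewrite /residue addrC addKr; apply: maxidMr.
Qed.

Lemma iota_notin_m (p : {poly K}) : p != 0 -> ~ m (iota p).
Proof.
move=> p0 mp; move: p0; rewrite -lead_coef_eq0 => /eqP; apply.
apply: (residue_inj (iota_infinity_residue p)); apply/residue_m.
by apply: maxidMl => //; apply: (sub_ringX HB); apply: Vt.
Qed.

(** For a fraction of polynomials, compare the degrees: leading coefficients give the residue, and
    [t] is a uniformiser. *)
Lemma fixed_infinity c : fixed c -> V c ->
  (exists2 k, k != 0 & residue c k) \/ exists2 v, V v & c = t * v.
Proof.
move=> fc Vc; have [a [b [b0 ec]]] := act_fixed fc.
have [a0|a0] := eqVneq a 0.
  by right; exists 0; rewrite ?mulr0 ?ec ?a0 ?rmorph0 ?mul0r //; apply: (sub_ring0 HB).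
set i := (size a).-1; set j := (size b).-1.
have ra := iota_infinity_residue a; have rb := iota_infinity_residue b.
rewrite -/i in ra; rewrite -/j in rb.
set ua := t ^+ i * iota a in ra; set ub := t ^+ j * iota b in rb.
have la : lead_coef a != 0 by rewrite lead_coef_eq0.
have lb : lead_coef b != 0 by rewrite lead_coef_eq0.
have [_ ua0 _ _] := residue_unit ra la.
have [_ ub0 Vub rbi] := residue_unit rb lb.
have rab := residueM ra rbi.
have tn0 n : t ^+ n != 0 by rewrite expf_neq0 // t_neq0.
have ib0 : iota b != 0 by rewrite iota_eq0.
have key : t ^+ i * c = t ^+ j * (ua / ub).
  by rewrite ec /ua /ub; field; rewrite ib0 tn0.
have [ltij|ltji|eij] := ltngtP i j.
- have [e ej] : exists e, j = (i.+1 + e)%N by exists (j - i).-1; move: ltij; lia.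
  right; exists (t ^+ e * (ua / ub)).
    apply: (sub_ringM HB); last exact: residue_V rab.
    by apply: (sub_ringX HB); apply: Vt.
  by apply: (mulfI (tn0 i)); rewrite key ej exprD exprSr; ring.
- left; have h : ua / ub = t ^+ (i - j) * c.
    by apply: (mulfI (tn0 j)); rewrite -key mulrA -exprD subnKC // ltnW.
  exfalso; have : m (ua / ub).
    by rewrite h; apply: maxidMr => //; apply: maxidXp => //; rewrite subn_gt0.
  move/residue_m => /(residue_inj rab) /eqP.
  by rewrite mulf_eq0 invr_eq0 (negPf la) (negPf lb).
- left; exists (lead_coef a / lead_coef b); first by rewrite mulf_neq0 ?invr_eq0.
  by rewrite -[c](mulKf (tn0 i)) key eij mulKf.
Qed.

Lemma fixed_residue c : fixed c -> V c -> exists k, residue c k.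
Proof.
move=> fc Vc; have [[k _ rk]|[v Vv ->]] := fixed_infinity fc Vc; first by exists k.
by exists 0; apply/residue_m; apply: maxidMr.
Qed.

Lemma fixed_m c : fixed c -> m c -> exists2 v, V v & c = t * v.
Proof.
move=> fc mc; have [[k k0 rk]|//] := fixed_infinity fc (maxid_sub HV mc).
by move/residue_m: mc => /(residue_inj rk) k0'; rewrite k0' eqxx in k0.
Qed.

(** Scaled by [t], the tower equation becomes [(t y)^(q+1) = k^(q+1)] modulo the maximal ideal. As
    [k^(q^2-1) = 1], the residue of [t y] is a root of [T^(q^2) - T], hence in [K]. *)
Lemma chain_infinity y : chain y -> exists2 k, k != 0 & residue (t * y) k.
Proof.
elim=> [|z {}y chz [k k0 rz] e].
  by exists 1; rewrite ?oner_eq0 // mulVf ?X_neq0 // -(rmorph1 kappa); apply: residue_kappa.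
have rt : residue t 0 by apply/residue_m.
have ry : residue ((t * y) ^+ q.+1) (k ^+ q.+1).
  have -> : (t * y) ^+ q.+1 = (t * z + t) ^+ q.+1 - t ^+ q.+1.
    by rewrite exprMn e mulrBr mulr1 -exprMn mulrDr mulr1.
  have -> : k ^+ q.+1 = (k + 0) ^+ q.+1 - 0 ^+ q.+1 by rewrite addr0 expr0n subr0.
  by apply: residueB; apply: residueX => //; apply: residueD.
have Vty : V (t * y) by apply: (@val_root _ _ HV _ q.+1) => //; apply: residue_V ry.
have k1 : k ^+ (q.+1 * q.-1) = 1.
  apply: (mulfI k0); rewrite -exprS mulr1 -addn1 -expq2 -cardK; exact: expf_card.
have [|c rc] := kappa_residue HV VK Vty.
  have -> : (t * y) ^+ (q ^ 2) - t * y = (((t * y) ^+ q.+1) ^+ q.-1 - 1) * (t * y).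
    by rewrite expq2 exprD expr1 exprM; ring.
  apply: maxidMr => //; have := residueX q.-1 ry.
  by rewrite -exprM k1 /residue rmorph1.
exists c => //; apply/eqP => c0; rewrite c0 in rc.
have := residue_inj ry (residueX q.+1 rc); rewrite expr0n /= => /eqP.
by rewrite expf_eq0 (negPf k0) andbF.
Qed.

Lemma chain_moved g : g != 1%g ->
  exists z y, [/\ chain z, y ^+ q.+1 = (z + 1) ^+ q.+1 - 1, act g z = z & act g y <> y].
Proof.
move=> g1; apply: contrapT => h; move/eqP: g1; apply; apply: chain_gen => y.
elim=> [|z {}y chz gz e]; first exact: act_iota.
by apply: contrapT => gy; apply: h; exists z, y.
Qed.

(** For [g] other than 1, follow a chain to the first [y] moved by [g]. It is multiplied by a
    constant other than 1, so [t * y] and its image have distinct residues. *)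
Lemma separating_family : exists c : G -> L,
  [/\ forall g h, exists k, residue (act h (c g)) k
    & forall g, g != 1%g -> ~ m (c g - act g (c g))].
Proof.
suff /choice[c Hc] : forall g, exists c,
    (forall h, exists k, residue (act h c) k) /\ (g != 1%g -> ~ m (c - act g c)).
  by exists c; split=> g; [apply: (Hc g).1 | apply: (Hc g).2].
move=> g; have [->|/chain_moved[z [y [chz e gz gy]]]] := eqVneq g 1%g.
  by exists 1; split=> // h; exists 1; rewrite rmorph1 -(rmorph1 kappa); apply: residue_kappa.
exists (t * y); have chy := chain_step chz e; split=> [h|_].
  by rewrite rmorphM fixed_t; have [k _ rk] := chain_infinity (chain_act h chy); exists k.
have y0 : y != 0 by apply/eqP => y0; apply: gy; rewrite y0 rmorph0.
have [k [gky _]] := kummer gz e y0.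
have [a a0 ra] := chain_infinity chy.
have -> : t * y - act g (t * y) = (1 - kappa k) * (t * y).
  by rewrite rmorphM fixed_t gky; ring.
move/residue_m => h; have rk : residue (1 - kappa k) (1 - k).
  by rewrite /residue rmorphB rmorph1 subrr; left.
have := residue_inj h (residueM rk ra) => /esym/eqP.
rewrite mulf_eq0 (negPf a0) orbF subr_eq0 => /eqP k1; apply: gy.
by rewrite gky -k1 rmorph1 mul1r.
Qed.

Lemma residue_conjs c : (forall h, exists k, residue (act h c) k) -> R c.
Proof. by move=> rc h; have [k rk] := rc h; apply: residue_V rk. Qed.

(** The factors from [separating_family] remove every conjugate but the first in [trace_separation]
    and leave [u * f], where [u] has a nonzero residue and can be divided out. Local claims are
    thereby tested on traces, which lie in [K(x)]. *)
Lemma infinity_separation (N : L -> Prop) f :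
  (forall x y, N x -> N y -> N (x - y)) ->
  (forall x y k, residue x k -> N y -> N (x * y)) ->
  (forall b, R b -> N (Tr (f * b))) -> N f.
Proof.
have [c [rc sc]] := separating_family => NB NM Nf.
pose gs := enum (~: [set 1%g : G]).
pose u := \prod_(g <- gs) (c g - act g (c g)).
have [k k0 ru] : exists2 k, k != 0 & residue u k.
  have Vf g : V (c g - act g (c g)).
    by apply: (sub_ringB HB); [apply: conjs_sub|]; apply: residue_conjs.
  have [k rk] : exists k, residue u k.
    rewrite /u; elim: (gs) => [|g s [k rk]].
      by exists 1; rewrite big_nil -(rmorph1 kappa); apply: residue_kappa.
    have [a ra] := rc g g; have [b rb] := rc g 1%g; rewrite act1 in rb.
    by exists ((b - a) * k); rewrite big_cons; apply: residueM => //; apply: residueB.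
  exists k => //; apply/eqP => k0; move: rk; rewrite k0 => /residue_m.
  move=> /(maxid_prod_prime HV)[] // g; rewrite mem_enum in_setC in_set1.
  exact: sc.
have Nu : N (u * f).
  have := @trace_separation V HV N c gs NB (fun g => residue_conjs (rc g)).
  have NM' g x : N x -> N (act g (c g) * x) by have [a ra] := rc g g; apply: (NM _ _ _ ra).
  move/(_ NM' f Nf); rewrite (bigD1 1%g) //= [X in _ + X]big1 ?addr0 => [|h h1].
    rewrite act1 mulrC; congr (N (_ * _)); apply: eq_bigr => g _.
    by rewrite act1.
  rewrite (bigD1_seq h) ?enum_uniq ?mem_enum ?in_setC ?in_set1 //=.
  by rewrite subrr mul0r mulr0.
have [_ u0 _ ri] := residue_unit ru k0.
by rewrite -(mulKf u0 f); apply: NM Nu; apply: ri.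
Qed.

Lemma conjs_residue y : R y -> exists k, residue y k.
Proof.
move=> Ry; apply: (@infinity_separation (fun z => exists k, residue z k)) => [a b [k rk] [l rl]|a b k ra [l rl]|b Rb].
- by exists (k - l); apply: residueB.
- by exists (k * l); apply: residueM.
- apply: fixed_residue; first exact: fixed_Tr.
  by apply: V_Tr => //; apply: (sub_ringM RB).
Qed.

Lemma conjs_m y : (forall g, m (act g y)) -> exists2 v, V v & y = t * v.
Proof.
move=> my; apply: (@infinity_separation (fun z => exists2 v, V v & z = t * v)) => [_ _ [a Va ->] [b Vb ->]|a _ k ra [b Vb ->]|b Rb].
- by exists (a - b); [apply: (sub_ringB HB) | rewrite mulrBr].
- by exists (a * b); [apply: (sub_ringM HB) => //; apply: residue_V ra | rewrite mulrCA].
- apply: fixed_m; first exact: fixed_Tr.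
  by apply: m_Tr => // g; rewrite rmorphM; apply: maxidMr.
Qed.

Lemma V_residue y : V y -> exists k, residue y k.
Proof.
move=> Vy; have [r [Rr nmr Rry]] := horner_tail_lemma HV Vy.
have [a ra] := conjs_residue Rr; have [b rb] := conjs_residue Rry.
have a0 : a != 0 by apply/eqP => a0; apply: nmr; apply/residue_m; rewrite -a0.
by exists (b / a); apply: residue_div ra a0; rewrite mulrC.
Qed.

(** To reach [conjs_m], multiply [y] by [r], which brings all conjugates into [V], and by [e], a
    unit at this place that lies in the maximal ideal after every other group element. *)
Lemma m_t y : m y -> exists2 v, V v & y = t * v.
Proof.
move=> my; have [r [Rr nmr Rry]] := horner_tail_lemma HV (maxid_sub HV my).
have [c [rc sc]] := separating_family.
have /choice[k Hk] : forall g, exists k, residue (act g (c g)) k by move=> g; apply: rc.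
pose gs := enum (~: [set 1%g : G]).
pose e := \prod_(g <- gs) (c g - kappa (k g)).
have Re : R e.
  move=> h; rewrite rmorph_prod; apply: (sub_ring_prod HB) => g _.
  rewrite rmorphB /= act_iota; apply: (sub_ringB HB); last exact: VK.
  exact: (residue_conjs (rc g)).
have me : forall h, h != 1%g -> m (act h e).
  move=> h h1; rewrite rmorph_prod (bigD1_seq h) ?enum_uniq ?mem_enum ?in_setC ?in_set1 //=.
  apply: maxidMr => //; first by rewrite rmorphB /= act_iota; apply: Hk.
  apply: (sub_ring_prod HB) => g _; rewrite rmorphB /= act_iota; apply: (sub_ringB HB); last exact: VK.
  exact: (residue_conjs (rc g)).
have nme : ~ m e.
  move=> /(maxid_prod_prime HV)[g _|g].
    apply: (sub_ringB HB) => //; apply: conjs_sub; exact: (residue_conjs (rc g)).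
  rewrite mem_enum in_setC in_set1 => g1 mg; apply: (sc g g1).
  have -> : c g - act g (c g) = (c g - kappa (k g)) - (act g (c g) - kappa (k g)) by ring.
  by apply: maxidB => //; apply: Hk.
have [v Vv ev] : exists2 v, V v & e * (r * y) = t * v.
  apply: conjs_m => g; have [->|g1] := eqVneq g 1%g.
    rewrite act1; apply: maxidMl => //; first exact: conjs_sub Re.
    by apply: maxidMl => //; apply: conjs_sub Rr.
  by rewrite rmorphM; apply: maxidMr => //; apply: me.
have [Vei e0] := unitV (conjs_sub Re) nme.
have [Vri r0] := unitV (conjs_sub Rr) nmr.
exists (e^-1 * r^-1 * v); first by apply: (sub_ringM HB) => //; apply: (sub_ringM HB).
have -> : t * (e^-1 * r^-1 * v) = e^-1 * r^-1 * (t * v) by ring.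
by rewrite -ev; field; rewrite e0 r0.
Qed.

(** Otherwise its norm would be a nonzero polynomial vanishing at infinity. *)
Lemma integral_no_small f : integral f -> (forall g, m (act g f)) -> f = 0.
Proof.
move=> If mf; apply/eqP/negP => /negP f0.
have [a a0 ea] := integral_norm If f0; apply: (iota_notin_m a0).
rewrite -ea (bigD1 1%g) //=; apply: maxidMr => //.
by apply: (sub_ring_prod HB) => g _; apply: (maxid_sub HV).
Qed.

(* [f] has poles of order at most [n] at all places at infinity. *)
Definition deg_le n f := R (t ^+ n * f).

Lemma deg_leP n f : deg_le n f <-> forall g, V (t ^+ n * act g f).
Proof.
by split=> h g; have := h g; rewrite rmorphM rmorphXn /= fixed_t.
Qed.

Lemma VtX n y : V y -> V (t ^+ n * y).
Proof. by move=> Vy; apply: (sub_ringM HB) => //; apply: (sub_ringX HB); apply: Vt. Qed.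

Lemma deg_le_weak n n' f : (n <= n')%N -> deg_le n f -> deg_le n' f.
Proof.
move=> le /deg_leP h; apply/deg_leP => g.
by rewrite -(subnK le) exprD -mulrA; apply: VtX.
Qed.

Lemma tX n : t ^+ n * X ^+ n = 1.
Proof. by rewrite exprVn mulVf // expf_neq0 // X_neq0. Qed.

(** Multiply the conjugates: [t^(M d)] times the norm is divisible by [t^(#|Z| r)], and the norm, a
    nonzero polynomial, has no zero at infinity. *)
Lemma zero_bound M r f (Z : {set G}) : integral f -> f != 0 -> deg_le M f ->
  (forall g, g \in Z -> exists2 v, V v & t ^+ M * act g f = t ^+ r * v) ->
  (#|Z| * r <= M * d)%N.
Proof.
move=> If f0 /deg_leP Vf HZ; rewrite leqNgt; apply/negP => lt.
have [a a0 ea] := integral_norm If f0; apply: (iota_notin_m a0).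
have tn0 n : t ^+ n != 0 by rewrite expf_neq0 // t_neq0.
have [v Vv ev] : exists2 v, V v & t ^+ (M * d) * iota a = t ^+ (#|Z| * r) * v.
  have -> : t ^+ (M * d) * iota a = \prod_g (t ^+ M * act g f).
    by rewrite big_split /= ea prodr_const -exprM.
  rewrite (bigID [in Z]) /=.
  have [v Vv ->] : exists2 v, V v & \prod_(g in Z) (t ^+ M * act g f) = t ^+ (#|Z| * r) * v.
    rewrite -big_enum /= cardE; have : {subset enum Z <= Z} by move=> g; rewrite mem_enum.
    elim: (enum Z) => [|g s IH] sZ.
      by exists 1; rewrite ?big_nil ?mul0n ?expr0 ?mulr1 //; apply: (sub_ring1 HB).
    have [|v Vv ev] := IH _; first by move=> h hs; apply: sZ; rewrite inE hs orbT.
    have [|u Vu eu] := HZ g; first by apply: sZ; rewrite mem_head.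
    exists (u * v); first exact: (sub_ringM HB).
    by rewrite big_cons eu ev /= mulSn exprD; ring.
  exists (v * \prod_(g | g \notin Z) (t ^+ M * act g f)); last by rewrite mulrA.
  by apply: (sub_ringM HB) => //; apply: (sub_ring_prod HB) => g _.
have -> : iota a = t ^+ (#|Z| * r - M * d) * v.
  by apply: (mulfI (tn0 (M * d)%N)); rewrite ev mulrA -exprD subnKC // ltnW.
by apply: maxidMr => //; apply: maxidXp; rewrite // subn_gt0.
Qed.

Lemma fixed_deg c : fixed c -> exists j, V (t ^+ j * c).
Proof.
case/act_fixed => a [b [b0 ->]]; exists (size a).-1.
have ra := iota_infinity_residue a; have rb := iota_infinity_residue b.
have lb : lead_coef b != 0 by rewrite lead_coef_eq0.
have [_ ub0 Vub _] := residue_unit rb lb.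
have -> : t ^+ (size a).-1 * (iota a / iota b) =
  (t ^+ (size a).-1 * iota a) * (t ^+ (size b).-1 * (t ^+ (size b).-1 * iota b)^-1).
  by rewrite invfM mulVKf ?mulrA // expf_neq0 // t_neq0.
by apply: (sub_ringM HB); [apply: residue_V ra | apply: VtX].
Qed.

Lemma exists_deg f : exists n, deg_le n f.
Proof.
have /choice[j Hj] : forall i, exists j, V (t ^+ j * (norm_poly f)`_i).
  by move=> i; apply: fixed_deg; apply: fixed_norm_poly.
pose J := (\sum_(i < d) j i)%N.
exists J; apply/deg_leP => g.
apply: (@val_integral _ _ HV (fun i => - (t ^+ (J * (d - i)) * (norm_poly f)`_i)) _ d) => [i id|].
  apply: (sub_ringN HB).
  have le : (j i <= J * (d - i))%N.
    have jJ : (j i <= J)%N by rewrite /J (bigD1 (Ordinal id)) //= leq_addr.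
    by apply: (leq_trans jJ); rewrite leq_pmulr // subn_gt0.
  by rewrite -(subnK le) exprD -mulrA; apply: VtX.
rewrite exprMn norm_poly_rel mulr_sumr; apply: eq_bigr => i _.
rewrite exprMn -!exprM.
have -> : (J * d = J * (d - i) + J * i)%N by rewrite -mulnDr subnK // ltnW.
by rewrite exprD; ring.
Qed.

Lemma fixed_proper c : fixed c -> exists p s, [/\ c = iota p + s, fixed s & m s].
Proof.
case/act_fixed => a [b [b0 ->]].
have ib0 : iota b != 0 by rewrite iota_eq0.
exists (a %/ b), (iota (a %% b) / iota b); split.
- by apply: (mulIf ib0); rewrite divfK // mulrDl divfK // -rmorphM -rmorphD -divp_eq.
- by apply: fixedM; [|apply: fixedV]; apply: fixed_iota.
set r := a %% b; have [->|r0] := eqVneq r 0; first by rewrite rmorph0 mul0r; left.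
have lt : ((size r).-1 < (size b).-1)%N.
  by rewrite -ltnS !prednK ?size_poly_gt0 // ltn_modp.
have rr := iota_infinity_residue r; have rb := iota_infinity_residue b.
have lb : lead_coef b != 0 by rewrite lead_coef_eq0.
have [_ ub0 Vub _] := residue_unit rb lb.
have -> : iota r / iota b = t ^+ ((size b).-1 - (size r).-1) *
  ((t ^+ (size r).-1 * iota r) * (t ^+ (size b).-1 * iota b)^-1).
  apply: (mulIf (mulf_neq0 (expf_neq0 (size b).-1 t_neq0) ib0)).
  rewrite -[RHS]mulrA divfK // [RHS]mulrA -exprD subnK; last exact: ltnW.
  by rewrite mulrCA divfK.
apply: maxidMr => //; first by apply: maxidXp; rewrite // subn_gt0.
by apply: (sub_ringM HB) => //; apply: residue_V rr.
Qed.

(** After a translation only the coefficient at 1 matters. Replacing [y] by [c g * y] and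
    subtracting multiplies each coefficient by [act h (c g) - act g (c g)], which removes all [h]
    other than 1. *)
Lemma dedekind (a : G -> L) : (forall y, \sum_h a h * act h y = 0) -> forall g, a g = 0.
Proof.
suff key b : (forall y, \sum_h b h * act h y = 0) -> b 1%g = 0.
  move=> ha g; have := key (fun h => a (g * h)%g); rewrite mulg1; apply=> y.
  rewrite -[RHS](ha (act g^-1%g y)) [RHS](reindex_inj (mulgI g)) /=.
  by apply: eq_bigr => h _; rewrite -actM mulKg.
have [c [_ sc]] := separating_family => hb.
pose gs := enum (~: [set 1%g : G]).
have : forall y, \sum_h b h * \prod_(g <- gs) (act h (c g) - act g (c g)) * act h y = 0.
  elim: (gs) => [|g s IH] y.
    by rewrite -[RHS](hb y); apply: eq_bigr => h _; rewrite big_nil mulr1.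
  pose S z := \sum_h b h * \prod_(g0 <- s) (act h (c g0) - act g0 (c g0)) * act h z.
  have S0 z : S z = 0 by apply: IH.
  transitivity (S (c g * y) - act g (c g) * S y); last by rewrite !S0 mulr0 subr0.
  rewrite /S mulr_sumr -sumrB; apply: eq_bigr => h _.
  by rewrite big_cons rmorphM; ring.
move/(_ 1); rewrite (bigD1 1%g) //= [X in _ + X]big1 ?addr0 => [|h h1]; last first.
  rewrite (bigD1_seq h) ?enum_uniq ?mem_enum ?in_setC ?in_set1 //=.
  by rewrite subrr mul0r mulr0 mul0r.
rewrite act1 mulr1 => /eqP; rewrite mulf_eq0 => /orP[/eqP //|].
rewrite prodf_seq_eq0 => /hasP[g]; rewrite mem_enum in_setC in_set1 => g1 /=.
by rewrite act1 => /eqP e0; case: (sc g g1); left.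
Qed.

(** * Reduced bases *)

Definition in_span (e : nat -> L) n y :=
  exists2 c : nat -> L, forall i, fixed (c i) & y = \sum_(i < n) c i * e i.

Lemma in_span_weak e i n y : (i <= n)%N -> in_span e i y -> in_span e n y.
Proof.
move=> le [c fc ->]; exists (fun j => if (j < i)%N then c j else 0) => [j|].
  by case: ifP => _ // g; rewrite rmorph0.
rewrite (big_ord_widen n (fun j => c j * e j) le) big_mkcond /=.
by apply: eq_bigr => j _; case: ifP => _ //; rewrite mul0r.
Qed.

Lemma in_span_ext e e' n y : (forall i, (i < n)%N -> e i = e' i) -> in_span e n y -> in_span e' n y.
Proof. by move=> ee' [c fc ->]; exists c => //; apply: eq_bigr => i _; rewrite ee'. Qed.

Lemma in_span_unscale e n c y : fixed c -> c != 0 -> in_span e n (c * y) -> in_span e n y.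
Proof.
move=> fc c0 [a fa ey]; exists (fun i => c^-1 * a i) => [i|].
  by apply: fixedM => //; apply: fixedV.
by rewrite -[y](mulKf c0) ey mulr_sumr; apply: eq_bigr => i _; rewrite mulrA.
Qed.

Lemma in_span_top e n (c : nat -> L) : (forall i, fixed (c i)) -> c n != 0 ->
  in_span e n (\sum_(i < n.+1) c i * e i) -> in_span e n (e n).
Proof.
move=> fc c0 [a fa]; rewrite big_ord_recr /= => ea.
apply: (in_span_unscale (fc n) c0); exists (fun i => a i - c i) => [i g|].
  by rewrite rmorphB fa fc.
rewrite -(addKr (\sum_(i < n) c i * e i) (c n * e n)) ea addrC -sumrB.
by apply: eq_bigr => i _; rewrite mulrBl.
Qed.

(** The [d] rows of conjugates of [n < d] elements are dependent; if these elements spanned [L],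
    this would be a linear relation between automorphisms. *)
Lemma exists_outside_span e n : (n < d)%N -> exists y, ~ in_span e n y.
Proof.
move=> nd; apply: contrapT => h.
have all y : in_span e n y by apply: contrapT => ny; apply: h; exists y.
pose A := \matrix_(k < d, i < n) act (enum_val k) (e i).
have : kermx A != 0.
  by rewrite kermx_eq0 /row_free neq_ltn (leq_ltn_trans (rank_leq_col A) nd).
case/rowV0Pn => v /sub_kermxP vA v0.
have v0k : forall g, v 0 (enum_rank g) = 0.
  apply: (@dedekind (fun g => v 0 (enum_rank g))) => y; have [c fc ->] := all y.
  under eq_bigr do rewrite rmorph_sum mulr_sumr.
  rewrite exchange_big /= big1 // => i _.
  under eq_bigr do rewrite rmorphM fc mulrCA.
  rewrite -mulr_sumr (reindex (@enum_val G G)) /=; last exact: (onW_bij _ (@enum_val_bij G)).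
  have /matrixP /(_ 0 i) := vA; rewrite !mxE => ev.
  transitivity (c i * \sum_k v 0 k * A k i); last by rewrite ev mulr0.
  by congr (_ * _); apply: eq_bigr => k _; rewrite mxE enum_valK.
case/eqP: v0; apply/rowP => k; rewrite mxE -(enum_valK k); exact: v0k.
Qed.

(* Greedy choice: each [e i] has minimal degree outside the span of its predecessors. *)
Definition reduced n (e : nat -> L) (dd : nat -> nat) := forall i, (i < n)%N ->
  [/\ integral (e i), deg_le (dd i) (e i), ~ in_span e i (e i)
    & forall f j, integral f -> ~ in_span e i f -> deg_le j f -> (dd i <= j)%N].

Lemma exists_reduced n : (n <= d)%N -> exists e dd, reduced n e dd.
Proof.
elim: n => [|n IH] nd; first by exists (fun=> 0), (fun=> 0%N).
have [e [dd red]] := IH (ltnW nd).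
pose P j := `[< exists f, [/\ integral f, ~ in_span e n f & deg_le j f] >].
have exP : exists j, P j.
  have [y ny] := exists_outside_span e nd.
  have [b b0 Ib] := multiple_integral y; have [j dj] := exists_deg (iota b * y).
  exists j; apply/asboolP; exists (iota b * y); split=> // h; apply: ny.
  by apply: (in_span_unscale (fixed_iota b) _ h); rewrite iota_eq0.
case: (ex_minnP exP) => j /asboolP[f [If nf dj]] minj.
pose e' i := if (i < n)%N then e i else f.
pose dd' i := if (i < n)%N then dd i else j.
have ee' i : (i <= n)%N -> forall k, (k < i)%N -> e k = e' k.
  by move=> le k ki; rewrite /e' (leq_trans ki le).
have e'e i : (i <= n)%N -> forall k, (k < i)%N -> e' k = e k by move=> le k ki; rewrite (ee' i).
exists e', dd' => i; rewrite ltnS leq_eqVlt => /orP[/eqP ->|ltin].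
  rewrite /e' /dd' ltnn; split=> // [h|f' j' If' nf' dj'].
    by apply: nf; apply: in_span_ext h; apply: e'e.
  apply: minj; apply/asboolP; exists f'; split=> // h; apply: nf'.
  by apply: in_span_ext h; apply: ee'.
have [a b c D] := red i ltin; have le := ltnW ltin.
rewrite {1 2 4}/e' /dd' ltin; split=> // [h|f' j' If' nf'].
  by apply: c; apply: in_span_ext h; apply: e'e.
by apply: D => // h; apply: nf'; apply: in_span_ext h; apply: ee'.
Qed.

Lemma residue_sum I (r : seq I) (P : pred I) (F : I -> L) (f : I -> K) :
  (forall i, P i -> residue (F i) (f i)) ->
  residue (\sum_(i <- r | P i) F i) (\sum_(i <- r | P i) f i).
Proof.
move=> Ff; apply: (big_ind2 residue) => //; last by move=> *; apply: residueD.
by apply/residue_m; left.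
Qed.

Lemma residue_prod I (r : seq I) (P : pred I) (F : I -> L) (f : I -> K) :
  (forall i, P i -> residue (F i) (f i)) ->
  residue (\prod_(i <- r | P i) F i) (\prod_(i <- r | P i) f i).
Proof.
move=> Ff; apply: (big_ind2 residue) => //; last by move=> *; apply: residueM.
by rewrite -(rmorph1 kappa); apply: residue_kappa.
Qed.

Lemma residue_det n (Y : 'M[L]_n) (U : 'M[K]_n) :
  (forall i j, residue (Y i j) (U i j)) -> residue (\det Y) (\det U).
Proof.
move=> YU; apply: residue_sum => s _; apply: residueM; last by apply: residue_prod.
by apply: residueX; apply: residueN; rewrite -(rmorph1 kappa); apply: residue_kappa.
Qed.

(** Since [t] is a uniformiser at each place, such an [f] would have degree [dd i - 1], against
    minimality; if [dd i = 0] it would be 0, which lies in every span. *)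
Lemma reduced_min n e dd i f : reduced n e dd -> (i < n)%N -> integral f ->
  ~ in_span e i f -> ~ (forall g, m (t ^+ dd i * act g f)).
Proof.
move=> red ltin If nf mf; have [_ _ _ mind] := red i ltin.
case E : (dd i) => [|D] in mf mind.
  apply: nf; rewrite (integral_no_small If) => [|g].
    by exists (fun=> 0) => [_ g|]; rewrite ?rmorph0 // big1 // => j _; rewrite mul0r.
  by have := mf g; rewrite expr0 mul1r.
have : (D.+1 <= D)%N.
  apply: (mind f) => //; apply/deg_leP => g; have [v Vv ev] := m_t (mf g).
  suff -> : t ^+ D * act g f = v by [].
  by apply: (mulfI t_neq0); rewrite -ev exprS mulrA.
by rewrite ltnn.
Qed.

Lemma reduced_mono n e dd i j : reduced n e dd -> (i <= j)%N -> (j < n)%N -> (dd i <= dd j)%N.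
Proof.
move=> red le lt; have [Ij dj nj _] := red j lt.
have [_ _ _ mind] := red i (leq_ltn_trans le lt).
by apply: mind dj => // h; apply: nj; apply: in_span_weak h.
Qed.

Lemma top_index (P : pred nat) n i : (i < n)%N -> P i ->
  exists k, [/\ (k < n)%N, P k & forall j, (k < j < n)%N -> ~~ P j].
Proof.
move=> ltin Pi; pose Q k := (k < n)%N && P k.
have [||k /andP[kn Pk] maxk] := @ex_maxnP Q n; first by exists i; rewrite /Q ltin.
  by move=> k /andP[/ltnW].
exists k; split=> // j /andP[kj jn]; apply/negP => Pj.
by have := maxk j; rewrite /Q jn Pj leqNgt kj => /(_ isT).
Qed.

Lemma reduced_top n e dd (c : nat -> L) k : reduced n e dd ->
  (forall i, fixed (c i)) -> integral (\sum_(i < n) c i * e i) ->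
  (k < n)%N -> c k != 0 -> (forall i, (k < i < n)%N -> c i = 0) ->
  ~ (forall g, m (t ^+ dd k * act g (\sum_(i < n) c i * e i))).
Proof.
move=> red fc Ic kn ck c0; apply: (reduced_min red kn Ic) => h.
have [_ _ nk _] := red k kn; apply: nk; apply: (in_span_top fc ck).
have -> // : \sum_(j < k.+1) c j * e j = \sum_(j < n) c j * e j.
rewrite (big_ord_widen n (fun j => c j * e j) kn) big_mkcond /=.
apply: eq_bigr => j _; rewrite ltnS; case: leqP => // kj.
by rewrite c0 ?mul0r // kj ltn_ord.
Qed.

(** * A full reduced basis, its trace dual and its degrees *)

Section FullBasis.
Variables (e : nat -> L) (dd : nat -> nat).
Hypothesis red : reduced d e dd.

Let y i := t ^+ dd i * e i.
Let Ry i : (i < d)%N -> R (y i). Proof. by case/red. Qed.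
Let Y := \matrix_(i < d, k < d) act (enum_val k) (y i).

Lemma exists_leading : exists U : 'M[K]_d, forall i k, residue (Y i k) (U i k).
Proof.
have /choice[U HU] : forall ik : 'I_d * 'I_d, exists u, residue (Y ik.1 ik.2) u.
  by move=> [i k] /=; apply: V_residue; rewrite mxE; apply: Ry.
exists (\matrix_(i, k) U (i, k)) => i k; rewrite [X in residue _ X]mxE; exact: (HU (i, k)).
Qed.

Let U := projT1 (cid exists_leading).
Let HU : forall i k, residue (Y i k) (U i k) := projT2 (cid exists_leading).

(** A relation between the rows of leading coefficients, homogenised by powers of [X] up to its top
    index [k], is an integral function outside the span of its predecessors whose terms of degree
    [dd k] all cancel, against [reduced_top]. *)
Lemma leading_unit : U \in unitmx.
Proof.
rewrite -row_free_unit -kermx_eq0; apply: contrapT => /negP/rowV0Pn[v /sub_kermxP vU].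
case/eqP; apply/rowP => i0; rewrite mxE.
apply: contrapT => /eqP vi0.
pose v' i := if insub i is Some j then v 0 j else 0.
have v'E (j : 'I_d) : v' j = v 0 j by rewrite /v' valK.
have [||k [kd v'k v'0]] := @top_index (fun i => v' i != 0) d i0 => //; first by rewrite v'E.
pose c i := kappa (v' i) * X ^+ (dd k - dd i).
have fc i : fixed (c i).
  by apply: fixedM; [apply: fixed_kappa | move=> g; rewrite rmorphXn act_iota].
have c0 i : (k < i < d)%N -> c i = 0.
  by move=> /v'0; rewrite negbK => /eqP vi; rewrite /c vi rmorph0 mul0r.
apply: (reduced_top red fc _ kd _ c0).
- apply: (sub_ring_sum integral_sub_ring) => i _; apply: (sub_ringM integral_sub_ring).
    apply: (sub_ringM integral_sub_ring); first exact: integral_iota.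
    by rewrite -rmorphXn; apply: integral_iota.
  by have [] := red (ltn_ord i).
- by rewrite mulf_neq0 ?fmorph_eq0 // expf_neq0 // X_neq0.
move=> g; apply/residue_m.
have <- : \sum_(i < d) v 0 i * U i (enum_rank g) = 0.
  by move/matrixP/(_ 0 (enum_rank g)): vU; rewrite !mxE.
rewrite rmorph_sum mulr_sumr; apply: residue_sum => i _; rewrite rmorphM fc /c v'E.
have [vi|vi] := eqVneq (v 0 i) 0.
  by rewrite vi rmorph0 !mul0r mulr0; apply/residue_m; left.
have ik : (i <= k)%N.
  rewrite leqNgt; apply/negP => ki; move: vi; rewrite -v'E.
  by apply/negP; apply: v'0; rewrite ki ltn_ord.
have le := reduced_mono red ik kd.
have -> : t ^+ dd k * (kappa (v 0 i) * X ^+ (dd k - dd i) * act g (e i)) = kappa (v 0 i) * Y i (enum_rank g).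
  rewrite mxE enum_rankK rmorphM rmorphXn /= fixed_t -{1}(subnK le) exprD.
  rewrite -[RHS]mul1r -(tX (dd k - dd i)); ring.
by apply: residueM; [apply: residue_kappa | apply: HU].
Qed.

(** The Gram matrix of the trace form on the scaled basis. Its determinant has residue
    [\det U ^+ 2], a unit, so the inverse and the dual family [w] are regular at infinity. *)
Let T := Y *m Y^T.

Lemma gramE i j : T i j = Tr (y i * y j).
Proof.
rewrite mxE /Tr (reindex (@enum_val G G)) /=; last exact: (onW_bij _ (@enum_val_bij G)).
by apply: eq_bigr => k _; rewrite [RHS]rmorphM !mxE.
Qed.

Lemma fixed_sub_ring : sub_ring fixed.
Proof.
split=> [g|a b fa fb g|]; [exact: rmorph1 | by rewrite rmorphB fa fb | exact: fixedM].
Qed.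

Lemma gram_V i j : V (T i j).
Proof. by rewrite gramE; apply: V_Tr => //; apply: (sub_ringM RB); apply: Ry. Qed.

Lemma gram_fixed i j : fixed (T i j).
Proof. by rewrite gramE; apply: fixed_Tr. Qed.

Lemma det_gram : residue (\det T) (\det U ^+ 2).
Proof. by rewrite det_mulmx det_tr expr2; apply: residueM; apply: residue_det. Qed.

Let detU : \det U ^+ 2 != 0.
Proof. by rewrite expf_neq0 // -unitfE; apply: leading_unit. Qed.

Lemma gram_unit : T \in unitmx.
Proof. by rewrite unitmxE unitfE; have [] := residue_unit det_gram detU. Qed.

Let C := invmx T.

Lemma invgramE i j : C i j = (\det T)^-1 * (\adj T) i j.
Proof. by rewrite /C /invmx gram_unit mxE. Qed.

Lemma invgram_V i j : V (C i j).
Proof.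
rewrite invgramE; apply: (sub_ringM HB); first by have [] := residue_unit det_gram detU.
by apply: (sub_ring_adj HB); apply: gram_V.
Qed.

Lemma invgram_fixed i j : fixed (C i j).
Proof.
rewrite invgramE; apply: fixedM.
  by apply: fixedV; apply: (sub_ring_det fixed_sub_ring); apply: gram_fixed.
by apply: (sub_ring_adj fixed_sub_ring); apply: gram_fixed.
Qed.

Let w (i : 'I_d) := \sum_j C i j * y j.

Lemma Tr_sum I (r : seq I) (F : I -> L) : Tr (\sum_(i <- r) F i) = \sum_(i <- r) Tr (F i).
Proof. by rewrite /Tr exchange_big; apply: eq_bigr => h _; rewrite rmorph_sum. Qed.

Lemma w_dual (i k : 'I_d) : Tr (w i * y k) = (i == k)%:R.
Proof.
transitivity ((C *m T) i k); last by rewrite mulVmx ?mxE ?gram_unit.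
rewrite [RHS]mxE /w mulr_suml Tr_sum; apply: eq_bigr => j _.
by rewrite gramE -TrZ ?mulrA //; apply: invgram_fixed.
Qed.

Lemma gram_nondegenerate f : (forall k : 'I_d, Tr (f * y k) = 0) -> f = 0.
Proof.
move=> hf; pose v := \row_(k < d) act (enum_val k) f.
have Yu : Y \in unitmx.
  by have := gram_unit; rewrite /T unitmx_mul => /andP[].
have : v *m Y^T = 0.
  apply/rowP => k; rewrite mxE [RHS]mxE.
  transitivity (Tr (f * y k)); last exact: hf.
  rewrite /Tr [RHS](reindex (@enum_val G G)) /=; last exact: (onW_bij _ (@enum_val_bij G)).
  by apply: eq_bigr => j _; rewrite [RHS]rmorphM !mxE.
move/(congr1 (fun Z => Z *m invmx Y^T)); rewrite mulmxK ?unitmx_tr // mul0mx.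
by move/rowP/(_ (enum_rank 1%g)); rewrite !mxE enum_rankK act1.
Qed.

Lemma basis_span f : exists2 c : nat -> L, forall i, fixed (c i) & f = \sum_(i < d) c i * e i.
Proof.
have fTr i : fixed (Tr (f * w i)) by apply: fixed_Tr.
pose b (i : nat) := if insub i is Some j then Tr (f * w j) * t ^+ dd i else 0.
have bE (j : 'I_d) : b j = Tr (f * w j) * t ^+ dd j by rewrite /b valK.
exists b => [i|].
  rewrite /b; case: insub => [j|]; last by move=> g; rewrite rmorph0.
  by apply: fixedM => //; apply: (sub_ringX fixed_sub_ring); apply: fixed_t.
apply/eqP; rewrite -subr_eq0; apply/eqP/gram_nondegenerate => k.
rewrite mulrBl TrB; apply/eqP; rewrite subr_eq0; apply/eqP.
have -> : (\sum_(i < d) b i * e i) * y k = \sum_(i < d) Tr (f * w i) * (y i * y k).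
  by rewrite mulr_suml; apply: eq_bigr => i _; rewrite bE /y; ring.
have -> : Tr (\sum_(i < d) Tr (f * w i) * (y i * y k)) = \sum_(i < d) Tr (f * w i) * Tr (y i * y k).
  by rewrite Tr_sum; apply: eq_bigr => i _; rewrite TrZ.
transitivity (\sum_(i < d) Tr (f * y i) * Tr (w i * y k)).
  rewrite (bigD1 k) //= w_dual eqxx mulr1 big1 ?addr0 // => i /negPf ik.
  by rewrite w_dual ik mulr0.
transitivity (\sum_(i < d) \sum_(j < d) Tr (f * y i) * Tr (C i j * y j * y k)).
  by apply: eq_bigr => i _; rewrite /w mulr_suml Tr_sum mulr_sumr.
rewrite exchange_big /=; apply: eq_bigr => j _.
rewrite /w [f * _]mulr_sumr Tr_sum mulr_suml; apply: eq_bigr => i _.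
have -> : f * (C j i * y i) = C j i * (f * y i) by ring.
have -> : C i j * y j * y k = C i j * (y j * y k) by ring.
rewrite (TrZ _ (invgram_fixed j i)) (TrZ _ (invgram_fixed i j)).
have -> : C i j = C j i; last by ring.
have CT : C^T = C by rewrite /C trmx_inv /T trmx_mul trmxK.
by rewrite -{1}CT mxE.
Qed.

(** Split each coefficient into a polynomial and a part vanishing at infinity. The second parts sum
    to an integral function too small at its top index, so [reduced_top] makes them vanish. *)
Lemma integral_coef f : integral f ->
  exists a : nat -> {poly K}, f = \sum_(i < d) iota (a i) * e i.
Proof.
move=> If; have [c fc ef] := basis_span f.
have /choice[a Ha] : forall i, exists a, fixed (c i - iota a) /\ m (c i - iota a).
  move=> i; have [p [s [ec fs ms]]] := fixed_proper (fc i).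
  by exists p; rewrite ec addrC addKr.
pose s i := c i - iota (a i).
have fs i : fixed (s i) by apply: (Ha i).1.
exists a; rewrite ef; apply: eq_bigr => i0 _; congr (_ * _).
apply/eqP; rewrite -subr_eq0; apply: contraT => si0.
have [||k [kd sk s0]] := @top_index (fun i => s i != 0) d i0 => //.
have Is : integral (\sum_(i < d) s i * e i).
  have -> : \sum_(i < d) s i * e i = f - \sum_(i < d) iota (a i) * e i.
    by rewrite ef -sumrB; apply: eq_bigr => i _; rewrite /s mulrBl.
  apply: (sub_ringB integral_sub_ring) => //.
  apply: (sub_ring_sum integral_sub_ring) => i _; apply: (sub_ringM integral_sub_ring).
    exact: integral_iota.
  by have [] := red (ltn_ord i).
have s0' i : (k < i < d)%N -> s i = 0 by move=> /s0; rewrite negbK => /eqP.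
case: (reduced_top red fs Is kd sk s0') => g.
rewrite rmorph_sum mulr_sumr; apply: maxid_sum => // i _; rewrite rmorphM fs.
have [ik|ki] := leqP i k; last by rewrite s0' ?ki ?ltn_ord // mul0r mulr0; left.
have le := reduced_mono red ik kd.
rewrite mulrCA; apply: maxidMr => //; first exact: (Ha i).2.
rewrite -(subnK le) exprD -mulrA; apply: VtX.
by have [_ /deg_leP + _ _] := red (ltn_ord i).
Qed.

(** [W] is dual to [e i], so it lies in the codifferent and [ramif * W] is integral. If [dd i]
    exceeded the degree [q^2] of [ramif], this product would vanish at all infinite places and be 0,
    although [Tr (W * e i) = 1]. *)
Lemma reduced_deg i : (i < d)%N -> (dd i <= q ^ 2)%N.
Proof.
move=> ltid; pose i' := Ordinal ltid; rewrite leqNgt; apply/negP => lt.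
pose W := t ^+ dd i * w i'.
have ft n : fixed (t ^+ n) by apply: (sub_ringX fixed_sub_ring); apply: fixed_t.
have fX n : fixed (X ^+ n) by move=> g; rewrite rmorphXn act_iota.
have We (k : 'I_d) : Tr (W * e k) = (i' == k)%:R.
  have -> : W * e k = t ^+ dd i * (X ^+ dd k * (w i' * y k)).
    rewrite /W /y -[LHS]mul1r -(tX (dd k)); ring.
  rewrite (TrZ _ (ft _)) (TrZ _ (fX _)) w_dual; case: eqP => [<-|_]; last by rewrite !mulr0.
  by rewrite /= mulr1 tX.
have TW o : integral o -> exists a, Tr (W * o) = iota a.
  move=> /integral_coef[a ->]; exists (a i).
  rewrite mulr_sumr Tr_sum (bigD1 i') //= big1 ?addr0 => [|k ki].
    by rewrite mulrCA (TrZ _ (fixed_iota _)) (We i') eqxx mulr1.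
  by rewrite mulrCA (TrZ _ (fixed_iota _)) We eq_sym (negPf ki) mulr0.
have IW := codifferent_ramif TW.
have Vr : V (t ^+ (q ^ 2) * iota ramif).
  by have := iota_infinity_residue ramif; rewrite size_ramif; apply: residue_V.
have W0 : iota ramif * W = 0.
  apply: integral_no_small => // g; rewrite rmorphM act_iota /W rmorphM ft.
  have -> : iota ramif * (t ^+ dd i * act g (w i')) =
     t ^+ (dd i - q ^ 2) * ((t ^+ (q ^ 2) * iota ramif) * act g (w i')).
    by rewrite -{1}(subnK (ltnW lt)) exprD; ring.
  apply: maxidMr => //; first by apply: maxidXp; rewrite // subn_gt0.
  apply: (sub_ringM HB) => //; rewrite rmorph_sum; apply: (sub_ring_sum HB) => j _.
  rewrite rmorphM (invgram_fixed _ _ g); apply: (sub_ringM HB); first exact: invgram_V.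
  exact: Ry.
have := We i'; rewrite eqxx /=; move/eqP: W0.
rewrite mulf_eq0 iota_eq0 (negPf ramif_neq0) => /eqP ->.
by rewrite mul0r /Tr big1 => [/esym/eqP|h _]; rewrite ?oner_eq0 // rmorph0.
Qed.

Lemma basis_leading_surj (a : G -> K) :
  exists f, integral f /\ forall g, residue (t ^+ (q ^ 2) * act g f) (a g).
Proof.
pose v := (\row_(k < d) a (enum_val k)) *m invmx U.
pose f := \sum_(i < d) kappa (v 0 i) * X ^+ (q ^ 2 - dd i) * e i.
exists f; split.
  apply: (sub_ring_sum integral_sub_ring) => i _; apply: (sub_ringM integral_sub_ring).
    apply: (sub_ringM integral_sub_ring); first exact: integral_iota.
    by rewrite -rmorphXn; apply: integral_iota.
  by have [] := red (ltn_ord i).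
move=> g; rewrite rmorph_sum mulr_sumr.
have -> : a g = \sum_(i < d) v 0 i * U i (enum_rank g).
  have : v *m U = \row_(k < d) a (enum_val k) by rewrite mulmxKV // leading_unit.
  by move/rowP/(_ (enum_rank g)); rewrite !mxE enum_rankK => <-.
apply: residue_sum => i _; rewrite !rmorphM rmorphXn /= !act_iota.
have le := reduced_deg (ltn_ord i).
have -> : t ^+ (q ^ 2) * (iota (v 0 i)%:P * X ^+ (q ^ 2 - dd i) * act g (e i)) = kappa (v 0 i) * Y i (enum_rank g).
  rewrite [Y _ _]mxE enum_rankK rmorphM rmorphXn /= fixed_t -{1}(subnK le) exprD.
  rewrite -[RHS]mul1r -(tX (q ^ 2 - dd i)); ring.
by apply: residueM; [apply: residue_kappa | apply: HU].
Qed.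

End FullBasis.

Theorem leading_surj (a : G -> K) :
  exists f, integral f /\ forall g, residue (t ^+ (q ^ 2) * act g f) (a g).
Proof.
have [e [dd red]] := exists_reduced (leqnn d).
exact: basis_leading_surj red a.
Qed.

(** Induction on the excess pole order: [leading_surj], multiplied by a power of [X], matches the
    leading terms at all places at once, until order [q^2] remains. *)
Lemma approximation (y : G -> L) :
  exists f, integral f /\ forall g, V (t ^+ (q ^ 2) * (act g f - y g)).
Proof.
have [n Hn] : exists n, forall g, V (t ^+ (q ^ 2 + n) * y g).
  have /choice[j Hj] : forall g, exists j, deg_le j (y g) by move=> g; apply: exists_deg.
  exists (\sum_g j g)%N => g; rewrite exprD -mulrA; apply: VtX.
  have le : (j g <= \sum_g j g)%N by rewrite (bigD1 g) //= leq_addr.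
  by have /deg_leP/(_ 1%g) := deg_le_weak le (Hj g); rewrite act1.
elim: n y Hn => [|n IH] y Hn.
  exists 0; split=> [|g]; first exact: (sub_ring0 integral_sub_ring).
  by rewrite rmorph0 sub0r mulrN; apply: (sub_ringN HB); rewrite -[(q ^ 2)%N]addn0.
have /choice[a Ha] : forall g, exists a, residue (t ^+ (q ^ 2 + n.+1) * y g) a.
  by move=> g; apply: V_residue.
have [f0 [If0 rf0]] := leading_surj a.
have [|f1 [If1 Hf1]] := IH (fun g => y g - act g (X ^+ n.+1 * f0)).
  move=> g; have : m (t * (t ^+ (q ^ 2 + n) * (y g - act g (X ^+ n.+1 * f0)))).
    apply/residue_m; rewrite -(subrr (a g)).
    have -> : t * (t ^+ (q ^ 2 + n) * (y g - act g (X ^+ n.+1 * f0))) =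
      t ^+ (q ^ 2 + n.+1) * y g - t ^+ (q ^ 2) * act g f0.
      have -> : t ^+ (q ^ 2) = t ^+ (q ^ 2 + n.+1) * X ^+ n.+1 by rewrite exprD -mulrA tX mulr1.
      by rewrite rmorphM rmorphXn /= act_iota addnS [t ^+ _.+1]exprS; ring.
    exact: residueB.
  move=> /m_t[v Vv ev]; have -> // : t ^+ (q ^ 2 + n) * (y g - act g (X ^+ n.+1 * f0)) = v.
  by apply: (mulfI t_neq0).
exists (X ^+ n.+1 * f0 + f1); split.
  apply: (sub_ringD integral_sub_ring) => //; apply: (sub_ringM integral_sub_ring) => //.
  by rewrite -rmorphXn; apply: integral_iota.
by move=> g; rewrite rmorphD; have := Hf1 g; rewrite opprB addrA [act g f1 + _]addrC.
Qed.

(** * Jets at infinity *)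

Definition evt (p : {poly K}) := (map_poly kappa p).[t].

Lemma evtB a b : evt (a - b) = evt a - evt b. Proof. by rewrite /evt rmorphB !hornerE. Qed.
Lemma evtD a b : evt (a + b) = evt a + evt b. Proof. by rewrite /evt rmorphD !hornerE. Qed.
Lemma evtM a b : evt (a * b) = evt a * evt b. Proof. by rewrite /evt rmorphM hornerM. Qed.
Lemma evtZ c a : evt (c *: a) = kappa c * evt a.
Proof. by rewrite -mul_polyC evtM /evt map_polyC hornerC. Qed.
Lemma evt0 : evt 0 = 0. Proof. by rewrite /evt rmorph0 horner0. Qed.
Lemma evtXn n : evt 'X^n = t ^+ n. Proof. by rewrite /evt map_polyXn hornerXn. Qed.
Lemma evtX : evt 'X = t. Proof. by rewrite /evt map_polyX hornerX. Qed.
Lemma evtC c : evt c%:P = kappa c. Proof. by rewrite /evt map_polyC hornerC. Qed.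
Lemma V_evt p : V (evt p).
Proof.
by apply: (sub_ring_horner HB); [move=> i; rewrite coef_map; apply: VK | apply: Vt].
Qed.

(** The expansion of [y] in powers of [t], cut at precision [r]; the size bound makes it unique. *)
Definition is_jet r y (p : {poly K}) := (size p <= r)%N /\ exists2 v, V v & y = evt p + t ^+ r * v.

Lemma jet_exists r y : V y -> exists p, is_jet r y p.
Proof.
elim: r y => [|r IH] y Vy.
  by exists 0; split; [rewrite size_poly0 | exists y; rewrite // evt0 add0r mul1r].
have [k rk] := V_residue Vy; have [v Vv ev] := m_t rk; have [p [sp [u Vu eu]]] := IH v Vv.
exists (p * 'X + k%:P); split.
  by rewrite size_MXaddC; case: ifP => // _; rewrite ltnS.
exists u => //; rewrite -[y](subrK (kappa k)) ev eu evtD evtM evtX evtC exprS.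
by ring.
Qed.

Lemma jet_unique0 r (p : {poly K}) v : (size p <= r)%N -> V v -> evt p = t ^+ r * v -> p = 0.
Proof.
elim/poly_ind: p r v => [//|p c IH] [|r] v sp Vv ev.
  by apply/eqP; rewrite -size_poly_leq0.
have ep : evt (p * 'X + c%:P) = t * evt p + kappa c.
  by rewrite evtD evtM evtX evtC mulrC.
have c0 : c = 0.
  apply: m_kappa; have -> : kappa c = t * (t ^+ r * v - evt p).
    by rewrite mulrBr mulrA -exprS -ev ep; ring.
  apply: maxidMr => //; apply: (sub_ringB HB); [exact: VtX | exact: V_evt].
rewrite c0 addr0 (IH r v) ?mul0r //.
  by move: sp; rewrite size_MXaddC c0 eqxx andbT; case: eqP => // ->; rewrite size_poly0.
by apply: (mulfI t_neq0); rewrite mulrA -exprS -ev ep c0 rmorph0 addr0.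
Qed.

Lemma jet_unique r y p p' : is_jet r y p -> is_jet r y p' -> p = p'.
Proof.
move=> [sp [v Vv ev]] [sp' [v' Vv' ev']]; apply/eqP; rewrite -subr_eq0; apply/eqP.
apply: (@jet_unique0 r _ (v' - v)).
- by rewrite (leq_trans (size_polyD _ _)) // size_polyN geq_max sp.
- exact: (sub_ringB HB).
- rewrite evtB; have -> : evt p = y - t ^+ r * v by rewrite ev addrK.
  by rewrite ev'; ring.
Qed.

Lemma jet_lin r c x y p p' : is_jet r x p -> is_jet r y p' ->
  is_jet r (kappa c * x + y) (c *: p + p').
Proof.
move=> [sp [v Vv ->]] [sp' [v' Vv' ->]]; split.
  rewrite (leq_trans (size_polyD _ _)) // geq_max sp' andbT.
  by rewrite (leq_trans (size_scale_leq _ _)).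
exists (kappa c * v + v'); last by rewrite evtD evtZ; ring.
by apply: (sub_ringD HB) => //; apply: (sub_ringM HB).
Qed.

(** Jets without the size bound, so that products can be formed before truncation. *)
Definition jet_cong r y p := exists2 v, V v & y = evt p + t ^+ r * v.

Lemma jet_cong_jet r y p : is_jet r y p -> jet_cong r y p. Proof. by case. Qed.

Lemma jet_congM r x y p p' : jet_cong r x p -> jet_cong r y p' -> jet_cong r (x * y) (p * p').
Proof.
move=> [v Vv ->] [v' Vv' ->].
exists (evt p * v' + v * evt p' + t ^+ r * (v * v')); last by rewrite evtM; ring.
have Vt' : V (t ^+ r) by apply: (sub_ringX HB); apply: Vt.
by repeat (first [exact: V_evt | exact: Vv | exact: Vv' | exact: Vt' | apply: (sub_ringD HB) | apply: (sub_ringM HB)]).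
Qed.

Lemma jet_cong_take r y p : jet_cong r y p -> is_jet r y (take_poly r p).
Proof.
move=> [v Vv ->]; split; first exact: size_take_poly.
exists (evt (drop_poly r p) + v); first by apply: (sub_ringD HB) => //; apply: V_evt.
by rewrite -{1}(poly_take_drop r p) evtD evtM evtXn; ring.
Qed.

Lemma jet0P r y : is_jet r y 0 <-> exists2 v, V v & y = t ^+ r * v.
Proof.
split=> [[_ [v Vv ->]]|[v Vv ->]]; first by exists v; rewrite // evt0 add0r.
by split; [rewrite size_poly0 | exists v; rewrite // evt0 add0r].
Qed.

(* Counting: there are [#|K| ^ d] leading vectors but fewer jets on [W]. *)
Lemma exists_vanishing r (W : {set G}) : (#|W| * r < d)%N ->
  exists f, [/\ integral f, f != 0, deg_le (q ^ 2) f
    & forall g, g \in W -> exists2 v, V v & t ^+ (q ^ 2) * act g f = t ^+ r * v].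
Proof.
move=> lt.
have /choice[f Hf] : forall a : {ffun G -> K}, exists f,
    integral f /\ forall g, residue (t ^+ (q ^ 2) * act g f) (a g).
  by move=> a; apply: leading_surj.
have Vf a g : V (t ^+ (q ^ 2) * act g (f a)) by apply: residue_V ((Hf a).2 g).
have /choice[J HJ] : forall ag : {ffun G -> K} * G, exists p,
    is_jet r (t ^+ (q ^ 2) * act ag.2 (f ag.1)) p.
  by move=> [a g]; apply: jet_exists; apply: Vf.
pose code (a : {ffun G -> K}) := [ffun wi : 'I_#|W| * 'I_r => (J (a, enum_val wi.1))`_wi.2].
have /injectivePn[a [a' aa' ecode]] : ~~ injectiveb code.
  apply/negP => /injectiveP/leq_card; rewrite !card_ffun card_prod !card_ord.
  rewrite leq_exp2l; last by rewrite finNzRing_gt1.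
  by rewrite leqNgt lt.
exists (f a - f a'); split.
- by apply: (sub_ringB integral_sub_ring); [apply: (Hf a).1 | apply: (Hf a').1].
- apply: contra aa'; rewrite subr_eq0 => /eqP eff; apply/eqP/ffunP => g.
  by apply: residue_inj ((Hf a).2 g) _; rewrite eff; apply: (Hf a').2.
- by apply/deg_leP => g; rewrite rmorphB mulrBr; apply: (sub_ringB HB).
move=> g gW; apply/jet0P.
have eJ : J (a, g) = J (a', g).
  apply/polyP => i; have [ir|ri] := ltnP i r; last first.
    by rewrite !nth_default //; apply: leq_trans ri; [case: (HJ (a', g)) | case: (HJ (a, g))].
  have := congr1 (fun F : {ffun _} => F (enum_rank_in gW g, Ordinal ir)) ecode.
  by rewrite !ffunE /= enum_rankK_in.
have := jet_lin (-1) (HJ (a', g)) (HJ (a, g)); rewrite eJ scaleN1r addNr.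
have -> // : t ^+ (q ^ 2) * act g (f a - f a') =
  kappa (-1) * (t ^+ (q ^ 2) * act g (f a')) + t ^+ (q ^ 2) * act g (f a).
by rewrite (rmorphN1 kappa) rmorphB; ring.
Qed.

(** Take [psi] vanishing to order [r] on [W] and approximate the quotient of the target by [psi].
    Multiplying back by [psi] turns the error into a multiple of [t ^+ r] on [W]; each factor costs
    degree [q^2]. *)
Lemma jet_interpolation r (W : {set G}) (p : G -> {poly K}) : (#|W| * r < d)%N ->
  exists f, [/\ integral f, deg_le (q ^ 2 + q ^ 2) f
    & forall g, g \in W -> (size (p g) <= r)%N -> is_jet r (t ^+ (q ^ 2 + q ^ 2) * act g f) (p g)].
Proof.
move=> lt; have [psi [Ipsi psi0 /deg_leP dpsi psiW]] := exists_vanishing lt.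
pose Q := (q ^ 2)%N.
pose y g := if g \in W then X ^+ (Q + Q) * evt (p g) / act g psi else 0.
have [f1 [If1 Hf1]] := approximation y.
have apsi g : act g psi != 0 by rewrite fmorph_eq0.
have eW g : g \in W -> t ^+ (Q + Q) * act g (psi * f1) =
    evt (p g) + (t ^+ Q * act g psi) * (t ^+ Q * (act g f1 - y g)).
  move=> gW; have h : t ^+ (Q + Q) * (act g psi * y g) = evt (p g).
    by rewrite /y gW [act g psi * _]mulrC divfK // mulrA tX mul1r.
  by rewrite -h rmorphM exprD; ring.
have VW g : g \in W -> V (t ^+ (Q + Q) * act g (psi * f1)).
  move=> gW; rewrite eW //; apply: (sub_ringD HB); first exact: V_evt.
  exact: (sub_ringM HB).
exists (psi * f1); split; first exact: (sub_ringM integral_sub_ring).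
  apply/deg_leP => g; have [|gW] := boolP (g \in W); first exact: VW.
  have := Hf1 g; rewrite /y (negPf gW) subr0 => h.
  have -> : t ^+ (q ^ 2 + q ^ 2) * act g (psi * f1) = (t ^+ Q * act g psi) * (t ^+ Q * act g f1).
    by rewrite rmorphM exprD; ring.
  exact: (sub_ringM HB).
move=> g gW sp; split=> //; have [v Vv ev] := psiW g gW.
exists (v * (t ^+ Q * (act g f1 - y g))); first exact: (sub_ringM HB).
by rewrite eW // [t ^+ Q * act g psi]ev -mulrA.
Qed.

Let Q := (q ^ 2)%N.

Definition jet_code n r (x : G -> {poly K}) := exists f,
  [/\ integral f, deg_le n f & forall g, is_jet r (t ^+ n * act g f) (x g)].

Lemma jet_code_lin n r :
  jet_code n r (fun=> 0) /\
  forall a x y, jet_code n r x -> jet_code n r y -> jet_code n r (fun g => a *: x g + y g).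
Proof.
split.
  exists 0; split; first exact: (sub_ring0 integral_sub_ring).
    by apply/deg_leP => g; rewrite rmorph0 mulr0; apply: (sub_ring0 HB).
  by move=> g; apply/jet0P; exists 0; rewrite ?rmorph0 ?mulr0 //; apply: (sub_ring0 HB).
move=> a x y [f [If /deg_leP df Jf]] [f' [If' /deg_leP df' Jf']].
have e g : t ^+ n * act g (kappa a * f + f') = kappa a * (t ^+ n * act g f) + t ^+ n * act g f'.
  by rewrite rmorphD rmorphM /= act_iota; ring.
exists (kappa a * f + f'); split.
- apply: (sub_ringD integral_sub_ring) => //; apply: (sub_ringM integral_sub_ring) => //.
  exact: integral_iota.
- apply/deg_leP => g; rewrite e; apply: (sub_ringD HB) => //; apply: (sub_ringM HB) => //.
- by move=> g; rewrite e; apply: jet_lin.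
Qed.

(** Multiplying the function by [X ^+ n'] cancels the extra power of [t]. *)
Lemma jet_code_shift n n' r x : jet_code n r x -> jet_code (n + n') r x.
Proof.
move=> [f [If /deg_leP df Jf]].
have e g : t ^+ (n + n') * act g (X ^+ n' * f) = t ^+ n * act g f.
  by rewrite rmorphM rmorphXn /= act_iota exprD -[RHS]mul1r -(tX n'); ring.
exists (X ^+ n' * f); split.
- apply: (sub_ringM integral_sub_ring) => //.
  by rewrite -rmorphXn; apply: integral_iota.
- by apply/deg_leP => g; rewrite e.
- by move=> g; rewrite e.
Qed.

Lemma jet_codeM n n' r x y : jet_code n r x -> jet_code n' r y ->
  jet_code (n + n') r (fun g => take_poly r (x g * y g)).
Proof.
move=> [f [If /deg_leP df Jf]] [f' [If' /deg_leP df' Jf']].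
have e g : t ^+ (n + n') * act g (f * f') = (t ^+ n * act g f) * (t ^+ n' * act g f').
  by rewrite rmorphM exprD; ring.
exists (f * f'); split; first exact: (sub_ringM integral_sub_ring).
- by apply/deg_leP => g; rewrite e; apply: (sub_ringM HB).
- by move=> g; rewrite e; apply: jet_cong_take; apply: jet_congM; apply: jet_cong_jet.
Qed.

Lemma jet_code_dist n r x : jet_code n r x -> (exists g, x g != 0) ->
  (#|[set g | x g == 0%R]| * r <= n * d)%N.
Proof.
move=> [f [If df Jf]] [g0 xg0]; apply: (zero_bound If _ df) => [|g].
  apply: contra xg0 => /eqP f0; apply/eqP/(jet_unique (Jf g0)); rewrite f0 rmorph0 mulr0.
  by apply/jet0P; exists 0; rewrite ?mulr0 //; apply: (sub_ring0 HB).
by rewrite in_set => /eqP xg; apply/jet0P; rewrite -xg.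
Qed.

Lemma coef_take_polyM r (a b : {poly K}) i : (i < r)%N -> (take_poly r a * b)`_i = (a * b)`_i.
Proof.
move=> ir; rewrite !coefM; apply: eq_bigr => j _; rewrite coef_take_poly.
by rewrite (leq_ltn_trans _ ir) // -ltnS.
Qed.

(** By [zero_bound], a nonzero word of degree [2 Q] with jets of length [16 Q] is zero on at most an
    eighth of the [d] blocks; the hypothesis on [delta] is the one that interpolation on [delta]
    blocks asks for. *)
Theorem poly_code_infinity delta : (0 < delta)%N -> (delta * (16 * Q) < d)%N ->
  poly_code K G (16 * Q) delta.
Proof.
move=> delta0 lt; set r := (16 * Q)%N in lt *.
have Q0 : (0 < Q)%N by rewrite /Q expn_gt0 ltnW.
have interp (W : {set G}) p : (#|W| <= delta)%N -> (forall g, (size (p g : {poly K}) <= r)%N) ->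
    exists2 x, jet_code (Q + Q) r x & forall g, g \in W -> x g = p g.
  move=> ltW sp; have [|f [If df Jf]] := @jet_interpolation r W p.
    by apply: leq_ltn_trans lt; rewrite leq_mul2r ltW orbT.
  have /choice[x Hx] : forall g, exists x, is_jet r (t ^+ (Q + Q) * act g f) x.
    by move=> g; apply: jet_exists; have /deg_leP := df; apply.
  exists x; first by exists f.
  by move=> g gW; apply: jet_unique (Hx g) (Jf g gW (sp g)).
exists (jet_code (Q + Q) r); split.
- exact: jet_code_lin.
- by move=> x [f [_ _ Jf]] g; case: (Jf g).
- move=> x Cx nx; have := jet_code_dist Cx nx.
  have := cardsC [set g | x g == 0].
  have -> : ~: [set g | x g == 0] = [set g | x g != 0] by apply/setP => g; rewrite !in_set.
  move: lt; rewrite /r; move: #|[set g | x g == 0]| #|[set g | x g != 0]| #|G| => z n D; nia.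
- exact: interp.
move=> k kd.
(* Words have degree at most [2 Q], so products of four of them at most [8 Q]; a jet
   supported on one block would vanish at [d - 1] blocks, against [zero_bound]. *)
pose n8 := (Q + Q + (Q + Q) + (Q + Q) + (Q + Q))%N.
pose delta_word (gi : G * 'I_r) : K := ((gi.1 == 1%g) && (gi.2 == 0%N :> nat))%:R.
pose poly_of (u : G * 'I_r -> K) g := \poly_(i < r) (if insub i is Some j then u (g, j) else 0).
have coef_poly_of u g (j : 'I_r) : (poly_of u g)`_j = u (g, j) by rewrite coef_poly ltn_ord valK.
have [||l [[[g0 i0] l0] lC]] := @annihilator K (G * 'I_r)%type (fun u => jet_code n8 r (poly_of u)).
- have [C0 CL] := jet_code_lin n8 r; split=> [|a x y Cx Cy].
    have -> // : poly_of (fun=> 0) = fun=> 0.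
    by apply/funext => g; apply/polyP => i; rewrite coef_poly coef0; case: ifP => // _; case: insub.
  have -> : poly_of (fun i => a * x i + y i) = fun g => a *: poly_of x g + poly_of y g; last exact: CL.
  apply/funext => g; apply/polyP => i; rewrite coefD coefZ !coef_poly.
  by case: ifP => _; [case: insub => [j|]|]; rewrite ?mulr0 ?addr0.
- exists delta_word => C1.
  have r0 : (0 < r)%N by rewrite muln_gt0.
  have [|] := leqP (#|[set g | poly_of delta_word g == 0%R]| * r)%N (n8 * d)%N; last first.
    rewrite ltnNge (jet_code_dist C1) //; exists 1%g; apply/eqP => /polyP/(_ (Ordinal r0)).
    by rewrite coef_poly_of coef0 /delta_word /= !eqxx => /eqP; rewrite oner_eq0.
  have -> : [set g | poly_of delta_word g == 0] = ~: [set 1%g].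
    apply/setP => g; rewrite in_set in_setC in_set1; have [->|g1] := eqVneq g 1%g.
      apply/eqP => /polyP/(_ (Ordinal r0)).
      by rewrite coef_poly_of coef0 /delta_word /= !eqxx => /eqP; rewrite oner_eq0.
    apply/eqP/polyP => i; rewrite coef_poly coef0; case: ifP => // _; case: insub => // j.
    by rewrite /delta_word /= (negPf g1).
  rewrite cardsC1 /r /n8; move: lt; rewrite /r; move: #|G| => D; nia.
pose B := [set g | [exists i, l (g, i) != 0]].
pose lam0 g (p : {poly K}) := \sum_(i < r) l (g, i) * p`_i.
have lamC x : jet_code n8 r x -> \sum_g lam0 g (x g) = 0.
  move=> Cx; rewrite -[RHS](lC (fun gi => (x gi.1)`_gi.2)).
    by rewrite /lam0 pair_bigA; apply: eq_bigr => -[g i] _.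
  have -> // : poly_of (fun gi => (x gi.1)`_gi.2) = x.
  apply/funext => g; apply/polyP => i; rewrite coef_poly; case: ltnP => ir.
    by rewrite insubT.
  by rewrite nth_default //; case: Cx => f [_ _ /(_ g)[sx _]]; apply: leq_trans sx ir.
(* On a smaller support, interpolation would give a word equal to one monomial at [g0] and 0 on the
   rest of [B], on which the functional is nonzero. *)
have Bdelta : (delta <= #|B|)%N.
  rewrite leqNgt; apply/negP => ltB.
  have [||x Cx xB] := interp B (fun g => if g == g0 then 'X^i0 else 0); first exact: ltnW.
    by move=> g; case: ifP; rewrite ?size_polyXn ?size_poly0.
  have C8 : jet_code n8 r x.
    have -> : n8 = (Q + Q + 6 * Q)%N by rewrite /n8; lia.
    exact: jet_code_shift.
  have g0B : g0 \in B by rewrite in_set; apply/existsP; exists i0.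
  case/eqP: l0; rewrite -[RHS](lamC x C8) (bigD1 g0) //= big1 ?addr0 => [|g gg0].
    rewrite xB // eqxx /lam0 (bigD1 i0) //= coefXn eqxx mulr1 big1 ?addr0 // => i ii0.
    by rewrite coefXn val_eqE (negPf ii0) mulr0.
  rewrite /lam0 big1 // => i _; have [->|lgi] := eqVneq (l (g, i)) 0; first by rewrite mul0r.
  rewrite xB ?(negPf gg0) ?coef0 ?mulr0 //.
  by rewrite in_set; apply/existsP; exists i.
have [A [sAB cA]] : exists A : {set G}, A \subset B /\ #|A| = k.
  exists [set g in take k (enum B)]; split.
    by apply/subsetP => g; rewrite in_set => /mem_take; rewrite mem_enum.
  rewrite cardsE; have /card_uniqP -> := take_uniq k (enum_uniq [in B]).
  by rewrite size_takel // -cardE; apply: leq_trans kd Bdelta.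
have /choice[i Hi] : forall g, exists i, g \in A -> l (g, i) != 0.
  move=> g; have [|gA] := boolP (g \in A); last by exists i0.
  move/(subsetP sAB); rewrite in_set => /existsP[i li]; by exists i.
(* The fourth factor [j]: on [A] its jet selects one nonzero coefficient of [l] and scales it to
   1. *)
have [||j Cj jA] := interp A (fun g => (l (g, i g))^-1 *: 'X^(i g)); first by rewrite cA.
  by move=> g; rewrite (leq_trans (size_scale_leq _ _)) // size_polyXn.
exists A, (fun g p => lam0 g (p * j g)); split=> //.
- move=> g a x y; rewrite /lam0 mulr_sumr -big_split /=; apply: eq_bigr => u _.
  by rewrite mulrDl -scalerAl coefD coefZ; ring.
- move=> x y z Cx Cy Cz.
  have C4 := jet_codeM (jet_codeM (jet_codeM Cx Cy) Cz) Cj.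
  rewrite -[RHS](lamC _ C4); apply: eq_bigr => g _; apply: eq_bigr => u _; congr (_ * _).
  rewrite coef_take_poly ltn_ord coef_take_polyM //.
  by rewrite -(mulrA (take_poly r (x g * y g))) coef_take_polyM // !mulrA.
- move=> g gA; rewrite mul1r jA // /lam0 (bigD1 (i g)) //= coefZ coefXn eqxx mulr1.
  rewrite mulfV ?Hi // big1 ?addr0 // => u ui.
  by rewrite coefZ coefXn val_eqE (negPf ui) !mulr0.
Qed.

End Infinity.

Theorem poly_code_tower delta : (0 < delta)%N -> (delta * (16 * q ^ 2) < d)%N ->
  poly_code K G (16 * q ^ 2) delta.
Proof.
by have [V [HV VK mt]] := exists_infinite_place; apply: (poly_code_infinity HV VK mt).
Qed.

(** * The degree of the tower *)

Lemma place_above_X : exists V, [/\ valring V, forall p, V (iota p) & maxid V X].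
Proof.
pose B y := exists p, y = iota p.
have HB : sub_ring B.
  split; first by exists 1; rewrite rmorph1.
  - by move=> _ _ [x ->] [y ->]; exists (x - y); rewrite rmorphB.
  - by move=> _ _ [x ->] [y ->]; exists (x * y); rewrite rmorphM.
have nB : ~ B X^-1.
  move=> [e ee]; have : 'X * e = 1.
    by apply: iota_inj; rewrite rmorphM -ee mulfV ?rmorph1 ?X_neq0.
  move=> /(congr1 (fun P : {poly K} => P.[0])); rewrite !hornerE => /esym/eqP.
  by rewrite oner_eq0.
have [V [HV BV mX]] := chevalley HB (ex_intro _ 'X erefl) nB.
by exists V; split=> // p; apply: BV; exists p.
Qed.

Section Degree.
Variable V : L -> Prop.
Hypotheses (HV : valring V) (VA : forall p, V (iota p)) (mX : maxid V X).
Let HB := HV.1.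
Notation m := (maxid V).

Definition vunit v := V v /\ ~ m v.

Lemma vunitM u v : vunit u -> vunit v -> vunit (u * v).
Proof.
move=> [Vu nu] [Vv nv]; split; first exact: (sub_ringM HB).
by move=> /(maxid_prime HV)[].
Qed.

Lemma vunitV u : vunit u -> vunit u^-1.
Proof.
move=> [Vu nu]; have [Vi u0] := unitV Vu nu; split=> //.
move=> mi; apply: (maxidN1 HV); rewrite -(mulVf u0); exact: maxidMr.
Qed.

Lemma vunit1 : vunit 1.
Proof. by split; [apply: (sub_ring1 HB) | apply: maxidN1]. Qed.

Lemma vunitX u n : vunit u -> vunit (u ^+ n).
Proof. by move=> hu; elim: n => [|n IH]; [apply: vunit1 | rewrite exprS; apply: vunitM]. Qed.

Lemma vunit_neq0 u : vunit u -> u != 0.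
Proof. by move=> [Vu nu]; have [] := unitV Vu nu. Qed.

Lemma vunit_addm u x : vunit u -> m x -> vunit (u + x).
Proof.
move=> [Vu nu] mx; split; last exact: nmaxidD.
by apply: (sub_ringD HB) => //; apply: (maxid_sub HV).
Qed.

Lemma m_expr_vunit y n : m y -> vunit (y ^+ n) -> n = 0%N.
Proof. by case: n => // n my [_]; case; apply: maxidXp. Qed.

Lemma poly_order (p : {poly K}) : p != 0 -> exists n u, vunit u /\ iota p = X ^+ n * u.
Proof.
elim/poly_ind: p => [/eqP //|p c IH] pc0.
have [c0|c0] := eqVneq c 0.
  have p0 : p != 0 by apply: contra pc0 => /eqP ->; rewrite c0 mul0r addr0.
  have [n [u [hu e]]] := IH p0; exists n.+1, u; split=> //.
  by rewrite c0 addr0 rmorphM /= e exprSr; ring.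
exists 0%N, (iota (p * 'X + c%:P)); split; last by rewrite mul1r.
rewrite rmorphD /= addrC; apply: vunit_addm; last by rewrite rmorphM; apply: maxidMl.
split; first exact: VA.
move=> mc; apply: (maxidN1 HV); have -> : 1 = iota (c^-1)%:P * iota c%:P.
  by rewrite -rmorphM -polyCM mulVf // rmorph1.
by apply: maxidMl.
Qed.

(** Above [x = 0] the equation reads [y_(i+1)^(q+1) = y_i * v] with [v] a unit, so [X] is a unit
    times [y_n] to the power [M = (q+1)^n]. An equation of degree [d] for [y_n] over [K(x)] needs
    two terms of equal order, so two distinct exponents up to [d] agree modulo [M]. *)
Lemma degree_lower_bound n (y : nat -> L) : y 0%N = X ->
  (forall i, (i < n)%N -> y i.+1 ^+ q.+1 = (y i + 1) ^+ q.+1 - 1) -> (q.+1 ^ n <= d)%N.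
Proof.
move=> y0 yS.
have my i : (i <= n)%N -> m (y i) /\ exists2 u, vunit u & X = y i ^+ (q.+1 ^ i) * u.
  elim: i => [|i IH] le.
    by rewrite y0; split=> //; exists 1; rewrite ?mulr1 ?expr1 //; apply: vunit1.
  have [mi [u hu eX]] := IH (ltnW le).
  have Vi := maxid_sub HV mi.
  have q0 : (0 < q)%N by apply: ltnW.
  pose v := 1 + (y i ^+ q.-1 + y i ^+ q).
  have hv : vunit v.
    apply: vunit_addm; first exact: vunit1.
    by apply: maxidD => //; apply: maxidXp => //; rewrite -ltnS prednK.
  have e : y i.+1 ^+ q.+1 = y i * v.
    have yq : y i ^+ q = y i * y i ^+ q.-1 by rewrite -exprS prednK.
    by rewrite yS // exprSr frob expr1n /v yq; ring.
  have mS : m (y i.+1).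
    apply: (@maxidX _ _ HV _ q.+1); last by rewrite e; apply: maxidMr => //; case: hv.
    apply: (@val_root _ _ HV _ q.+1) => //; rewrite e.
    by apply: (sub_ringM HB) => //; case: hv.
  split=> //; exists (u * (v ^+ (q.+1 ^ i))^-1).
    by apply: vunitM => //; apply: vunitV; apply: vunitX.
  have vi0 : v ^+ (q.+1 ^ i) != 0 by rewrite expf_neq0 // vunit_neq0.
  by rewrite expnS exprM e exprMn {1}eX; field.
have [mn [u hu eX]] := my n (leqnn n); set M := (q.+1 ^ n)%N in eX *; set z := y n in mn eX.
have z0 : z != 0.
  apply/eqP => z0; have := X_neq0; rewrite eX z0 expr0n /M expn_eq0 /= mul0r eqxx //.
pose P i := (norm_poly z)`_i.
have sumP : \sum_(i < d.+1) P i * z ^+ i = 0.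
  by have := norm_poly_root 1%g z; rewrite act1 horner_coef size_norm_poly.
have [|i Pi dom] := @dominant _ _ HV d.+1 (fun i => P i * z ^+ i).
  by exists ord_max; rewrite /P norm_poly_monic mul1r expf_neq0.
(* A single dominant term could not be cancelled by the others. *)
have [j [ji uj]] : exists j : 'I_d.+1, j != i /\ vunit ((P j * z ^+ j) / (P i * z ^+ i)).
  apply: contrapT => h; apply: (maxidN1 HV).
  have -> : 1 = - \sum_(j < d.+1 | j != i) (P j * z ^+ j) / (P i * z ^+ i).
    rewrite -mulr_suml; move: sumP; rewrite (bigD1 i) //= => /eqP; rewrite addrC addr_eq0 => /eqP ->.
    by rewrite mulNr opprK divff.
  apply: maxidN => //; apply: maxid_sum => // j ji; apply: contrapT => nm; apply: h.
  by exists j; split=> //; split.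
have Pi0 : P i != 0 by apply: contra Pi => /eqP ->; rewrite mul0r.
have Pj0 : P j != 0.
  by apply: contraTneq (vunit_neq0 uj) => ->; rewrite !mul0r eqxx.
have order c : fixed c -> c != 0 -> exists a b w, vunit w /\ c * X ^+ b = X ^+ a * w.
  move=> /act_fixed[a [b [b0 ec]]] c0.
  have a0 : a != 0 by apply: contra c0 => /eqP ea; rewrite ec ea rmorph0 mul0r.
  have [k1 [u1 [h1 e1]]] := poly_order a0; have [k2 [u2 [h2 e2]]] := poly_order b0.
  exists k1, k2, (u1 * u2^-1); split; first by apply: vunitM => //; apply: vunitV.
  by rewrite ec e1 e2; field; rewrite expf_neq0 ?X_neq0 // vunit_neq0.
have [a [b [w [hw ew]]]] : exists a b w, vunit w /\ (P j / P i) * X ^+ b = X ^+ a * w.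
  apply: order; last by rewrite mulf_neq0 ?invr_eq0.
  by apply: fixedM; [|apply: fixedV]; apply: fixed_norm_poly.
(* comparing orders at the place: [j + M a = i + M b] *)
have key : exists2 v, vunit v & z ^+ (j + M * a) = z ^+ (i + M * b) * v.
  exists ((P j * z ^+ j / (P i * z ^+ i)) * u ^+ b * (w * u ^+ a)^-1).
    apply: vunitM; first by apply: vunitM => //; apply: vunitX.
    by apply: vunitV; apply: vunitM => //; apply: vunitX.
  have w0 := vunit_neq0 hw; have u0 := vunit_neq0 hu.
  have ua0 : u ^+ a != 0 by rewrite expf_neq0.
  have zi0 : z ^+ i != 0 by rewrite expf_neq0.
  have e1 : P j / P i * (z ^+ M) ^+ b * u ^+ b = (z ^+ M) ^+ a * u ^+ a * w.
    by move: ew; rewrite eX !exprMn mulrA.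
  rewrite !exprD !exprM.
  apply: (mulIf (mulf_neq0 w0 ua0)).
  transitivity (z ^+ j * ((z ^+ M) ^+ a * u ^+ a * w)); first by ring.
  by rewrite -e1; field; rewrite zi0 Pi0 w0 ua0.
have eq_exp e f v : vunit v -> z ^+ e = z ^+ f * v -> e = f.
  move=> hv ee; have [lt|lt|//] := ltngtP e f.
  - have : vunit (z ^+ (f - e)).
      have -> : z ^+ (f - e) = v^-1; last exact: vunitV.
      apply: (mulIf (vunit_neq0 hv)); rewrite mulVf ?vunit_neq0 //.
      apply: (mulfI (expf_neq0 e z0)); rewrite mulrA -exprD subnKC ?mulr1 //; exact: ltnW.
    by move=> /(m_expr_vunit mn); lia.
  - have : vunit (z ^+ (e - f)).
      have -> // : z ^+ (e - f) = v.
      apply: (mulfI (expf_neq0 f z0)); rewrite -exprD subnKC //; exact: ltnW.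
    by move=> /(m_expr_vunit mn); lia.
have [v hv /(eq_exp _ _ _ hv) e] := key.
have id' : (i <= d)%N by rewrite -ltnS.
have jd : (j <= d)%N by rewrite -ltnS.
have M0 : (0 < M)%N by rewrite expn_gt0.
have ne : (j : nat) <> i by move=> h; move/eqP: ji; apply; apply: val_inj.
rewrite leqNgt; apply/negP => dM.
move: e ne jd id'; move: (nat_of_ord j) (nat_of_ord i) => J I e ne jd id'.
have [ab|ab|ab] := ltngtP a b; last by apply: ne; move: e; rewrite ab; lia.
- have : (M * a + M <= M * b)%N by rewrite -mulnSr leq_mul2l ab orbT.
  lia.
- have : (M * b + M <= M * a)%N by rewrite -mulnSr leq_mul2l ab orbT.
  lia.
Qed.

End Degree.

Lemma tower_degree n (y : nat -> L) : y 0%N = X ->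
  (forall i, (i < n)%N -> y i.+1 ^+ q.+1 = (y i + 1) ^+ q.+1 - 1) -> (q.+1 ^ n <= d)%N.
Proof. by have [V [HV VA mX]] := place_above_X => y0 yS; exact: (degree_lower_bound HV VA mX y0 yS). Qed.

End FermatTower.

(** * Construction of the tower *)

Lemma map_XsubC (R S : nzRingType) (f : {rmorphism R -> S}) x :
  map_poly f ('X - x%:P) = 'X - (f x)%:P.
Proof. by rewrite rmorphB /= map_polyX map_polyC. Qed.

Lemma map_prod_XsubC (R S : comNzRingType) (f : {rmorphism R -> S}) (zs : seq R) :
  map_poly f (\prod_(z <- zs) ('X - z%:P)) = \prod_(z <- map f zs) ('X - z%:P).
Proof. by rewrite rmorph_prod big_map; apply: eq_bigr => z _; apply: map_XsubC. Qed.

Lemma irreducible_divisor (k : fieldType) (p : {poly k}) : (1 < size p)%N ->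
  exists2 r, irreducible_poly r & r %| p.
Proof.
move=> sp; pose P n := `[< exists r : {poly k}, [/\ r %| p, (1 < size r)%N & size r = n] >].
have exP : exists n, P n by exists (size p); apply/asboolP; exists p.
case: (ex_minnP exP) => n /asboolP[r [rp sr rn]] minn.
exists r => //; split=> // u su ur.
have r0 : r != 0 by rewrite -size_poly_gt0 ltnW.
have u0 : u != 0 by apply: contraNneq r0 => u0; rewrite u0 dvd0p in ur.
have su1 : (1 < size u)%N by rewrite ltn_neqAle eq_sym su size_poly_gt0.
rewrite -dvdp_size_eqp // eqn_leq dvdp_leq //= rn minn //.
by apply/asboolP; exists u; split=> //; apply: dvdp_trans ur rp.
Qed.

(** The base field is generalised in the induction because each adjoined root replaces it;
    [baseFieldType] views the last extension over the first field. *)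
Lemma exists_split_ext (k : fieldType) (p : {poly k}) : p != 0 ->
  exists (E : fieldExtType k) (zs : seq E),
    map_poly (in_alg E) p %= \prod_(z <- zs) ('X - z%:P).
Proof.
move: {2}(size p) (leqnn (size p)) => n; elim: n => [|n IH] in k p *.
  by rewrite size_poly_leq0 => ->.
move=> sp p0; have [s1|s1] := leqP (size p) 1.
  by exists k^o, [::]; rewrite big_nil -size_poly_eq1 size_map_poly eqn_leq s1 size_poly_gt0.
have [r irr_r rp] := irreducible_divisor s1.
have [E1 _ [x rx _]] := irredp_FAdjoin irr_r.
have /factor_theorem[u eu] : root (map_poly (in_alg E1) p) x.
  by rewrite -(divpK rp) rmorphM rootM rx orbT.
have ep0 : map_poly (in_alg E1) p != 0 by rewrite map_poly_eq0.
have u0 : u != 0 by apply: contraNneq ep0 => u0; rewrite eu u0 mul0r.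
have su : (size u <= n)%N.
  move: sp; rewrite -(size_map_poly (in_alg E1)) eu size_mul ?polyXsubC_eq0 //.
  by rewrite size_XsubC addn2.
have [E2 [zs ezs]] := IH E1 u su u0.
exists (baseFieldType E2), ((in_alg E2 x : baseFieldType E2) :: (zs : seq (baseFieldType E2))).
have -> : map_poly (in_alg (baseFieldType E2)) p = map_poly (in_alg E2) (map_poly (in_alg E1) p).
  by rewrite -map_poly_comp; apply: eq_map_poly => a; rewrite /= baseField_scaleE.
rewrite eu rmorphM /= map_XsubC big_cons mulrC.
exact: eqp_mull.
Qed.

Lemma exists_splitting_field (k : fieldType) (p : {poly k}) : p \is monic ->
  exists (L : splittingFieldType k) (zs : seq L),
    map_poly (in_alg L) p = \prod_(z <- zs) ('X - z%:P) /\ <<1 & zs>>%VS = {:L}%VS.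
Proof.
move=> mp; have [E [ys ey]] := exists_split_ext (monic_neq0 mp).
pose S := <<1 & ys>>%AS; pose L1 : fieldExtType k := subvs_of S.
pose zs : seq L1 := map (vsproj S) ys.
have zsK : map vsval zs = ys.
  rewrite -map_comp map_id_in // => y yys /=; apply: vsprojK.
  exact: seqv_sub_adjoin.
have ez : map_poly (in_alg L1) p = \prod_(z <- zs) ('X - z%:P).
  apply: (map_poly_inj (vsval : {rmorphism L1 -> E})).
  rewrite map_prod_XsubC zsK -map_poly_comp.
  have -> : map_poly (vsval \o in_alg L1) p = map_poly (in_alg E) p.
    by apply: eq_map_poly => a /=; rewrite algid1.
  apply/eqP; rewrite -eqp_monic ?monic_map ?monic_prod_XsubC //.
have gz : <<1 & zs>>%VS = {:L1}%VS.
  pose f := linfun (vsval : L1 -> E).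
  apply/vspaceP => u; rewrite memvf.
  have : vsval u \in (f @: <<1 & zs>>)%VS.
    have -> : (f @: <<1 & zs>>)%VS = <<1 & ys>>%VS; last exact: valP.
    rewrite aimg_adjoin_seq aimg1 -zsK; congr <<_ & _>>%VS.
    by apply: eq_map => z; rewrite lfunE.
  by case/memv_imgP => v vz; rewrite lfunE => /val_inj ->.
have ax : SplittingField.axiom L1.
  exists (map_poly (in_alg L1) p).
    by apply/polyOverP => i; rewrite coef_map memvZ ?mem1v.
  by exists zs => //; rewrite ez eqpxx.
pose L := HB.pack_for (splittingFieldType k) L1 (FieldExt_isSplittingField.Build k L1 ax).
by exists L, zs.
Qed.

Lemma horner_mx_eigen (E : fieldType) n (C : 'M[E]_n.+1) (f : {poly E}) (v : 'rV[E]_n.+1) z :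
  v *m C = z *: v -> v *m horner_mx C f = f.[z] *: v.
Proof.
move=> vC; elim/poly_ind: f => [|f c IH]; first by rewrite rmorph0 mulmx0 horner0 scale0r.
rewrite rmorphD rmorphM /= horner_mx_X horner_mx_C !hornerE mulmxDr mulmxA IH.
by rewrite -scalemxAl vC scalerA mul_mx_scalar -scalerDl.
Qed.

(** By Cayley-Hamilton the product of the [C - z] kills the eigenvector [v]. The vector reached just
    before the first zero is an eigenvector of [C], and still one of [f(C)] for [mu] since the
    matrices commute. *)
Lemma eigenvalue_horner_mx (E : fieldType) n (C : 'M[E]_n.+1) (f : {poly E}) (zs : seq E) mu :
  char_poly C = \prod_(z <- zs) ('X - z%:P) -> eigenvalue (horner_mx C f) mu ->
  exists2 z, z \in zs & mu = f.[z].
Proof.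
move=> eC /eigenvalueP[v vD v0].
have : v *m horner_mx C (\prod_(z <- zs) ('X - z%:P)) = 0.
  by rewrite -eC Cayley_Hamilton mulmx0.
elim: zs v vD v0 {eC} => [|z zs IH] v vD v0.
  by rewrite big_nil rmorph1 mulmx1 => v00; rewrite v00 eqxx in v0.
rewrite big_cons rmorphM /= rmorphB /= horner_mx_X horner_mx_C mulmxA.
set u := v *m (C - z%:M) => hu.
have [u0|u0] := eqVneq u 0.
  exists z; rewrite ?mem_head //.
  have vC : v *m C = z *: v.
    by apply/eqP; rewrite -subr_eq0 -mul_mx_scalar -mulmxBr; apply/eqP.
  have := horner_mx_eigen f vC; rewrite vD => /eqP; rewrite -subr_eq0 -scalerBl scaler_eq0.
  by rewrite (negPf v0) orbF subr_eq0 => /eqP.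
have uD : u *m horner_mx C f = mu *: u.
  rewrite /u; have -> : C - z%:M = horner_mx C ('X - z%:P) by rewrite rmorphB /= horner_mx_X horner_mx_C.
  rewrite -mulmxA; have -> : horner_mx C ('X - z%:P) *m horner_mx C f = horner_mx C f *m horner_mx C ('X - z%:P).
    by rewrite -[LHS]rmorphM -[RHS]rmorphM mulrC.
  by rewrite mulmxA vD scalemxAl.
by have [w wzs ->] := IH u uD u0 hu; exists w => //; rewrite inE wzs orbT.
Qed.

Lemma root_of_dvd_prod (E : fieldType) (g : {poly E}) (ys : seq E) :
  (1 < size g)%N -> g %| \prod_(y <- ys) ('X - y%:P) -> exists2 y, y \in ys & root g y.
Proof.
move=> sg /dvdp_prod_XsubC[m eg].
case es : (mask m ys) => [|y s].
  by move: eg sg; rewrite es big_nil -size_poly_eq1 => /eqP ->.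
exists y; first by apply: (@mem_mask _ _ m); rewrite es mem_head.
by rewrite (eqp_root eg) es big_cons rootM root_XsubC eqxx.
Qed.

Section TowerPolynomials.
Variables (K : finFieldType) (k : fieldType) (emb : {rmorphism {poly K} -> k}) (q : nat).

Definition tower_fun (R : nzRingType) : {poly R} := ('X + 1) ^+ q.+1 - 1.

Lemma tower_funE (R : comNzRingType) (z : R) : (tower_fun R).[z] = (z + 1) ^+ q.+1 - 1.
Proof. by rewrite /tower_fun !hornerE. Qed.

Lemma map_tower_fun (R S : nzRingType) (f : {rmorphism R -> S}) :
  map_poly f (tower_fun R) = tower_fun S.
Proof. by rewrite /tower_fun rmorphB rmorphXn rmorphD /= map_polyX !rmorph1. Qed.

(* The next polynomial has as roots the [y] with [y ^+ q.+1 = (z + 1) ^+ q.+1 - 1],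
   for [z] a root of [p]: it is a characteristic polynomial composed with a power. *)
Lemma tower_step (p : {poly k}) : p \is monic -> (1 < size p)%N ->
  exists p', [/\ p' \is monic, (1 < size p')%N
    & forall (E : fieldType) (phi : {rmorphism k -> E}) (zs ys : seq E),
      map_poly phi p = \prod_(z <- zs) ('X - z%:P) ->
      map_poly phi p' = \prod_(y <- ys) ('X - y%:P) ->
      (forall y, y \in ys -> exists2 z, z \in zs & y ^+ q.+1 = (z + 1) ^+ q.+1 - 1) /\
      (forall z, z \in zs -> exists2 y, y \in ys & y ^+ q.+1 = (z + 1) ^+ q.+1 - 1)].
Proof.
move=> mp sp; have [n [C eC]] : exists n (C : 'M[k]_n.+1), char_poly C = p.
  have := companionmxK mp; move: (companionmx p); case: (size p) sp => [|[|n]] // _ C eC.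
  by exists n, C.
pose D := horner_mx C (tower_fun k).
have mD : char_poly D \is monic := char_poly_monic D.
have mX : 'X^(q.+1) \is @monic k by apply: monicXn.
have sX : size ('X^(q.+1) : {poly k}) = q.+2 by apply: size_polyXn.
exists (char_poly D \Po 'X^(q.+1)); split.
- by rewrite monicE lead_coef_comp ?sX // (monicP mD) (monicP mX) expr1n mulr1.
- by rewrite -[size _]prednK ?size_comp_poly ?size_char_poly ?sX // size_poly_gt0 comp_poly_eq0 ?sX ?monic_neq0.
move=> E phi zs ys ezs eys.
have eE : char_poly (map_mx phi C) = \prod_(z <- zs) ('X - z%:P) by rewrite -map_char_poly eC.
have eDE : map_mx phi D = horner_mx (map_mx phi C) (tower_fun E).
  by rewrite map_horner_mx map_tower_fun.
have ecomp : map_poly phi (char_poly D \Po 'X^(q.+1)) = char_poly (map_mx phi D) \Po 'X^(q.+1).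
  by rewrite map_comp_poly map_char_poly map_polyXn.
split=> [y yys|z zzs].
  have : root (char_poly (map_mx phi D)) (y ^+ q.+1).
    have : root (map_poly phi (char_poly D \Po 'X^(q.+1))) y by rewrite eys root_prod_XsubC.
    by rewrite ecomp /root horner_comp hornerXn.
  rewrite -eigenvalue_root_char eDE => /(eigenvalue_horner_mx eE)[z zzs ->].
  by exists z => //; rewrite tower_funE.
have : root (char_poly (map_mx phi C)) z by rewrite eE root_prod_XsubC.
rewrite -eigenvalue_root_char => /eigenvalueP[v vC v0].
pose c := (tower_fun E).[z].
have rc : root (char_poly (map_mx phi D)) c.
  rewrite -eigenvalue_root_char; apply/eigenvalueP; exists v => //.
  by rewrite eDE; apply: horner_mx_eigen.
have [||y yys ry] := @root_of_dvd_prod E ('X^(q.+1) - c%:P) ys.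
- by rewrite size_polyDl size_polyXn // size_polyN size_polyC; case: (c != 0).
- rewrite -eys ecomp; have /factor_theorem[g ->] := rc.
  by rewrite comp_polyM comp_polyB comp_polyX comp_polyC dvdp_mull.
exists y => //; move: ry; rewrite /root !hornerE subr_eq0 => /eqP ->.
by rewrite /c tower_funE.
Qed.

(** The roots of [p] are the elements of level [n], and [P] multiplies the polynomials of all
    levels: splitting [P] splits every level, and [p] serves to climb one step further. *)
Lemma tower_poly n : exists P p : {poly k},
  [/\ P \is monic, p \is monic, (1 < size p)%N, p %| P &
   forall (E : fieldType) (phi : {rmorphism k -> E}) (zs : seq E),
     map_poly phi P = \prod_(z <- zs) ('X - z%:P) ->
     (forall z, z \in zs -> chain (phi \o emb) q z) /\
     exists y : nat -> E, [/\ y 0%N = phi (emb 'X),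
       forall i, (i < n)%N -> y i.+1 ^+ q.+1 = (y i + 1) ^+ q.+1 - 1
       & root (map_poly phi p) (y n)]].
Proof.
elim: n => [|n [P [p [mP mp sp pP IH]]]].
  exists ('X - (emb 'X)%:P), ('X - (emb 'X)%:P).
  split; rewrite ?monicXsubC ?size_XsubC ?dvdpp // => E phi zs; rewrite map_XsubC => e.
  split=> [z|]; last by exists (fun=> phi (emb 'X)); split=> //; rewrite root_XsubC.
  rewrite -root_prod_XsubC -e root_XsubC => /eqP ->; exact: chain_base.
have [p' [mp' sp' Hp']] := tower_step mp sp.
exists (P * p'), p'; split=> //; [by rewrite monicMl | exact: dvdp_mulIr |].
move=> E phi zs ezs.
have split_of g : g \is monic -> g %| P * p' -> exists2 s, map_poly phi g = \prod_(z <- s) ('X - z%:P) & {subset s <= zs}.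
  move=> mg; rewrite -(dvdp_map phi) ezs => /dvdp_prod_XsubC[m em].
  exists (mask m zs); last by move=> z /mem_mask.
  by apply/eqP; rewrite -eqp_monic ?monic_map ?monic_prod_XsubC.
have [sP eP _] := split_of P mP (dvdp_mulr _ (dvdpp _)).
have [s es _] := split_of p mp (dvdp_mulr _ pP).
have [s' es' ss'] := split_of p' mp' (dvdp_mull _ (dvdpp _)).
have [chP [y [y0 yS ry]]] := IH E phi sP eP.
have [s's ss] := Hp' E phi s s' es es'.
have chs z : z \in s -> chain (phi \o emb) q z.
  move=> zs0; apply: chP; rewrite -root_prod_XsubC -eP; move: pP => /dvdpP[c ->].
  by rewrite rmorphM rootM /= es root_prod_XsubC zs0 orbT.
split=> [z zzs|].
  have : root (map_poly phi (P * p')) z by rewrite ezs root_prod_XsubC.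
  rewrite rmorphM rootM /= eP es' !root_prod_XsubC => /orP[/chP //|/s's[w ws ew]].
  exact: chain_step (chs w ws) ew.
have [w ws' ew] : exists2 w, w \in s' & w ^+ q.+1 = (y n + 1) ^+ q.+1 - 1.
  by apply: ss; rewrite -root_prod_XsubC -es.
exists (fun i => if (i <= n)%N then y i else w); split=> //.
  move=> i lein; have [ltin|gein] := ltnP i n; first by rewrite /= ltnW // yS.
  have -> : i = n by apply/eqP; rewrite eqn_leq gein -ltnS lein.
  by rewrite /= leqnn ew.
by rewrite /= ltnn es' root_prod_XsubC.
Qed.

End TowerPolynomials.

Lemma fraction_quotient (R : idomainType) (c : {fraction R}) :
  exists a b, b != 0 /\ c = tofrac a / tofrac b.
Proof.
elim/quotW: c => x; have d0 := denom_ratioP x.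
exists (frac x).1, (frac x).2; split=> //.
have fd0 : tofrac (frac x).2 != 0 by rewrite tofrac_eq0.
apply: (mulIf fd0); rewrite divfK //.
rewrite -[X in X * _]/(\pi_({fraction R})%qT x) /GRing.mul /= !piE.
apply/eqmodP; rewrite /= FracField.equivfE /FracField.mulf !numden_Ratio ?oner_neq0 ?mulr1 ?mulf_neq0 //.
by rewrite mulrC.
Qed.

Section FermatField.
Variables (K : finFieldType) (q ell a : nat).
Hypotheses (cardK : #|K| = (q ^ 2)%N) (p_prime : prime ell) (q_def : q = (ell ^ a)%N)
  (a_gt0 : (0 < a)%N) (p_char : ell%:R = 0 :> K).

(** The splitting field of the tower polynomial is Galois over [K(x)], and its group realises the
    abstract setting. Its order is at least [(q+1)^n], which exceeds [n]. *)
Theorem poly_code_family n : exists G : finType, (n <= #|G|)%N /\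
  forall delta, (0 < delta)%N -> (delta * (16 * q ^ 2) < #|G|)%N -> poly_code K G (16 * q ^ 2) delta.
Proof.
have q_gt1 : (1 < q)%N by rewrite q_def -(exp1n a) ltn_exp2r // prime_gt1.
have q_dvd : (ell %| q)%N by rewrite q_def dvdn_exp.
pose k : fieldType := {fraction {poly K}}.
pose emb : {rmorphism {poly K} -> k} := @tofrac _.
have [P [p [mP mp sp pP HP]]] := tower_poly emb q n.
have [L [zs [ezs genL]]] := exists_splitting_field mP.
have [chz [y [y0 yS _]]] := HP L (in_alg L) zs ezs.
pose iota : {rmorphism {poly K} -> L} := (in_alg L) \o emb.
pose G := gal_of {:L}%VS.
have charL : ell \in [pchar L].
  rewrite inE p_prime; have -> : ell%:R = iota (ell%:R)%:P :> L by rewrite !rmorph_nat.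
  by rewrite p_char rmorph0 eqxx.
have natq : [pchar L].-nat q by rewrite q_def pnatX pnatE // charL.
have frob (u v : L) : (u + v) ^+ q = u ^+ q + v ^+ q by apply: exprDn_pchar.
have sep : separable 1 {:L}.
  rewrite -genL; apply: separable_Fadjoin_seq; apply/allP => z /chz.
  elim=> [|w {}z _ sepw e]; first by apply: base_separable; rewrite /= memvZ // mem1v.
  have [->|z0] := eqVneq z 0; first by apply: base_separable; apply: mem0v.
  apply: (adjoin_separable sepw).
  (* Separability amounts to [z] being in the field generated by [z ^+ q], and [z] is the known
     [z ^+ q.+1] divided by it. *)
  rewrite (pcharf_n_separable _ _ natq q_gt1); set S := <<_; _>>%VS.
  have -> : z = ((w + 1) ^+ q.+1 - 1) / z ^+ q.
    by rewrite -e exprS mulfK // expf_neq0.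
  have wS : w \in S by apply: subvP_adjoin; apply: memv_adjoin.
  have S1 : 1 \in S by apply: mem1v.
  by apply: rpredM; [apply: rpredB => //; apply: rpredX; apply: rpredD | rewrite rpredV memv_adjoin].
have gal1 : galois 1 {:L} by rewrite /galois sub1v sep normalFieldf.
pose act (g : G) : {rmorphism L -> L} := gal_repr g : 'AEnd(L).
have actE g u : act g u = g u by [].
have act1 u : act 1%g u = u by rewrite actE gal_id.
have actM g h u : act (g * h)%g u = act h (act g u) by rewrite !actE galM ?memvf.
have act_alg g c : act g (c%:A) = c%:A by rewrite actE linearZ /= rmorph1.
have fixed1 u : (forall g, act g u = u) -> exists c : k, u = c%:A.
  move=> hu; have : u \in fixedField 'Gal({:L} / 1)%g.
    by apply/fixedFieldP; rewrite ?memvf // => g _; apply: hu.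
  rewrite (galois_fixedField gal1) => /vlineP[c ->]; by exists c.
have gen g : (forall u, chain iota q u -> act g u = u) -> g = 1%g.
  move=> hg; apply/eqP/gal_eqP => u _; rewrite gal_id.
  have : u \in fixedSpace (gal_repr g : 'AEnd(L)).
    have : (<<1 & zs>> <= fixedSpace (gal_repr g : 'AEnd(L)))%VS.
      apply/Fadjoin_seqP; split; first exact: sub1v.
      by move=> z zzs; apply/fixedSpaceP; apply: hg; apply: chz.
    by rewrite genL => /subvP; apply; rewrite memvf.
  by move/fixedSpaceP.
have iota_inj : injective iota.
  move=> u v h; have /eqP : emb u = emb v by apply: (fmorph_inj (in_alg L)).
  by rewrite tofrac_eq => /eqP.
have act_iota g u : act g (iota u) = iota u by apply: act_alg.
have act_fixed u : (forall g, act g u = u) -> exists b c, c != 0 /\ u = iota b / iota c.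
  move=> /fixed1[c ->]; have [b [e [e0 ->]]] := fraction_quotient c.
  by exists b, e; split=> //; exact: (fmorph_div (in_alg L)).
exists G; split.
  apply: (leq_trans _ (tower_degree iota_inj act1 actM act_fixed q_gt1 cardK frob p_prime q_dvd y0 yS)).
  by apply: ltnW; apply: ltn_expl; apply: ltnW.
move=> delta; exact: (poly_code_tower iota_inj act1 actM act_iota act_fixed q_gt1 cardK frob p_prime q_dvd p_char gen).
Qed.

End FermatField.

(** * Decomposition of symmetric trilinear forms *)

Section CubicFrames.
Variables (F : finFieldType) (S : finType).

Definition sym3 (T : S -> S -> S -> F) :=
  (forall a b c, T a b c = T b a c) /\ (forall a b c, T a b c = T a c b).

(** Functionals that re-encode a block: joint injectivity preserves the distance, and the second
    clause makes symmetric forms diagonal, as transversality demands. *)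
Definition cubic_frame (J : finType) (phi : 'I_3 -> J -> S -> F) :=
  (forall h (u : S -> F), (forall j, \sum_s phi h j s * u s = 0) -> forall s, u s = 0) /\
  (forall T, sym3 T -> exists b : J -> F, forall x y z,
     T x y z = \sum_j b j * phi 0 j x * phi 1 j y * phi 2%:R j z).

Lemma sum_delta (x : S) (u : S -> F) : \sum_i (x == i)%:R * u i = u x.
Proof.
rewrite (bigD1 x) //= eqxx mul1r big1 ?addr0 // => i /negPf.
by rewrite eq_sym => ->; rewrite mul0r.
Qed.

(** Index by triples and let the three families read the three entries: this is the expansion of a
    form in coordinates, over any finite field. *)
Lemma coordinate_frame : exists (J : finType) (phi : 'I_3 -> J -> S -> F), cubic_frame phi.
Proof.
pose pr (h : 'I_3) (j : S * S * S) := if h == 0 then j.1.1 else if h == 1 then j.1.2 else j.2.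
exists (S * S * S)%type, (fun h j s => (pr h j == s)%:R); split.
  move=> h u hu s; rewrite -(hu (s, s, s)).
  by rewrite sum_delta /pr; do 2![case: ifP => //].
move=> T _; exists (fun j => T j.1.1 j.1.2 j.2) => x y z.
rewrite (bigD1 (x, y, z)) //= !eqxx !mulr1 big1 ?addr0 // => -[[a b] c] /=.
by rewrite /pr /= !xpair_eqE !negb_and -orbA => /or3P[] /negPf->; rewrite ?(mulr0, mul0r).
Qed.

Section Waring.
Variables (tau : F) (tau0 : tau != 0) (tau1 : tau != 1).

Let cubes (T : S -> S -> S -> F) := exists b : {ffun S -> F} -> F, forall x y z,
  T x y z = \sum_j b j * j x * j y * j z.

Let cubes_ext T T' : (forall x y z, T x y z = T' x y z) -> cubes T' -> cubes T.
Proof. by move=> e [b h]; exists b => x y z; rewrite e. Qed.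

Let cubes_lin a T T' : cubes T -> cubes T' -> cubes (fun x y z => a * T x y z + T' x y z).
Proof.
move=> [b h] [b' h']; exists (fun j => a * b j + b' j) => x y z.
by rewrite h h' mulr_sumr -big_split; apply: eq_bigr => j _ /=; ring.
Qed.

Let cubes0 : cubes (fun _ _ _ => 0).
Proof. by exists (fun=> 0) => x y z; rewrite big1 // => j _; rewrite !mul0r. Qed.

Let cubes_scale a T : cubes T -> cubes (fun x y z => a * T x y z).
Proof. by move=> h; apply: cubes_ext (cubes_lin a h cubes0) => x y z; rewrite addr0. Qed.

Let cubesD T T' : cubes T -> cubes T' -> cubes (fun x y z => T x y z + T' x y z).
Proof. by move=> h h'; apply: cubes_ext (cubes_lin 1 h h') => x y z; rewrite mul1r. Qed.

Let cubes_sum (I : finType) (T : I -> S -> S -> S -> F) :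
  (forall i, cubes (T i)) -> cubes (fun x y z => \sum_i T i x y z).
Proof.
move=> h; elim: (index_enum I) => [|i s IHs].
  by apply: cubes_ext cubes0 => x y z; rewrite big_nil.
by apply: cubes_ext (cubesD (h i) IHs) => x y z; rewrite big_cons.
Qed.

Let cube (u : S -> F) : cubes (fun x y z => u x * u y * u z).
Proof.
exists (fun j => (j == finfun u)%:R) => x y z.
rewrite (bigD1 (finfun u)) //= eqxx !ffunE mul1r big1 ?addr0 // => j /negPf->.
by rewrite !mul0r.
Qed.

Definition mono21 (u v : S -> F) x y z := u x * u y * v z + u x * v y * u z + v x * u y * u z.

(* Subtracting [u^3] and [v^3] from [(u + t v)^3] leaves
   [t mono21 u v + t^2 mono21 v u]; the values [t = 1, tau] separate both terms. *)
Let cubes21 u v : cubes (mono21 u v).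
Proof.
have h t : cubes (fun x y z => t * mono21 u v x y z + t ^+ 2 * mono21 v u x y z).
  apply: cubes_ext (cubes_lin (-1) (cube u) (cubes_lin (- t ^+ 3) (cube v) (cube (fun x => u x + t * v x)))).
  by move=> x y z; rewrite /mono21; ring.
have d0 : tau * (tau - 1) != 0 by rewrite mulf_neq0 // subr_eq0.
apply: cubes_ext (cubes_scale (tau * (tau - 1))^-1 (cubes_lin (tau ^+ 2) (h 1) (cubes_scale (-1) (h tau)))).
move=> x y z; apply: (mulfI d0); rewrite mulrA divff // mul1r; ring.
Qed.

(** Polarising [mono21] in its repeated argument gives the sum over six permutations without
    dividing by 2 or 6. *)
Let cubes111 u v w : cubes (fun x y z =>
  u x * (v y * w z + w y * v z) + u y * (v x * w z + w x * v z) + u z * (v x * w y + w x * v y)).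
Proof.
apply: cubes_ext (cubes_lin (-1) (cubes21 v u) (cubes_lin (-1) (cubes21 w u) (cubes21 (fun x => v x + w x) u))).
by move=> x y z; rewrite /mono21; ring.
Qed.

Let rk (a : S) : nat := enum_rank a.
Let e (i x : S) : F := (x == i)%:R.

Let sum_e x (u : S -> F) : \sum_i e i x * u i = u x. Proof. exact: sum_delta. Qed.

Let ltgt a b :
  [\/ [/\ (rk a < rk b)%N = true, (rk b < rk a)%N = false, (a == b) = false & (b == a) = false],
      [/\ (rk b < rk a)%N = true, (rk a < rk b)%N = false, (a == b) = false & (b == a) = false]
    | a = b].
Proof.
have [->|ne] := eqVneq a b; first by constructor 3.
case: (ltngtP (rk a) (rk b)) => h; [by constructor 1|by constructor 2|].
by case/eqP: ne; apply: enum_rank_inj; apply: val_inj.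
Qed.

(** Split [M] into its diagonal and the rows [r b] of its strict lower triangle: the former yields
    terms [mono21], the latter terms [cubes111]. *)
Let cubes_slice i (M : S -> S -> F) : (forall b c, M b c = M c b) ->
  cubes (fun x y z => e i x * M y z + e i y * M x z + e i z * M x y).
Proof.
move=> symM; pose r b c := M b c * (rk c < rk b)%N%:R.
have dec y z : M y z = \sum_b (M b b * (e b y * e b z) + (e b y * r b z + r b y * e b z)).
  rewrite big_split big_split /=.
  rewrite (eq_bigr (fun b => e b y * (M b b * e b z))); last by move=> b _; ring.
  rewrite [X in _ + (_ + X)](eq_bigr (fun b => e b z * r b y)); last by move=> b _; ring.
  rewrite !sum_e /r /e; case: (ltgt y z) => [[-> -> _ ->]|[-> -> _ ->]|->].
  - by rewrite /= symM; ring.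
  - by rewrite /=; ring.
  by rewrite eqxx ltnn /=; ring.
apply: cubes_ext (cubes_sum (fun b => cubes_lin (M b b) (cubes21 (e b) (e i)) (cubes111 (e i) (e b) (r b)))).
move=> x y z; rewrite (dec y z) (dec x z) (dec x y) !mulr_sumr -!big_split /=.
by apply: eq_bigr => b _; rewrite /mono21; ring.
Qed.

(** Group the triples by their largest index [i], occurring three times, twice or once: a cube, a
    [mono21] with [r i], or a slice with [M i]. Sorting avoids denominators, so small characteristic
    is harmless. *)
Lemma sym3_cubes T : sym3 T -> exists b : {ffun S -> F} -> F, forall x y z,
  T x y z = \sum_j b j * j x * j y * j z.
Proof.
move=> [s1 s2]; pose r i b := T i i b * (rk b < rk i)%N%:R.
pose M i b c := T i b c * ((rk b < rk i) && (rk c < rk i))%N%:R.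
have symM i b c : M i b c = M i c b by rewrite /M andbC s2.
apply: cubes_ext (cubes_sum (fun i => cubesD (cubes_slice i (symM i)) (cubes_lin (T i i i) (cube (e i)) (cubes21 (e i) (r i))))).
move=> x y z.
rewrite (eq_bigr (fun i => e i x * M i y z + e i y * M i x z + e i z * M i x y + (e i x * (e i y * e i z * T i i i) + (e i x * (e i y * r i z) + e i x * (e i z * r i y) + e i y * (e i z * r i x))))); last by move=> i _; rewrite /mono21; ring.
rewrite !big_split /= !sum_e /M /r /e.
have s3 u v w : T u v w = T w u v by rewrite s2 s1.
rewrite (s1 y x z) -(s3 x y z) (s2 x x y) (s3 y y x).
case: (ltgt x y) => [[a1 a2 a3 a4]|[a1 a2 a3 a4]|E1]; case: (ltgt y z) => [[b1 b2 b3 b4]|[b1 b2 b3 b4]|E2];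
  case: (ltgt x z) => [[c1 c2 c3 c4]|[c1 c2 c3 c4]|E3]; subst => //.
all: rewrite ?eqxx ?ltnn ?a1 ?a2 ?a3 ?a4 ?b1 ?b2 ?b3 ?b4 ?c1 ?c2 ?c3 ?c4 /=.
all: rewrite ?(mulr0n, mulr1n, mulr0, mul0r, mulr1, mul1r, addr0, add0r) //.
all: by move: a1 b1 c1; clear; lia.
Qed.

End Waring.

(** A third field element is what separates the two mixed terms of a cube. All functionals are used,
    so injectivity is clear. *)
Lemma Waring_frame : (2 < #|F|)%N -> exists (J : finType) (psi : J -> S -> F), cubic_frame (fun _ => psi).
Proof.
move=> F3; have [tau] : exists tau : F, tau \notin [:: 0; 1].
  apply/existsP; apply: contraLR F3; rewrite negb_exists => /forallP h.
  rewrite -leqNgt -[2%N]/(size [:: 0; 1 : F]); apply: leq_trans (card_size _).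
  by apply: subset_leq_card; apply/subsetP => x _; rewrite -[_ \in _]negbK.
rewrite !inE negb_or => /andP[tau0 tau1].
exists {ffun S -> F}, (fun (j : {ffun S -> F}) s => j s); split=> [_ u hu s | T /(sym3_cubes tau0 tau1)//].
rewrite -(hu [ffun i => (s == i)%:R]) -[LHS](sum_delta s).
by apply: eq_bigr => i _; rewrite ffunE.
Qed.

End CubicFrames.

(** * CSS codes from encoding graphs *)

Section Duals.
Variable F : fieldType.

Lemma sub_dualmx n (A : 'M[F]_n) (y : 'rV_n) : (y <= dualmx A)%MS = (A *m y^T == 0).
Proof. by rewrite /dualmx; apply/sub_kermxP/eqP => [h|h]; apply: trmx_inj; rewrite trmx_mul ?trmxK trmx0. Qed.

Lemma sub_dualmxP n (A : 'M[F]_n) (y : 'rV_n) :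
  reflect (forall v : 'rV_n, (v <= A)%MS -> \sum_j y 0 j * v 0 j = 0) (y <= dualmx A)%MS.
Proof.
have dot (v : 'rV_n) : (v *m y^T) 0 0 = \sum_j y 0 j * v 0 j.
  by rewrite mxE; apply: eq_bigr => j _; rewrite mxE mulrC.
rewrite sub_dualmx; apply: (iffP eqP) => [h v /submxP[B ->]|h].
  by rewrite -dot -mulmxA h mulmx0 mxE.
apply/matrixP => i j; rewrite [RHS]mxE ord1 -(h _ (row_sub i A)) -dot.
by rewrite -row_mul [RHS]mxE.
Qed.

Lemma dualmxK n (A : 'M[F]_n) : (dualmx (dualmx A) == A)%MS.
Proof.
have sub : (A <= dualmx (dualmx A))%MS.
  apply/row_subP => i; rewrite sub_dualmx tr_row /dualmx; apply/eqP.
  by rewrite colE mulmxA mulmx_ker mul0mx.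
rewrite andbC -(geq_leqif (mxrank_leqif_eq sub)).
by rewrite /dualmx !(mxrank_ker, mxrank_tr) subKn // rank_leq_col.
Qed.

End Duals.

Section CSSofGraph.
Variables (F : finFieldType) (n k D : nat) (P : 'rV[F]_k -> 'rV[F]_n -> Prop).
Hypotheses (P0 : P 0 0)
  (PD : forall a z v z' v', P z v -> P z' v' -> P (a *: z + z') (a *: v + v'))
  (P_total : forall z, exists v, P z v)
  (P_zdist : forall z v, P z v -> z != 0 -> (D <= wt v)%N)
  (P_xdist : forall y : 'rV[F]_n, (forall v, P 0 v -> \sum_j y 0 j * v 0 j = 0) ->
     (exists z v, P z v /\ \sum_j y 0 j * v 0 j != 0) -> (D <= wt y)%N)
  (D_gt0 : (0 < D)%N) (D_le_n : (D <= n)%N).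

(* Here [P] is the graph [{(z, v) | v \in Enc_Z z}] of the encoding. *)
Lemma css_of_graph : exists (Q : css F n) (E : 'M[F]_(k, n)),
  [/\ css_valid Q, css_dim Q = k, is_encZ Q E, (D <= css_dist Q)%N
    & forall z v, in_enc Q E z v -> P z v].
Proof.
have PB z v z' v' : P z v -> P z' v' -> P (z - z') (v - v').
  by move=> h h'; have := PD (-1) h' h; rewrite !scaleN1r ![- _ + _]addrC.
have [||S0 HS0] := @subspace_mx F n (P 0) => //.
  by move=> a x y hx hy; have := PD a hx hy; rewrite scaler0 addr0.
have [||SZ HSZ] := @subspace_mx F n (fun v => exists z, P z v).
- by exists 0.
- by move=> a x y [z hz] [z' hz']; exists (a *: z + z'); apply: PD.
have [c Pc] := choice (fun j : 'I_k => P_total (delta_mx 0 j)).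
(* [S0] is the coset of the message 0 and [SZ] the union of all cosets; by biduality the dual of
   [QX] is [S0]. *)
pose E := \matrix_j c j; exists (CSS (dualmx S0) SZ), E.
have dd v : (v <= dualmx (dualmx S0))%MS = (v <= S0)%MS by rewrite (eqmxP (dualmxK S0)).
have PE z : P z (z *m E).
  rewrite mulmx_sum_row [X in P X _]row_sum_delta.
  elim: (index_enum _) => [|j s IHs]; first by rewrite !big_nil.
  by rewrite !big_cons rowK; apply: PD.
have encP z v : in_enc (CSS (dualmx S0) SZ) E z v -> P z v.
  rewrite /in_enc /= dd => /HS0 /PD-/(_ 1 _ _ (PE z)).
  by rewrite scaler0 add0r scale1r subrK.
(* Such a [z] would have the zero vector in its coset, against the positive distance. *)
have enc_inj (z : 'rV_k) : (z *m E <= S0)%MS -> z = 0.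
  move=> /HS0 h; apply: contraTeq D_gt0 => z0.
  have := P_zdist (PB _ _ _ _ (PE z) h); rewrite subr0 subrr => /(_ z0).
  rewrite /wt (_ : [set _ | _] = set0) ?cards0 ?leqn0 -?eqn0Ngt //.
  by apply/setP => j; rewrite !inE mxE eqxx.
have S0SZ : (S0 <= SZ)%MS by apply/rV_subP => v /HS0 h; apply/HSZ; exists 0.
have ESZ : (E <= SZ)%MS.
  by apply/row_subP => j; rewrite rowK; apply/HSZ; exists (delta_mx 0 j).
have SZE : (SZ <= E + S0)%MS.
  apply/rV_subP => v /HSZ[z h]; rewrite -[v](subrK (z *m E)) addrC addmx_sub_adds ?submxMl //.
  by apply/HS0; rewrite -(subrr z); apply: PB.
have rE : \rank E = k.
  apply/eqP; rewrite -[_ == _]/(row_free E) -kermx_eq0; apply/rowV0P => z /sub_kermxP e.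
  by apply: enc_inj; rewrite e sub0mx.
have rcap : \rank (E :&: S0) = 0%N.
  apply/eqP; rewrite mxrank_eq0; apply/rowV0P => v.
  rewrite sub_capmx => /andP[/submxP[z ->]] /enc_inj->; exact: mul0mx.
split=> //.
- by rewrite /css_valid /= (eqmxP (dualmxK S0)).
- rewrite /css_dim /= (eqmxP (dualmxK S0)).
  have -> : \rank SZ = \rank (E + S0)%MS.
    by apply: eqmx_rank; rewrite SZE addsmx_sub ESZ.
  by rewrite -(addn0 (\rank (E + S0))) -rcap mxrank_sum_cap rE addnK.
- split=> //= [z|]; first by rewrite dd => /enc_inj.
  by rewrite (adds_eqmx (eqmx_refl E) (eqmxP (dualmxK S0))).
(* The default value [n] of the minimum is covered by [D_le_n]. *)
rewrite /css_dist; apply: (big_ind (fun m => (D <= m)%N)) => // [x y hx hy|y]; first by rewrite leq_min hx.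
case/orP => /andP[] /=.
  move=> /sub_dualmxP h /sub_dualmxP h'; apply: P_xdist => [v /HS0/h//|].
  apply: contrapT => hn; apply: h' => v /HSZ[z Pzv]; apply: contrapT => /eqP hv.
  by apply: hn; exists z, v.
rewrite dd => /HSZ[z Pzy] h; apply: (P_zdist Pzy); apply: contraNneq h => z0.
by apply/HS0; rewrite -z0.
Qed.

End CSSofGraph.

(** * Descent to the base field *)

Section Descent.
Variables (F K : finFieldType) (emb : {rmorphism F -> K}) (e r : nat).
Variables (kap : 'I_e -> K) (co : 'I_e -> K -> F) (tht : K -> F).
Hypotheses (co_lin : forall j a x y, co j (emb a * x + y) = a * co j x + co j y)
  (co_dec : forall x, x = \sum_j emb (co j x) * kap j)
  (tht_lin : forall a x y, tht (emb a * x + y) = a * tht x + tht y) (tht1 : tht 1 = 1).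

Let S := ('I_r * 'I_e)%type.

Let coord (s : S) (p : {poly K}) : F := co s.2 p`_s.1.
Let basis (s : S) : {poly K} := kap s.2 *: 'X^(s.1).

Let coord_lin s a x y : coord s (emb a *: x + y) = a * coord s x + coord s y.
Proof. by rewrite /coord coefD coefZ co_lin. Qed.

Let coord0 s : coord s 0 = 0.
Proof. by have := coord_lin s (-1) 0 0; rewrite scaler0 addr0 mulN1r addNr. Qed.

Let coord_dec (p : {poly K}) : (size p <= r)%N -> p = \sum_s emb (coord s p) *: basis s.
Proof.
move=> sp; rewrite -(pair_bigA _ (fun (i : 'I_r) (j : 'I_e) => emb (co j p`_i) *: (kap j *: 'X^i))) /=.
have {1}-> : p = \poly_(i < r) p`_i.
  by apply/polyP => i; rewrite coef_poly; case: ltnP => // h; rewrite nth_default // (leq_trans sp).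
rewrite poly_def; apply: eq_bigr => i _; rewrite [in LHS](co_dec p`_i) scaler_suml.
by apply: eq_bigr => j _; rewrite scalerA.
Qed.

Lemma linear_expand (f : {poly K} -> F) (p : {poly K}) : (size p <= r)%N ->
  (forall a x y, f (emb a *: x + y) = a * f x + f y) ->
  f p = \sum_s coord s p * f (basis s).
Proof.
move=> sp fl; have f0 : f 0 = 0 by have := fl (-1) 0 0; rewrite scaler0 addr0 mulN1r addNr.
rewrite [in LHS](coord_dec sp); elim: (index_enum _) => [|s l IHl]; first by rewrite !big_nil.
by rewrite !big_cons fl IHl.
Qed.

Variables (G J : finType) (delta : nat) (C : (G -> {poly K}) -> Prop).
Variables (A : {set G}) (lam : G -> {poly K} -> K).
Hypotheses (C0 : C (fun=> 0))
  (C_lin : forall a x y, C x -> C y -> C (fun g => a *: x g + y g))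
  (C_size : forall x, C x -> forall g, (size (x g) <= r)%N)
  (C_dist : forall x, C x -> (exists g, x g != 0) -> (delta <= #|[set g | x g != 0%R]|)%N)
  (C_interp : forall (W : {set G}) p, (#|W| <= delta)%N -> (forall g, (size (p g : {poly K}) <= r)%N) ->
     exists2 x, C x & forall g, g \in W -> x g = p g)
  (A_delta : (#|A| < delta)%N) (r_gt0 : (0 < r)%N) (delta_le : (delta <= #|G|)%N)
  (lam_lin : forall g a x y, lam g (a *: x + y) = a * lam g x + lam g y)
  (lam_C : forall x y z, C x -> C y -> C z -> \sum_g lam g (x g * y g * z g) = 0)
  (lam1 : forall g, g \in A -> lam g 1 = 1).

Implicit Type psi : J -> S -> F.

(* The message sits in the blocks of [A], as constant polynomials; those blocks
   are punctured from the codeword (their coordinates are padded with [0]), and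
   every other block is sent through the functionals [psi]. *)
Definition block_graph psi (z : 'rV[F]_#|A|) (v : 'rV[F]_#|{: G * J}|) :=
  exists x, [/\ C x, forall i, x (enum_val i) = (emb (z 0 i))%:P
    & forall g j, v 0 (enum_rank (g, j)) =
        if g \in A then 0 else \sum_s psi j s * coord s (x g)].

Definition jointly_injective psi :=
  forall u : S -> F, (forall j, \sum_s psi j s * u s = 0) -> forall s, u s = 0.

Let blocks (v : 'rV[F]_#|{: G * J}|) := [set (enum_val t).1 | t in [set t | v 0 t != 0%R]].

Let blocks_wt v : (#|blocks v| <= wt v)%N. Proof. exact: leq_imset_card. Qed.

Let in_blocks (v : 'rV[F]_#|{: G * J}|) g j : v 0 (enum_rank (g, j)) != 0 -> g \in blocks v.
Proof. by move=> h; apply/imsetP; exists (enum_rank (g, j)); rewrite ?inE ?enum_rankK. Qed.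

Let block_total psi z : exists v, block_graph psi z v.
Proof.
have [x Cx xA] := @C_interp A (fun g => (\sum_(i | enum_val i == g :> G) emb (z 0 i))%:P) (ltnW A_delta)
  (fun g => leq_trans (size_polyC_leq1 _) r_gt0).
exists (\row_t (if (enum_val t).1 \in A then 0
  else \sum_s psi (enum_val t).2 s * coord s (x (enum_val t).1))), x; split=> // [i|g j].
  rewrite xA ?enum_valP // (big_pred1 i) // => i' /=; exact: inj_eq enum_val_inj _ _.
by rewrite mxE enum_rankK.
Qed.

(** In [Z], a nonzero message gives at least [delta] nonzero blocks, at most [#|A|] of them
    punctured; injectivity keeps the others visible. In [X], if [y] is too light, replace the word
    [x] by one equal to it on the blocks of [y] and 0 on [A]: this encodes 0 and pairs with [y] in
    the same way. *)
Lemma css_of_block_graph psi : jointly_injective psi -> (0 < #|J|)%N ->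
  exists (Q : css F #|{: G * J}|) (E : 'M[F]_(#|A|, #|{: G * J}|)),
  [/\ css_valid Q, css_dim Q = #|A|, is_encZ Q E, (delta - #|A| <= css_dist Q)%N
    & forall z v, in_enc Q E z v -> block_graph psi z v].
Proof.
move=> inj J_gt0; apply: css_of_graph.
- exists (fun=> 0); split=> // [i|g j]; first by rewrite mxE rmorph0 polyC0.
  by rewrite mxE; case: ifP => // _; rewrite big1 // => s _; rewrite coord0 mulr0.
- move=> a z v z' v' [x [Cx xA xv]] [x' [Cx' xA' xv']].
  exists (fun g => emb a *: x g + x' g); split=> [|i|g j]; first exact: C_lin.
    by rewrite xA xA' !mxE rmorphD rmorphM polyCD polyCM mul_polyC.
  rewrite !mxE xv xv'; case: ifP => _; first by rewrite mulr0 addr0.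
  by rewrite mulr_sumr -big_split; apply: eq_bigr => s _; rewrite coord_lin /=; ring.
- exact: block_total.
- move=> z v [x [Cx xA xv]] z0; apply: leq_trans (blocks_wt v).
  have [i zi] : exists i, z 0 i != 0.
    by apply: contrapT => h; case/eqP: z0; apply/rowP => i; rewrite mxE; apply: contrapT => /eqP hi; apply: h; exists i.
  have /(C_dist Cx) h : exists g, x g != 0.
    by exists (enum_val i); rewrite xA polyC_eq0 fmorph_eq0.
  rewrite leq_subLR; apply: leq_trans h _; rewrite -cardsUI; apply: leq_trans (leq_addr _ _).
  apply/subset_leq_card/subsetP => g; rewrite !inE; case: (boolP (g \in A)) => //= gA xg0.
  apply: contrapT => gb; case/eqP: xg0.
  rewrite (coord_dec (C_size Cx g)) big1 // => s _; rewrite (inj (fun s => coord s (x g))) ?rmorph0 ?scale0r // => j.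
  by apply: contrapT => /eqP hj; apply: gb; apply: (@in_blocks v g j); rewrite xv (negPf gA).
- move=> y y0 [z [v [[x [Cx xA xv]]]]]; apply: contraNT; rewrite -ltnNge => wy.
  have hW : (#|A :|: blocks y| <= delta)%N.
    apply: leq_trans (leq_of_leqif (leq_card_setU _ _)) _.
    by have := blocks_wt y; move: wy A_delta; clear; lia.
  have [||x' Cx' x'W] := @C_interp (A :|: blocks y) (fun g => if g \in A then 0 else x g) => // [g|].
    by case: ifP => _; rewrite ?size_poly0 ?C_size.
  pose v' : 'rV[F]_#|{: G * J}| := \row_t (if (enum_val t).1 \in A then 0 else \sum_s psi (enum_val t).2 s * coord s (x' (enum_val t).1)).
  have /y0 e0 : block_graph psi 0 v'.
    exists x'; split=> // [i|g j]; last by rewrite mxE enum_rankK.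
    by rewrite x'W ?inE enum_valP // mxE rmorph0 polyC0.
  apply/eqP; transitivity (\sum_t y 0 t * v' 0 t); last exact: e0.
   apply: eq_bigr => t _; have [->|yt] := eqVneq (y 0 t) 0; first by rewrite !mul0r.
  have gb : (enum_val t).1 \in blocks y by apply/imsetP; exists t; rewrite ?inE.
  congr (_ * _); rewrite mxE; have := xv (enum_val t).1 (enum_val t).2.
  rewrite -surjective_pairing enum_valK => ->; case: ifP => // gA.
  by rewrite x'W ?inE ?gb ?orbT // gA.
- by rewrite subn_gt0.
apply: leq_trans (leq_subr _ _) _; apply: leq_trans delta_le _.
by rewrite card_prod leq_pmulr.
Qed.

(** Apply [tht] to the vanishing sum of the forms [lam g (x * y * z)]. On [A] it returns the
    products of message symbols; the remaining blocks, diagonalised by the frame, equal minus this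
    sum, whence the sign in the coefficients. *)
Lemma block_CCZ (phi : 'I_3 -> J -> S -> F) : cubic_frame phi ->
  exists b : 'rV[F]_#|{: G * J}|, forall z1 z2 z3 v1 v2 v3,
    block_graph (phi 0) z1 v1 -> block_graph (phi 1) z2 v2 -> block_graph (phi 2%:R) z3 v3 ->
    \sum_j z1 0 j * z2 0 j * z3 0 j = \sum_j b 0 j * v1 0 j * v2 0 j * v3 0 j.
Proof.
move=> [_ dec]; pose w g (x y z : {poly K}) : F := tht (lam g (x * y * z)).
have th0 : tht 0 = 0 by have := tht_lin (-1) 0 0; rewrite mulr0 addr0 mulN1r addNr.
have th_sum (f : G -> K) : tht (\sum_g f g) = \sum_g tht (f g).
  elim: (index_enum G) => [|g l IHl]; first by rewrite !big_nil th0.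
  by rewrite !big_cons -[f g]mul1r -(rmorph1 emb) tht_lin mul1r IHl rmorph1 mul1r.
have w1 g a x x' y z : w g (emb a *: x + x') y z = a * w g x y z + w g x' y z.
  by rewrite /w -tht_lin -lam_lin; congr (tht (lam g _)); rewrite !mulrDl !scalerAl.
have wC g x y z : w g x y z = w g y x z by rewrite /w [x * y]mulrC.
have wA g x y z : w g x y z = w g x z y by rewrite /w mulrAC.
have /choice[b hb] g : exists b : J -> F, forall s1 s2 s3, w g (basis s1) (basis s2) (basis s3) =
    \sum_j b j * phi 0 j s1 * phi 1 j s2 * phi 2%:R j s3.
  by apply: dec; split=> s1 s2 s3; [rewrite wC | rewrite wA].
have wE g (x y z : {poly K}) : (size x <= r)%N -> (size y <= r)%N -> (size z <= r)%N ->
    w g x y z = \sum_j b g j * (\sum_s phi 0 j s * coord s x) * (\sum_s phi 1 j s * coord s y)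
       * (\sum_s phi 2%:R j s * coord s z).
  move=> sx sy sz; transitivity (\sum_s1 \sum_s2 \sum_s3 \sum_j
      b g j * (phi 0 j s1 * coord s1 x) * (phi 1 j s2 * coord s2 y) * (phi 2%:R j s3 * coord s3 z)).
    rewrite (linear_expand sx (fun a u v => w1 g a u v y z)); apply: eq_bigr => s1 _.
    rewrite wC (linear_expand sy (fun a u v => w1 g a u v (basis s1) z)) mulr_sumr; apply: eq_bigr => s2 _.
    rewrite wC wA wC (linear_expand sz (fun a u v => w1 g a u v (basis s1) (basis s2))) !mulr_sumr.
    apply: eq_bigr => s3 _; rewrite wC wA hb !mulr_sumr; apply: eq_bigr => j _; ring.
  under eq_bigr do under eq_bigr do rewrite exchange_big.
  under eq_bigr do rewrite exchange_big.
  rewrite exchange_big; apply: eq_bigr => j _.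
  under eq_bigr do under eq_bigr do rewrite -mulr_sumr.
  under eq_bigr do rewrite -mulr_suml -mulr_sumr.
  by rewrite -!mulr_suml -mulr_sumr.
exists (\row_t - b (enum_val t).1 (enum_val t).2) => z1 z2 z3 v1 v2 v3.
move=> [x1 [C1 A1 e1]] [x2 [C2 A2 e2]] [x3 [C3 A3 e3]].
have : \sum_g w g (x1 g) (x2 g) (x3 g) = 0 by rewrite -th_sum lam_C.
rewrite (bigID (mem A)) /= => /eqP; rewrite addr_eq0 => /eqP eA.
transitivity (\sum_(g in A) w g (x1 g) (x2 g) (x3 g)).
  rewrite [RHS]big_enum_val; apply: eq_bigr => i _.
  rewrite A1 A2 A3 /w -!polyCM -[(_ * _)%:P]mulr1 mul_polyC -[_ *: 1]addr0 lam_lin.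
  have -> : lam (enum_val i) 0 = 0 by have := lam_lin (enum_val i) (-1) 0 0; rewrite scaler0 addr0 mulN1r addNr.
  by rewrite lam1 ?enum_valP // -!rmorphM tht_lin tht1 th0 mulr1 addr0.
rewrite {}eA -sumrN [RHS](reindex (@enum_rank _)) /=; last exact: (onW_bij _ (@enum_rank_bij _)).
transitivity (\sum_g \sum_j - b g j * v1 0 (enum_rank (g, j)) * v2 0 (enum_rank (g, j)) * v3 0 (enum_rank (g, j))).
  2: by rewrite pair_bigA; apply: eq_bigr => -[g j] _; rewrite mxE enum_rankK.
rewrite [RHS](bigID (mem A)) /= [X in _ = X + _]big1 ?add0r; last first.
  by move=> g gA; rewrite big1 // => j _; rewrite e1 gA mulr0 !mul0r.
apply: eq_bigr => g gA; rewrite wE ?C_size // -sumrN; apply: eq_bigr => j _.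
by rewrite e1 e2 e3 (negPf gA) !mulNr.
Qed.

End Descent.

Import Num.Theory.

(** * The theorem *)

Lemma finField_card_prime_power (F : finFieldType) :
  exists ell a, [/\ prime ell, ell%:R = 0 :> F, (0 < a)%N & #|F| = (ell ^ a)%N].
Proof.
have [ell p_ell charF] := finPcharP F.
have F_ell : #|F| = (ell ^ logn ell #|F|)%N.
  by rewrite -cardsT; apply/card_pgroup/abelem_pgroup; apply: fin_ring_pchar_abelem.
exists ell, (logn ell #|F|); split=> //; first by have /andP[_ /eqP] := charF.
by case: (logn _ _) F_ell (finNzRing_gt1 F) => // ->.
Qed.

(* [x |-> x^2 + x] kills both [0] and [-1], hence misses some [-a]. *)
Lemma irreducible_quadratic (F : finFieldType) : exists2 p : {poly F}, size p = 3 & irreducible_poly p.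
Proof.
pose f (x : F) := - (x ^+ 2 + x).
have [a fa] : exists a, forall x, f x != a.
  apply: contrapT => nf.
  have surj a : exists x, f x = a.
    by apply: contrapT => h; apply: nf; exists a => x; apply/eqP => e; apply: h; exists x.
  have [g fK] := choice surj.
  have [h gK hK] := injF_bij (can_inj fK).
  have fi : injective f by move=> x y; rewrite -[x]hK -[y]hK !fK => ->.
  have /eqP : (0 : F) = -1 by apply: fi; rewrite /f; ring.
  by rewrite eq_sym oppr_eq0 oner_eq0.
pose p : {poly F} := 'X^2 + ('X + a%:P); exists p.
  by rewrite size_polyDl size_polyXn // size_XaddC.
apply: cubic_irreducible => [|x]; first by rewrite size_polyDl size_polyXn // size_XaddC.
rewrite /root !hornerD hornerXn hornerX hornerC; apply: contra (fa x) => /eqP e; rewrite /f.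
by apply/eqP; rewrite -[LHS]addr0 -e; ring.
Qed.

Lemma quadratic_extension (F : finFieldType) : exists (K : finFieldType) (emb : {rmorphism F -> K})
    (e : nat) (kap : 'I_e -> K) (co : 'I_e -> K -> F) (tht : K -> F),
  [/\ #|K| = (#|F| ^ 2)%N, forall j a x y, co j (emb a * x + y) = a * co j x + co j y,
      forall x, x = \sum_j emb (co j x) * kap j,
      forall a x y, tht (emb a * x + y) = a * tht x + tht y & tht 1 = 1].
Proof.
have [p sp /irredp_FAdjoin[L dimL _]] := irreducible_quadratic F.
pose K : finFieldType := finvect_type L.
pose emb : {rmorphism F -> K} := in_alg L.
pose co j (x : K) := coord (vbasis {:L}) j (x : L).
have co_lin j a x y : co j (emb a * x + y) = a * co j x + co j y.
  have -> : emb a * x + y = a *: (x : L) + (y : L) by congr (_ + _); apply: mulr_algl.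
  by rewrite /co linearP.
have co_dec x : x = \sum_j emb (co j x) * (vbasis {:L})`_j.
  rewrite [LHS](coord_vbasis (memvf x)); apply: eq_bigr => j _; rewrite [RHS]mulr_algl //.
(* Any coordinate not vanishing at 1, rescaled, serves as [tht]. *)
have [j0 j0P] : exists j, co j 1 != 0.
  apply: contrapT => h; have /eqP[] := oner_neq0 K; rewrite (co_dec 1) big1 // => j _.
  suff -> : co j 1 = 0 by rewrite rmorph0 mul0r.
  by apply: contrapT => /eqP hj; apply: h; exists j.
exists K, emb, _, (fun j => (vbasis {:L})`_j), co, (fun x => co j0 x / co j0 1); split=> //.
- have := card_vspace (fullv : {vspace K}).
  rewrite card_vspacef [X in (_ ^ X)%N](_ : _ = 2) //; rewrite sp in dimL; exact: dimL.
- by move=> a x y; rewrite co_lin mulrDl mulrA.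
- by rewrite divff.
Qed.

(** The code is a function [f] of the family of functionals alone, so that equal families give
    literally the same code and encoding; this yields the single code for larger fields. *)
Lemma good_triples (F : finFieldType) : exists S : finType,
  forall (J : finType) (phi : 'I_3 -> J -> S -> F), cubic_frame phi ->
  exists c : rat, 0 < c /\ forall m, exists n, (m <= n)%N /\
  exists k (f : (J -> S -> F) -> css F n * 'M[F]_(k, n)),
    (forall h, good_code c (f (phi h)).1 (f (phi h)).2) /\
    supports_CCZ (f (phi 0)).1 (f (phi 1)).1 (f (phi 2%:R)).1
      (f (phi 0)).2 (f (phi 1)).2 (f (phi 2%:R)).2.
Proof.
have [K [emb [e [kap [co [tht [cardK co_lin co_dec tht_lin tht1]]]]]]] := quadratic_extension F.
have [ell [a [p_prime p_char a_gt0 cardF]]] := finField_card_prime_power F.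
have p_charK : ell%:R = 0 :> K by rewrite -(rmorph_nat emb) p_char rmorph0.
have family := poly_code_family cardK p_prime cardF a_gt0 p_charK.
set r := (16 * _)%N in family.
have r_gt0 : (0 < r)%N by rewrite muln_gt0 expn_gt0 (ltnW (finNzRing_gt1 F)).
clearbody r.
have e_gt0 : (0 < e)%N.
  case: e kap co co_lin co_dec => // kap co _ /(_ 1) /eqP; by rewrite big_ord0 oner_eq0.
exists ('I_r * 'I_e)%type => J phi frame.
have J_gt0 : (0 < #|J|)%N.
  rewrite lt0n; apply/negP => /eqP/card0_eq J0.
  have /eqP : (1 : F) = 0.
    apply: (frame.1 0 (fun=> 1) _ (Ordinal r_gt0, Ordinal e_gt0)) => j.
    by have := J0 j; rewrite inE.
  by rewrite oner_eq0.
(* The length is [#|G| * #|J|], at most [r * delta.+1 * #|J|]; since [delta >= 2], [delta.+1] is at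
   most four times [delta./2], the dimension and a bound for the distance. *)
exists (4 * r * #|J|)%:R^-1; split.
  by rewrite invr_gt0 ltr0n !muln_gt0 r_gt0.
(* The summand [m] makes the length large; [3 * r] ensures [delta >= 2], so that half of it is
   positive. *)
move=> m; have [G [G_big codes]] := family (m + 3 * r)%N.
pose delta := (#|G|.-1 %/ r)%N.
have delta_r : (delta * r < #|G|)%N.
  by have := leq_divM #|G|.-1 r; rewrite -/delta; move: G_big r_gt0; clear; lia.
have G_delta : (#|G| <= r * delta.+1)%N.
  have := ltn_ceil #|G|.-1 r_gt0; rewrite -/delta mulnC; move: G_big r_gt0; clear; lia.
have delta_gt1 : (1 < delta)%N.
  by rewrite leq_divRL //; move: G_big r_gt0; clear; lia.
have delta_G : (delta <= #|G|)%N.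
  by apply: leq_trans (ltnW delta_r); rewrite leq_pmulr.
have [C [[C0 C_lin] C_size C_dist C_interp C_tri]] := codes delta (ltnW delta_gt1) delta_r.
have [|A [lam [cardA lam_lin lam_C lam1]]] := C_tri delta./2; first by move: delta_gt1; clear; lia.
have A_delta : (#|A| < delta)%N by rewrite cardA; move: delta_gt1; clear; lia.
exists #|{: G * J}|; split.
  rewrite card_prod; apply: leq_trans (leq_pmulr _ J_gt0).
  by apply: leq_trans G_big; apply: leq_addr.
have [f fP] : exists f : (J -> ('I_r * 'I_e)%type -> F) -> css F #|{: G * J}| * 'M[F]_(#|A|, #|{: G * J}|),
    forall psi, jointly_injective psi ->
    [/\ css_valid (f psi).1, css_dim (f psi).1 = #|A|, is_encZ (f psi).1 (f psi).2,
       (delta - #|A| <= css_dist (f psi).1)%N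
     & forall z v, in_enc (f psi).1 (f psi).2 z v -> block_graph emb co C psi z v].
  (* Choice needs a value for every family; one that is not injective receives the zero code. *)
  suff /choice[f fP] : forall psi : J -> ('I_r * 'I_e)%type -> F,
      exists QE : css F #|{: G * J}| * 'M[F]_(#|A|, #|{: G * J}|), jointly_injective psi ->
      [/\ css_valid QE.1, css_dim QE.1 = #|A|, is_encZ QE.1 QE.2,
       (delta - #|A| <= css_dist QE.1)%N & forall z v, in_enc QE.1 QE.2 z v -> block_graph emb co C psi z v].
    by exists f.
  move=> psi; have [inj|ninj] := EM (jointly_injective psi); last by exists (CSS 0 0, 0).
  have [Q [E QE]] := css_of_block_graph co_lin co_dec C0 C_lin C_size C_dist C_interp A_delta r_gt0 delta_G inj J_gt0.
  by exists (Q, E).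
have inj h : jointly_injective (phi h) by apply: frame.1.
exists #|A|, f; split.
  move=> h; have [v d enc dist _] := fP _ (inj h).
  have n_k : (#|{: G * J}| <= 4 * r * #|J| * #|A|)%N.
    rewrite card_prod mulnAC leq_mul2r; apply/orP; right; apply: leq_trans G_delta _.
    by rewrite [(4 * r)%N]mulnC -mulnA leq_mul2l cardA; apply/orP; right; move: delta_gt1; clear; lia.
  have bound x : (#|A| <= x)%N -> (4 * r * #|J|)%:R^-1 * #|{: G * J}|%:R <= x%:R :> rat.
    move=> Ax; rewrite mulrC ler_pdivrMr ?ltr0n ?muln_gt0 ?r_gt0 //.
    by rewrite -natrM ler_nat; apply: leq_trans n_k _; rewrite mulnC leq_mul2r Ax orbT.
  split=> //; apply: bound => //; apply: leq_trans dist.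
  by rewrite cardA; move: delta_gt1; clear; lia.
have [b bP] := block_CCZ co_dec tht_lin tht1 C_size lam_lin lam_C lam1 frame.
exists b => z1 z2 z3 v1 v2 v3 h1 h2 h3.
have in_graph h z v : in_enc (f (phi h)).1 (f (phi h)).2 z v -> block_graph emb co C (phi h) z v.
  by have [_ _ _ _] := fP _ (inj h); apply.
by apply: bP; apply: in_graph.
Qed.

Theorem theorem6p1 (F : finFieldType) :
  exists c : rat, 0 < c /\
  exists N : nat -> Prop, infinite_natset N /\
  (forall n : nat, N n ->
     exists (k : nat) (Q1 Q2 Q3 : css F n) (E1 E2 E3 : 'M[F]_(k, n)),
       [/\ good_code c Q1 E1, good_code c Q2 E2, good_code c Q3 E3
         & supports_CCZ Q1 Q2 Q3 E1 E2 E3]) /\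
  ((5 <= #|F|)%N ->
   forall n : nat, N n ->
     exists (k : nat) (Q : css F n) (E : 'M[F]_(k, n)),
       [/\ good_code c Q E, supports_CCZ Q Q Q E E E & supports_U Q E]).
Proof.
have [S triples] := good_triples F.
have [F5|F5] := leqP 5 #|F|.
  have [J [psi /triples[c [c0 codes]]]] := Waring_frame S (leq_trans (isT : (3 <= 5)%N) F5).
  pose N n := exists k (Q : css F n) (E : 'M[F]_(k, n)), good_code c Q E /\ supports_CCZ Q Q Q E E E.
  exists c; split=> //; exists N; split; [|split=> [n|_ n]].
  - move=> m; have [n [mn [k [f [fg fc]]]]] := codes m.
    by exists n; split=> //; exists k, (f psi).1, (f psi).2; split=> //; apply: (fg 0).
  - by case=> k [Q [E [g ccz]]]; exists k, Q, Q, Q, E, E, E.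
  (* With equal codes, the [U] identity is the [CCZ] identity on the diagonal, with the same
     coefficients [b]. *)
  case=> k [Q [E [g ccz]]]; exists k, Q, E; split=> //.
  case: ccz => b bP; exists b => z z' h; have := bP _ _ _ _ _ _ h h h.
  rewrite (eq_bigr (fun j => z 0 j ^+ 3)) => [->|j _]; last by ring.
  by apply: eq_bigr => j _; ring.
have [J [phi /triples[c [c0 codes]]]] := coordinate_frame F S.
pose N n := exists (k : nat) (Q1 Q2 Q3 : css F n) (E1 E2 E3 : 'M[F]_(k, n)),
  [/\ good_code c Q1 E1, good_code c Q2 E2, good_code c Q3 E3 & supports_CCZ Q1 Q2 Q3 E1 E2 E3].
exists c; split=> //; exists N; split; last by split=> //; rewrite ltnNge -ltnS F5.
move=> m; have [n [mn [k [f [fg fc]]]]] := codes m; exists n; split=> //.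
by exists k, (f (phi 0)).1, (f (phi 1)).1, (f (phi 2%:R)).1, (f (phi 0)).2, (f (phi 1)).2, (f (phi 2%:R)).2.
Qed.
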